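(* For $r,s\in\mathbb N$ such that $s\leq r\neq0$, let $1\leq\lambda_1<\cdots<\lambda_s\leq r$, let $a_1,\dots,a_r,b_1,\dots,b_s$ be positive real numbers satisfying, for all $1\leq i\leq r$ and $1\leq j\leq s$, $$b_j>a_i\ \text{ if }i\leq\lambda_j,\qquad b_j>a_i-1\ \text{ if }i\geq\lambda_j+1,$$ and let $(\mu_0,\dots,\mu_{r-1})$ be the vector of measures supported on the whole positive real line if $s<r$ or on the interval $(0,1)$ if $s=r$ with densities $$\mathrm d\mu_k(x)=G^{\,r,0}_{\,s,r}\left(\left.\begin{matrix}b_1^{(k)},\dots,b_s^{(k)}\\ a_1^{(k)},\dots,a_r^{(k)}\end{matrix}\,\right|\,x\right)\frac{\mathrm dx}{x}=G^{\,r,0}_{\,s,r}\left(\left.\begin{matrix}b_1^{(k)}-1,\dots,b_s^{(k)}-1\\ a_1^{(k)}-1,\dots,a_r^{(k)}-1\end{matrix}\,\right|\,x\right)\mathrm dx\qquad\text{for }k\in\{0,\dots,r-1\},$$ where $a_i^{(k)}=a_i+1$ if $1\leq i\leq k$ and $a_i^{(k)}=a_i$ if $k+1\leq i\leq r$, and $b_j^{(k)}=b_j+1$ if $1\leq\lambda_j\leq k$ and $b_j^{(k)}=b_j$ if $k+1\leq\lambda_j\leq r$. Then, the $r$-orthogonal polynomial sequence $(P_n(x))_{n\in\mathbb N}$ with respect to $(\mu_0,\dots,\mu_{r-1})$ is given by $$P_n(x)=\frac{(-1)^n(a_1)_n\cdots(a_r)_n}{\left(b_1^{(n-1)}\right)_n\cdots\left(b_s^{(n-1)}\right)_n}\;{}_{s+1}F_r\left(\left.\begin{matrix}-n,b_1^{(n-1)},\dots,b_s^{(n-1)}\\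 a_1,\dots,a_r\end{matrix}\,\right|\,x\right)\qquad\text{with}\quad b_j^{(n-1)}=b_j+\left\lceil\frac{n-\lambda_j}{r}\right\rceil.$$
   Context: $\mathbb N=\{0,1,2,\dots\}$; $(z)_0=1$, $(z)_n=z(z+1)\cdots(z+n-1)$ for $n\ge1$; ${}_pF_q\left(\left.\begin{matrix}c_1,\dots,c_p\\ d_1,\dots,d_q\end{matrix}\,\right|\,x\right)=\sum_{n\ge0}\frac{(c_1)_n\cdots(c_p)_n}{(d_1)_n\cdots(d_q)_n}\frac{x^n}{n!}$. The Meijer G-function is defined by the Mellin-Barnes integral $$G^{\,r,0}_{\,s,r}\left(\left.\begin{matrix}b_1,\dots,b_s\\ a_1,\dots,a_r\end{matrix}\,\right|\,x\right)=\frac1{2\pi i}\int_{c-i\infty}^{c+i\infty}\frac{\Gamma(a_1+u)\cdots\Gamma(a_r+u)}{\Gamma(b_1+u)\cdots\Gamma(b_s+u)}\,x^{-u}\,\mathrm du,\qquad c>-\min_{1\le i\le r}\mathrm{Re}(a_i).$$ A sequence $(P_n(x))_{n\in\mathbb N}$ of monic polynomials with $\deg P_n=n$ is $r$-orthogonal with respect to $(\mu_0,\dots,\mu_{r-1})$ if, for all $j\in\{0,\dots,r-1\}$ and $k,n\in\mathbb N$, $\int x^kP_n(x)\,\mathrm d\mu_j(x)\neq0$ if $n=rk+j$ and $\int x^kP_n(x)\,\mathrm d\mu_j(x)=0$ if $n\geq rk+j+1$. *)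

(* Defs.v *)
From HB Require Import structures.
From mathcomp Require Import all_boot all_order all_algebra.
From mathcomp Require Import all_classical all_reals all_analysis.
From mathcomp Require Import complex.
Set Implicit Arguments.
Unset Strict Implicit.
Unset Printing Implicit Defensive.
Import Order.TTheory GRing.Theory Num.Theory.
Import numFieldNormedType.Exports.
Local Open Scope classical_set_scope.
Local Open Scope ring_scope.
Local Open Scope complex_scope.

Definition pochhammer (A : pzRingType) (z : A) (n : nat) : A :=
  \prod_(i < n) (z + i%:R).

(* [c] lists the upper parameters and [d] the lower ones *)
Definition hypergeometric (R : realType) (c d : seq R) (x : R) : R :=
  limn (series (fun n : nat =>
    (\prod_(z <- c) pochhammer z n) / (\prod_(z <- d) pochhammer z n)
    * (x ^+ n / n`!%:R))).

Section complex_functions.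
Variable R : realType.
Implicit Types (x c : R) (z u : R[i]).

Definition cexp z : R[i] :=
  (expR (complex.Re z))%:C * (cos (complex.Im z) +i* sin (complex.Im z)).

(* principal power, meaningful for [0 < x] *)
Definition cpow x z : R[i] := cexp (z * (ln x)%:C).

Definition cintegral (D : set R) (f : R -> R[i]) : R[i] :=
  (\int[lebesgue_measure]_(t in D) complex.Re (f t))
  +i* (\int[lebesgue_measure]_(t in D) complex.Im (f t)).

Definition euler_integral z : R[i] :=
  cintegral `]0, +oo[ (fun t => cpow t (z - 1) * (expR (- t))%:C).

(* Euler's integral when [0 < Re z]; elsewhere its meromorphic continuation by
   Gamma(z) = Gamma(z + n) / (z)_n, with [n] such that [0 < Re (z + n)].
   Since [0^-1 = 0], at a pole of Gamma both [Gamma z] and [(Gamma z)^-1] are 0;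
   for the latter this is the value of the entire function 1 / Gamma. *)
Definition Gamma z : R[i] :=
  let n := if 0 < complex.Re z then 0%N else (Num.truncn (- complex.Re z)).+1 in
  euler_integral (z + n%:R) / pochhammer z n.

(* An improper integral: for [s = r] the Mellin-Barnes integrand below need not
   be Lebesgue integrable, so the two half-lines are handled by limits. *)
Definition improper_integral (g : R -> R) : R :=
  lim ((fun T : R => \int[lebesgue_measure]_(t in `[- T, 0]) g t) @ +oo)
  + lim ((fun T : R => \int[lebesgue_measure]_(t in `[0, T]) g t) @ +oo).

(* integral of [f] from c - i oo to c + i oo, parametrized by u = c + i t *)
Definition vertical_integral c (f : R[i] -> R[i]) : R[i] :=
  (0 +i* 1) * (improper_integral (fun t => complex.Re (f (c +i* t)))
               +i* improper_integral (fun t => complex.Im (f (c +i* t)))).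

(* G^{r,0}_{s,r}(b; a | x), computed on the contour Re u = c *)
Definition meijerG (s r : nat) c (b : 'I_s -> R[i]) (a : 'I_r -> R[i]) x
    : R[i] :=
  (2 * (0 +i* pi))^-1 *
  vertical_integral c (fun u =>
    (\prod_(i < r) Gamma (a i + u)) / (\prod_(j < s) Gamma (b j + u))
    * cpow x (- u)).

End complex_functions.

Definition r_orthogonal (R : realType) (r : nat)
    (mu : 'I_r -> {measure set (measurableTypeR R) -> \bar R})
    (P : nat -> {poly R}) : Prop :=
  [/\ forall n, P n \is monic /\ size (P n) = n.+1,
      forall (j : 'I_r) (k n : nat),
        (mu j).-integrable setT (fun x => (x ^+ k * (P n).[x])%:E),
      forall (j : 'I_r) (k n : nat), n = (r * k + j)%N ->
        \int[mu j]_x (x ^+ k * (P n).[x]) <> 0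
    & forall (j : 'I_r) (k n : nat), (r * k + j + 1 <= n)%N ->
        \int[mu j]_x (x ^+ k * (P n).[x]) = 0].

(* [mu] is concentrated on [D], with density [w] there *)
Definition has_density (R : realType)
    (mu : {measure set (measurableTypeR R) -> \bar R}) (D : set R) (w : R -> R)
    : Prop :=
  measurable_fun (D : set (measurableTypeR R)) w /\
  forall A : set (measurableTypeR R), measurable A ->
    mu A = (\int[lebesgue_measure]_(x in A `&` D) (w x)%:E)%E.

Definition support_set (R : realType) (s r : nat) : set R :=
  if (s < r)%N then `]0, +oo[%classic else `]0, 1[%classic.

(* The parameters a_1, ..., a_r are [a i] with [i : 'I_r] numbered from 0, so
   a_i in the usual numbering is [a] at i - 1; likewise for b and lambda.  The
   values of [lam] keep the numbering from 1. *)
Definition ashift (R : realType) (r : nat) (a : 'I_r -> R) (k : nat) (i : 'I_r)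
    : R :=
  if (i.+1 <= k)%N then a i + 1 else a i.

Definition bshift (R : realType) (s : nat) (lam : 'I_s -> nat) (b : 'I_s -> R)
    (k : nat) (j : 'I_s) : R :=
  if (lam j <= k)%N then b j + 1 else b j.

(* b_j^{(n-1)} for arbitrary [n]; it is [bshift lam b n.-1 j] if 1 <= n <= r *)
Definition bpred (R : realType) (r s : nat) (lam : 'I_s -> nat) (b : 'I_s -> R)
    (n : nat) (j : 'I_s) : R :=
  b j + (Num.ceil ((n%:R - (lam j)%:R) / r%:R : R))%:~R.

(* Main.v *)
(* Put [x = exp (- xi)].  On the line Re z = a > 0, t |-> Gamma(a + i t) is the
   Fourier transform of exp (- a xi) exp (- exp (- xi)) and, for b > a,
   Gamma(a + i t) / Gamma(b + i t) is that of a beta density.  As b_j > a_i for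
   i = lambda_j, pairing b_j with a_(lambda_j) exhibits the quotient of Gamma
   products as the Fourier transform of a convolution D of r nonnegative
   integrable functions.  Away from 0 (everywhere if s < r) D is Lipschitz, so
   the Mellin-Barnes integral converges to D by Fourier inversion; hence the
   G-function does not depend on the contour, and its moments are
   prod_i Gamma(a_i + n) / prod_j Gamma(b_j + n).

   Testing P_n against x^k d mu_j, with N = r k + j, gives up to a nonzero factor
   the alternating sum of (-1)^m C(n, m) F(m).  If N < n, F is a polynomial of
   degree < n and the sum vanishes.  If N = n, F is either a monic polynomial of
   degree n or such a polynomial over a linear factor, and the inequalities
   between the a_i and b_j keep the sum from vanishing.  Uniqueness follows since
   the functionals are triangular with respect to (P_n). *)

Require Import Defs.
From HB Require Import structures.
From mathcomp Require Import all_boot all_order all_algebra.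
From mathcomp Require Import all_classical all_reals all_analysis.
From mathcomp Require Import measurable_realfun complex.
From mathcomp Require Import zify ring lra.
Import Order.TTheory GRing.Theory Num.Theory.
Import numFieldNormedType.Exports.
Set Implicit Arguments.
Unset Strict Implicit.
Unset Printing Implicit Defensive.
Local Open Scope classical_set_scope.
Local Open Scope ring_scope.

(** The G-function identities are asserted at every point of the support, so inversion almost
    everywhere would not do, and for [s = r] the transform of [D] need not be integrable. Pointwise
    inversion under a local Lipschitz condition meets both demands; it calls for a class of
    densities ([regular]) that is stable under convolution although beta densities may blow up or
    jump at 0. Reading Gamma(a + i t) / Gamma(b + i t) off the convolution of a Gamma with a beta
    density requires a division by Gamma(b + i t), so the nonvanishing of Gamma in the right
    half-plane is proved on the way. The abscissa of the contour, the passage between the two forms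
    of the density and the moments are one phenomenon: adding a constant to all parameters
    multiplies [D] by an exponential. On the algebraic side, the moment of order [k + m] of the
    [j]-th measure depends on [j] and [k] only through [N = r k + j]: going from [N] to [N + 1]
    raises one [a_i] and, if [i] is some [lambda_j], also [b_j]. Degrees are then counts of such
    steps. *)

Section density.
Context d (T : measurableType d) (R : realType).
Variables (mu nu : {measure set T -> \bar R}) (D : set T) (h : T -> R).
Hypotheses (mD : measurable D) (mh : measurable_fun D h).
Hypothesis h_ge0 : forall x, D x -> 0 <= h x.
Hypothesis nuE : forall A, measurable A ->
  nu A = (\int[mu]_(x in A `&` D) (h x)%:E)%E.
Local Open Scope ereal_scope.

Import HBNNSimple.

(** [nuE] is the case of indicator functions, the only form in which a density is given here.
    Monotone convergence along simple functions, on both sides, carries it over to nonnegative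
    [f]. *)
Lemma ge0_integral_density (f : T -> \bar R) :
  measurable_fun setT f -> (forall x, 0 <= f x) ->
  \int[nu]_x f x = \int[mu]_(x in D) (f x * (h x)%:E).
Proof.
move=> mf f0; pose g := nnsfun_approx measurableT mf.
have mgD n : measurable_fun D (g n).
  exact/measurable_funTS/measurable_funP.
have -> : \int[nu]_x f x = limn (fun n => \int[nu]_x (g n x)%:E).
  rewrite -monotone_convergence//.
  - apply: eq_integral => x _; apply/esym/cvg_lim => //.
    by apply: cvg_nnsfun_approx => // ? _; exact: f0.
  - by move=> n; exact/measurable_EFinP/measurable_funP.
  - by move=> n x _; rewrite lee_fin.
  - by move=> x _ m n mn; rewrite lee_fin; exact/lefP/nd_nnsfun_approx.
have -> : \int[mu]_(x in D) (f x * (h x)%:E) =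
    limn (fun n => \int[mu]_(x in D) ((g n x)%:E * (h x)%:E)).
  rewrite -monotone_convergence//.
  - apply: eq_integral => x _; apply/esym/cvg_lim => //; apply: cvgeZr => //.
    by apply: cvg_nnsfun_approx => // ? _; exact: f0.
  - by move=> n; apply/emeasurable_funM; exact/measurable_EFinP.
  - by move=> n x Dx; rewrite mule_ge0 ?lee_fin ?h_ge0.
  - move=> x Dx m n mn; rewrite lee_wpmul2r ?lee_fin ?h_ge0//.
    exact/lefP/nd_nnsfun_approx.
congr (limn _); apply/funext => n.
have mk k : measurable (g n @^-1` [set k]) by exact: measurable_sfunP.
under eq_integral do rewrite fimfunE -fsumEFin//.
rewrite ge0_integral_fsum//; last 2 first.
- by move=> y; exact/measurable_EFinP/measurable_funM.
- by move=> y x _; rewrite nnfun_muleindic_ge0.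
under [RHS]eq_integral => x xD.
  rewrite fimfunE -fsumEFin// ge0_mule_fsuml; last first.
    by move=> y; exact: nnfun_muleindic_ge0.
  over.
rewrite ge0_integral_fsum//; last 2 first.
- move=> y; apply: emeasurable_funM; last exact/measurable_EFinP.
  by apply/measurable_funTS/measurable_EFinP/measurable_funM.
- by move=> y x Dx; rewrite mule_ge0 ?nnfun_muleindic_ge0 ?lee_fin ?h_ge0.
apply: eq_fsbigr => r rg.
have r0 : (0 <= r)%R by move: rg; rewrite inE => -[t _ <-].
rewrite integralZl_indic_nnsfun// integral_indic// setIT nuE//.
under [RHS]eq_integral do rewrite EFinM -muleA.
rewrite ge0_integralZl//; last 2 first.
- by apply: emeasurable_funM; apply/measurable_EFinP.
- by move=> x Dx; rewrite mule_ge0 ?lee_fin ?h_ge0.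
congr (_ * _); under [RHS]eq_integral do rewrite muleC.
rewrite setIC integral_mkcondr.
by apply: eq_integral => x _; rewrite epatch_indic.
Qed.

Lemma integrable_density (f : T -> R) : measurable_fun setT f ->
  nu.-integrable setT (EFin \o f) <->
  mu.-integrable D (EFin \o (f \* h)%R).
Proof.
move=> mf.
have E : \int[nu]_x `|(f x)%:E| = \int[mu]_(x in D) `|(f x * h x)%:E|.
  rewrite ge0_integral_density//; last exact/measurableT_comp/measurable_EFinP.
  apply: eq_integral => x; rewrite inE => Dx.
  by rewrite EFinM abseM (@gee0_abs _ (h x)%:E)// lee_fin h_ge0.
have mfh : measurable_fun D (f \* h)%R.
  by apply: measurable_funM => //; exact: measurable_funTS.
split=> /integrableP[_ fi]; apply/integrableP; split => /=.
- exact/measurable_EFinP.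
- by rewrite -E.
- exact/measurable_EFinP.
- by rewrite E.
Qed.

(** No integrability is assumed: both sides are [fine] of a difference of integrals of positive and
    negative parts, and these agree separately because [h] is nonnegative on [D]. *)
Lemma Rintegral_density (f : T -> R) : measurable_fun setT f ->
  (\int[nu]_x f x = \int[mu]_(x in D) (f x * h x))%R.
Proof.
move=> mf; congr fine; rewrite integralE [RHS]integralE.
have mF : measurable_fun setT (EFin \o f) by exact/measurable_EFinP.
rewrite ge0_integral_density//; last exact: measurable_funepos.
rewrite ge0_integral_density//; last exact: measurable_funeneg.
congr (_ - _); apply: eq_integral => x; rewrite inE => Dx.
- by rewrite !funeposE /= -!EFin_max -EFinM maxr_pMl ?h_ge0// mul0r.
- by rewrite !funenegE /= -!EFin_max -EFinM maxr_pMl ?h_ge0// mul0r mulNr.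
Qed.

End density.

(** * The substitution x = exp (- xi) for Lebesgue integrals *)

Section change_of_variables.
Context {R : realType}.
Local Open Scope ereal_scope.
Local Notation mu := (@lebesgue_measure R).
Implicit Type f : R -> \bar R.

Lemma lebesgue_measureDr (a : R) (A : set (measurableTypeR R)) : measurable A ->
  pushforward mu ((+%R a) : _ -> measurableTypeR R) A = mu A.
Proof.
have ma : measurable_fun [set: R] (+%R a) by exact: measurable_funD.
move=> mA; apply/esym.
apply: lebesgue_measure_unique => //= _ [[x y]] _ <-.
rewrite /pushforward /=.
have -> : +%R a @^-1` `]x, y]%classic = `](x - a)%R, (y - a)%R]%classic.
  by apply/seteqP; split=> z /=; rewrite !in_itv/=; lra.
rewrite !lebesgue_measure_itv/= !lte_fin ltrD2r; case: ifP => // _.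
by rewrite -!EFinB; congr (EFin _); lra.
Qed.

Lemma ge0_integral_addl f (a : R) : measurable_fun setT f -> (forall x, 0 <= f x) ->
  \int[mu]_x f (a + x)%R = \int[mu]_x f x.
Proof.
move=> mf f0.
have ma : measurable_fun [set: R] (+%R a) by exact: measurable_funD.
rewrite -[LHS](@ge0_integral_pushforward _ _ (measurableTypeR R) (measurableTypeR R) _ _ ma mu setT f)//.
by apply: eq_measure_integral => A mA _; exact: lebesgue_measureDr.
Qed.

Lemma ge0_integral_opp f : measurable_fun setT f -> (forall x, 0 <= f x) ->
  \int[mu]_x f (- x)%R = \int[mu]_x f x.
Proof.
move=> mf f0.
have ma : measurable_fun [set: R] (@GRing.opp R) by exact: oppr_measurable.
rewrite -[LHS](@ge0_integral_pushforward _ _ (measurableTypeR R) (measurableTypeR R) _ _ ma mu setT f)//.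
by apply: eq_measure_integral => A mA _; exact: lebesgue_measureN.
Qed.

Lemma ge0_integral_subl f (a : R) : measurable_fun setT f -> (forall x, 0 <= f x) ->
  \int[mu]_x f (a - x)%R = \int[mu]_x f x.
Proof.
move=> mf f0.
rewrite (ge0_integral_opp (f := fun x => f (a + x)%R))//; first exact: ge0_integral_addl.
by apply: measurableT_comp => //; exact: measurable_funD.
Qed.

(** The image of this measure under x |-> exp (- x) is Lebesgue measure on []0, +oo[], which is the
    change of variables used throughout. *)
Definition expN_measure (A : set (measurableTypeR R)) : \bar R :=
  \int[mu]_(x in A) (expR (- x))%:E.

Lemma measurable_expN : measurable_fun [set: R] (fun x => expR (- x)).
Proof. by apply: measurableT_comp => //; exact: oppr_measurable. Qed.

Let expN_measure0 : expN_measure set0 = 0.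
Proof. exact: integral_set0. Qed.

Let expN_measure_ge0 A : 0 <= expN_measure A.
Proof. by apply: integral_ge0 => x _; rewrite lee_fin expR_ge0. Qed.

Let expN_measure_sigma_additive : semi_sigma_additive expN_measure.
Proof.
apply: semi_sigma_additive_nng_induced.
  have /measurable_EFinP m := measurable_expN.
  exact: m.
by move=> x; rewrite lee_fin expR_ge0.
Qed.

HB.instance Definition _ := isMeasure.Build _ _ _ expN_measure
  expN_measure0 expN_measure_ge0 expN_measure_sigma_additive.

Lemma integral_derive (f F : R -> R) (a b : R) : (a < b)%R ->
  (forall x : R, is_derive x 1%R F (f x)) -> continuous f ->
  \int[mu]_(x in `[a, b]) (f x)%:E = (F b - F a)%:E.
Proof.
move=> ab dF cf.
have cF : continuous F.
  by move=> x; apply/differentiable_continuous/derivable1_diffP; have [] := dF x.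
rewrite (continuous_FTC2 ab (F := F)) ?EFinB//.
- exact: continuous_subspaceT.
- split => [x _||]; first by have [] := dF x.
  + exact/cvg_at_right_filter/cF.
  + exact/cvg_at_left_filter/cF.
- by move=> x _; rewrite derive1E; have [_ ->] := dF x.
Qed.

Lemma ge0_integral_derivey (f F : R -> R) (a l : R) :
  (forall x : R, is_derive x 1%R F (f x)) -> continuous f ->
  (forall x, a <= x -> 0 <= f x)%R -> F x @[x --> +oo%R] --> l ->
  \int[mu]_(x in `[a, +oo[) (f x)%:E = (l - F a)%:E.
Proof.
move=> dF cf f0 Fl.
have cF : continuous F.
  by move=> x; apply/differentiable_continuous/derivable1_diffP; have [] := dF x.
rewrite (ge0_continuous_FTC2y f0 (F := F) (l := l)) ?EFinB//.
- exact: continuous_subspaceT.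
- exact/cvg_at_right_filter/cF.
- by move=> x _; rewrite derive1E; have [_ ->] := dF x.
Qed.

Lemma is_derive_expN (x : R) :
  is_derive x 1%R (fun x => - expR (- x))%R (expR (- x))%R.
Proof.
have : is_derive x 1%R (expR \o -%R) (expR (- x) * -1)%R.
  apply: is_derive1_comp.
by move=> /is_deriveN; rewrite mulrN1 opprK.
Qed.

Lemma continuous_expN : continuous (fun x : R => expR (- x)).
Proof. by move=> x; apply: continuous_comp; [exact: opp_continuous|exact: continuous_expR]. Qed.

Lemma expN_measure_cc (a b : R) : (a < b)%R ->
  expN_measure `[a, b] = (expR (- a) - expR (- b))%:E.
Proof.
move=> ab; rewrite /expN_measure (integral_derive ab is_derive_expN) ?opprK.
  by rewrite addrC.
exact: continuous_expN.
Qed.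

Lemma expN_measure_co (a b : R) : (a < b)%R ->
  expN_measure `[a, b[ = (expR (- a) - expR (- b))%:E.
Proof.
move=> ab; rewrite /expN_measure integral_itv_bndo_bndc; last first.
  have /measurable_EFinP m := measurable_expN.
  exact: (measurable_funTS m).
by rewrite -/(expN_measure _) expN_measure_cc.
Qed.

Lemma expN_measure_cy (a : R) : expN_measure `[a, +oo[ = (expR (- a))%:E.
Proof.
rewrite /expN_measure (ge0_integral_derivey (l := 0%R) is_derive_expN) ?opprK ?add0r//.
- exact: continuous_expN.
- by rewrite -[0%R]oppr0; apply: cvgN; exact: cvgr_expR.
Qed.

(** Lebesgue measure is characterized by its values on all intervals []x, y]], but the image measure
    lives on []0, +oo[] only. It is therefore completed by Lebesgue measure restricted to []-oo,
    0]], and the sum is checked according to the signs of [x] and [y]. *)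
Lemma pushforward_expN_measure (A : set (measurableTypeR R)) : measurable A ->
  A `<=` `]0%R, +oo[%classic ->
  pushforward expN_measure ((fun x => expR (- x)) : _ -> measurableTypeR R) A = mu A.
Proof.
move=> mA A0; pose B : set (measurableTypeR R) := `]-oo, 0%R]%classic.
have mB : measurable B by exact: measurable_itv.
have AB : A `&` B = set0.
  rewrite -subset0 => x [/A0] /=; rewrite /B/= !in_itv/= andbT => x0.
  by rewrite leNgt x0.
pose e : measurableTypeR R -> measurableTypeR R := fun x => expR (- x).
have me : measurable_fun (setT : set (measurableTypeR R)) e by exact: measurable_expN.
pose P : {measure set (measurableTypeR R) -> \bar R} :=
  measure_function_pushforward__canonical__measure_function_Measure expN_measure me.
have -> : mu A = measure_add P (mrestr mu mB) A; last first.
  by rewrite measure_addE /= /mrestr AB measure0 adde0.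
apply: lebesgue_measure_unique => // _ [[x y]] _ <-.
rewrite -[RHS]/(measure_add P (mrestr mu mB) `]x, y]%classic) measure_addE.
pose I : set (measurableTypeR R) := `]x, y]%classic.
suff : mu I = expN_measure (e @^-1` I) + mu (I `&` B) by [].
have [y0|y0] := leP y 0%R.
  have -> : e @^-1` I = set0.
    rewrite -subset0 => z; rewrite /I /e /= in_itv/= => /andP[_ zy].
    by have := lt_le_trans (expR_gt0 (- z)) (le_trans zy y0); rewrite ltxx.
  rewrite [X in X + _]expN_measure0 add0e; congr (mu _); apply/seteqP; split=> z; rewrite /I /=.
    by rewrite /I /B /= !in_itv/= => /andP[-> zy]; split => //; exact: le_trans y0.
  by case.
have [x0|x0] := leP x 0%R.
  have -> : e @^-1` I = `[(- ln y)%R, +oo[%classic.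
    apply/seteqP; split=> z; rewrite /I /e /= !in_itv/=.
      move=> /andP[_]; rewrite andbT -{1}(lnK y0) ler_expR; lra.
    rewrite andbT => zy; rewrite (le_lt_trans x0 (expR_gt0 _))/=.
    by rewrite -{1}(lnK y0) ler_expR; lra.
  rewrite expN_measure_cy opprK lnK//.
  have -> : I `&` B = `]x, 0%R]%classic.
    apply/seteqP; split=> z /=; rewrite /I /B/= !in_itv/= => ?; lra.
  rewrite /I !lebesgue_measure_itv/= !lte_fin (le_lt_trans x0 y0).
  case: ltP => [_|]; first by rewrite -EFinB -EFinD; congr (EFin _); lra.
  by move=> ?; rewrite adde0 -EFinB; congr (EFin _); lra.
have -> : I `&` B = set0.
  rewrite -subset0 => z /=; rewrite /I /B/= !in_itv/= => -[/andP[xz _] z0].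
  by have := lt_le_trans (lt_trans x0 xz) z0; rewrite ltxx.
rewrite measure0 adde0.
have -> : e @^-1` I = `[(- ln y)%R, (- ln x)%R[%classic.
  apply/seteqP; split=> z; rewrite /I /e /= !in_itv/=.
    by rewrite -{1}(lnK y0) -{1}(lnK x0) ler_expR ltr_expR; lra.
  by rewrite -{2}(lnK y0) -{2}(lnK x0) ler_expR ltr_expR; lra.
rewrite /I lebesgue_measure_itv/= lte_fin; case: ltP => xy.
  by rewrite expN_measure_co ?ltrN2 ?ltr_ln// !opprK !lnK// EFinB.
by rewrite set_itv_ge ?measure0// -leNgt bnd_simp lerN2 ler_ln.
Qed.

Let e : measurableTypeR R -> measurableTypeR R := fun x => expR (- x).

Let me : measurable_fun (setT : set (measurableTypeR R)) e.
Proof. exact: measurable_expN. Qed.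

Let e_gt0 : e @^-1` `]0%R, +oo[%classic = setT.
Proof. by apply/seteqP; split => // x _; rewrite /e /= in_itv/= expR_gt0. Qed.

Lemma measurable_comp_expN d (T : measurableType d) (f : R -> T) :
  measurable_fun (`]0%R, +oo[%classic : set R) f ->
  measurable_fun [set: R] (fun x => f (expR (- x))).
Proof.
move=> mf; apply: (measurable_comp _ _ mf (g := e)) => //=.
by move=> _ [x _ <-]; rewrite /= in_itv/= /e expR_gt0.
Qed.

Lemma ge0_integral_expN (f : R -> \bar R) :
  measurable_fun (`]0%R, +oo[%classic : set R) f ->
  (forall x, (0 < x)%R -> 0 <= f x) ->
  \int[mu]_(x in `]0%R, +oo[) f x = \int[mu]_x (f (expR (- x)) * (expR (- x))%:E).
Proof.
move=> mf f0.
transitivity (\int[pushforward expN_measure e]_(x in `]0%R, +oo[) f x).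
  by apply: eq_measure_integral => A mA A0; apply/esym; exact: pushforward_expN_measure.
rewrite ge0_integral_pushforward//; last first.
  by move=> x; rewrite inE/= in_itv/= andbT => /f0.
rewrite e_gt0 (@ge0_integral_density _ (measurableTypeR R) _ mu _ setT (fun x => expR (- x)))//.
- by move=> A mA; rewrite setIT.
- exact: measurable_comp_expN.
- by move=> x; apply: f0; exact: expR_gt0.
Qed.

Lemma Rintegral_expN (f : R -> R) :
  measurable_fun (`]0%R, +oo[%classic : set R) f ->
  (\int[mu]_(x in `]0%R, +oo[) f x = \int[mu]_x (f (expR (- x)) * expR (- x)))%R.
Proof.
move=> mf; have /measurable_EFinP mF := mf.
congr fine; rewrite integralE [RHS]integralE.
rewrite ge0_integral_expN//; last exact: measurable_funepos.
rewrite ge0_integral_expN//; last exact: measurable_funeneg.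
congr (_ - _); apply: eq_integral => x _.
  by rewrite !funeposE /= -!EFin_max -EFinM maxr_pMl ?expR_ge0// mul0r.
by rewrite !funenegE /= -!EFin_max -EFinM maxr_pMl ?expR_ge0// mul0r mulNr.
Qed.

Lemma integrable_expN (f : R -> R) :
  measurable_fun (`]0%R, +oo[%classic : set R) f ->
  mu.-integrable `]0%R, +oo[ (EFin \o f) <->
  mu.-integrable setT (fun x => (f (expR (- x)) * expR (- x))%:E).
Proof.
move=> mf; have /measurable_EFinP mF := mf.
have mg : measurable_fun [set: R] (fun x => f (expR (- x)) * expR (- x))%R.
  by apply: measurable_funM; [exact: measurable_comp_expN|exact: measurable_expN].
have E : \int[mu]_(x in `]0%R, +oo[) `|(f x)%:E| =
    \int[mu]_x `|(f (expR (- x)) * expR (- x))%:E|.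
  rewrite ge0_integral_expN//; last exact: measurableT_comp.
  by apply: eq_integral => x _; rewrite EFinM abseM [`|(expR _)%:E|]gee0_abs// lee_fin expR_ge0.
have /measurable_EFinP mG := mg.
split=> /integrableP[_ fi]; apply/integrableP; split => //.
  by rewrite -E.
by rewrite E.
Qed.

End change_of_variables.

(** * Integrable functions on the real line *)

Section L1.
Context {R : realType}.
Local Notation mu := (@lebesgue_measure R).
Implicit Types (f g h : R -> R) (a k M : R).

Definition L1 f := mu.-integrable setT (EFin \o f).

Lemma L1P f : L1 f <->
  measurable_fun [set: R] f /\ (\int[mu]_x `|f x|%:E < +oo)%E.
Proof.
split=> [/integrableP[/measurable_EFinP mf fi]|[mf fi]]; first by split.
by apply/integrableP; split => //; have /measurable_EFinP := mf; exact.
Qed.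

Lemma L1_measurable f : L1 f -> measurable_fun [set: R] f.
Proof. by case/L1P. Qed.

Lemma L1D f g : L1 f -> L1 g -> L1 (fun x => f x + g x).
Proof. by move=> f1 g1; exact: (integrableD _ f1 g1). Qed.

Lemma L1B f g : L1 f -> L1 g -> L1 (fun x => f x - g x).
Proof. by move=> f1 g1; exact: (integrableB _ f1 g1). Qed.

Lemma L1Z k f : L1 f -> L1 (fun x => k * f x).
Proof. by move=> f1; exact: (integrableZl _ k f1). Qed.

Lemma L1_norm f : L1 f -> L1 (fun x => `|f x|).
Proof. by move=> f1; exact: integrable_norm f1. Qed.

Lemma L1_le f g : measurable_fun [set: R] f -> (forall x, `|f x| <= g x) ->
  L1 g -> L1 f.
Proof.
move=> mf fg g1; have /measurable_EFinP mF := mf.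
apply: (@le_integrable _ (measurableTypeR R) R mu setT measurableT _ _ mF _ g1).
by move=> x _; rewrite lee_fin (le_trans (fg x))// ler_norm.
Qed.

Lemma L1_bounded f h M : L1 f -> measurable_fun [set: R] h ->
  (forall x, `|h x| <= M) -> L1 (fun x => f x * h x).
Proof.
move=> f1 mh hM; apply: (@L1_le _ (fun x => M * `|f x|)).
- by apply: measurable_funM => //; exact: L1_measurable.
- by move=> x; rewrite normrM mulrC ler_wpM2r.
- exact/L1Z/L1_norm.
Qed.

Lemma L1_subl f a : L1 f -> L1 (fun x => f (a - x)).
Proof.
case/L1P => mf fi; apply/L1P; split.
  by apply: (measurableT_comp mf); exact: measurable_funB.
rewrite (ge0_integral_subl (f := fun x => `|f x|%:E))//.
exact/measurable_EFinP/measurableT_comp.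
Qed.

Lemma Rintegral_subl f a : measurable_fun [set: R] f ->
  \int[mu]_x f (a - x) = \int[mu]_x f x.
Proof.
move=> mf; congr fine.
pose p x := (Num.max (f x) 0)%:E; pose n x := (Num.max (- f x) 0)%:E.
have E (F : R -> R) (q : R -> \bar R) : (forall x, q x = (Num.max (F x) 0)%:E) ->
    measurable_fun [set: R] F -> (\int[mu]_x q (a - x)%R = \int[mu]_x q x)%E.
  move=> qE mF; apply: ge0_integral_subl => [|x].
    rewrite (funext qE); apply/measurable_EFinP.
    exact: measurable_maxr.
  by rewrite qE lee_fin le_max lexx orbT.
transitivity (\int[mu]_x p (a - x)%R - \int[mu]_x n (a - x)%R)%E.
  rewrite integralE; congr (_ - _)%E; apply: eq_integral => x _.
    by rewrite funeposE -EFin_max.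
  by rewrite funenegE -EFin_max.
rewrite (E f)// (E (fun x => - f x))//; last exact: measurableT_comp.
rewrite [RHS]integralE; congr (_ - _)%E; apply: eq_integral => x _.
  by rewrite funeposE -EFin_max.
by rewrite funenegE -EFin_max.
Qed.

Lemma Rintegral_opp f : measurable_fun [set: R] f ->
  \int[mu]_x f (- x) = \int[mu]_x f x.
Proof.
by move=> mf; rewrite -(Rintegral_subl 0 mf); apply: eq_Rintegral => x _; rewrite sub0r.
Qed.

Lemma Rintegral_addl f a : measurable_fun [set: R] f ->
  \int[mu]_x f (a + x) = \int[mu]_x f x.
Proof.
move=> mf; rewrite -(Rintegral_subl a mf).
rewrite -(@Rintegral_opp (fun x => f (a - x))); last first.
  by apply: (measurableT_comp mf); exact: measurable_funB.
by apply: eq_Rintegral => x _; rewrite opprK.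
Qed.

Lemma L1_addr f a : L1 f -> L1 (fun x => f (x + a)).
Proof.
move=> f1; have := L1_subl 0 (L1_subl a f1).
by rewrite /L1; apply: eq_integrable => // x _ /=; rewrite sub0r opprK addrC.
Qed.

Lemma le_norm_RintegralM f M : L1 f -> forall h, L1 h ->
  (forall x, `|h x| <= M * `|f x|) -> `|\int[mu]_x h x| <= M * \int[mu]_x `|f x|.
Proof.
move=> f1 h h1 hf; apply: (le_trans (le_normr_Rintegral _ h1)) => //.
rewrite -RintegralZl//; last exact: L1_norm.
apply: le_Rintegral => //; first exact: L1_norm.
exact/L1Z/L1_norm.
Qed.

Lemma L1_EFinE f : L1 f -> (\int[mu]_x (f x)%:E = (\int[mu]_x f x)%:E)%E.
Proof. by move=> f1; rewrite fineK//; exact: integrable_fin_num f1. Qed.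

End L1.

(** * Convolution and Fubini's theorem *)

Section convolution.
Context {R : realType}.
Local Notation mu := (@lebesgue_measure R).
Implicit Types (f g h phi : R -> R) (A : set R) (M : R).

Definition convolution f g (x : R) : R := \int[mu]_y (f (x - y) * g y).

Lemma convolutionC f g : measurable_fun [set: R] f -> measurable_fun [set: R] g ->
  convolution f g = convolution g f.
Proof.
move=> mf mg; apply/funext => x.
rewrite /convolution -[RHS](@Rintegral_subl _ _ x); last first.
  apply: measurable_funM => //; apply: (measurableT_comp mg).
  exact: measurable_funB.
by apply: eq_Rintegral => y _; rewrite subKr mulrC.
Qed.

(** Tonelli with [x] integrated first: by translation invariance the inner integral is the norm of
    [f] times [|g y|]. *)
Lemma L1_convolution_prod f g : L1 f -> L1 g ->
  ((mu \x mu)%E).-integrable setT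
    (fun z : measurableTypeR R * measurableTypeR R => (f (z.1 - z.2) * g z.2)%:E).
Proof.
move=> f1 g1.
have mf := L1_measurable f1; have mg := L1_measurable g1.
have mF : measurable_fun [set: measurableTypeR R * measurableTypeR R]
    (fun z : measurableTypeR R * measurableTypeR R => (f (z.1 - z.2) * g z.2)%:E).
  have m1 : measurable_fun [set: R * R] (fun z : R * R => f (z.1 - z.2)).
    by apply: (measurableT_comp mf); exact: measurable_funB.
  have m2 : measurable_fun [set: R * R] (fun z : R * R => g z.2).
    exact: (measurableT_comp mg).
  have /measurable_EFinP := measurable_funM m1 m2; exact.
apply/(integrable21ltyP _ _ mF) => /=.
have -> : (\int[mu]_y \int[mu]_x `|(f (x - y) * g y)%:E| =
  \int[mu]_y ((\int[mu]_x `|f x|) * `|g y|)%:E)%E.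
  apply: eq_integral => y _; rewrite EFinM -(L1_EFinE (L1_norm f1)).
  rewrite -(ge0_integral_addl (f := fun x => `|f x|%:E) (- y))//; last first.
    exact/measurable_EFinP/measurableT_comp.
  rewrite -ge0_integralZr//; first last.
  - exact/measurable_EFinP/measurableT_comp/(measurableT_comp mf)/measurable_funD.
  by apply: eq_integral => x _; rewrite -EFinM -normrM addrC.
exact/integrable_lty/L1Z/L1_norm.
Qed.

(** Fubini against a bounded test function: cosine and sine give the transform of the convolution,
    the constant 1 its mass. Fubini alone makes the convolution integral converge for almost every
    [x]; the last hypothesis makes [convolution f g] a genuine integral everywhere. *)
Lemma integral_convolution f g phi M : L1 f -> L1 g ->
  measurable_fun [set: R] phi -> (forall x, `|phi x| <= M) ->
  (forall x, L1 (fun y => f (x - y) * g y)) ->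
  L1 (convolution f g) /\
  \int[mu]_x (convolution f g x * phi x) =
  \int[mu]_y (g y * \int[mu]_x (f x * phi (x + y))).
Proof.
move=> f1 g1 mp pM fg1; have F1 := L1_convolution_prod f1 g1.
have mf := L1_measurable f1; have mg := L1_measurable g1.
split.
  have := integrable_fubini_F F1; apply: eq_integrable => // x _.
  by rewrite /fubini_F /= L1_EFinE.
have G1 : ((mu \x mu)%E).-integrable setT
    (fun z : measurableTypeR R * measurableTypeR R => (f (z.1 - z.2) * g z.2 * phi z.1)%:E).
  have mp1 : measurable_fun [set: measurableTypeR R * measurableTypeR R]
    (fun z : measurableTypeR R * measurableTypeR R => phi z.1).
    exact: (measurableT_comp mp).
  have := integrableMl measurableT F1 mp1; apply; exists M.
  split=> [|x Mx z _ /=]; first exact: num_real.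
  by rewrite (le_trans (pM _))// ltW.
have /(congr1 fine) := Fubini G1; rewrite /=.
rewrite -[LHS]/(fine _) => H.
transitivity (fine (\int[mu]_x (\int[mu]_y (f (x - y) * g y * phi x)%:E)))%E.
  congr fine; apply: eq_integral => x _.
  have h1 : L1 (fun y => phi x * (f (x - y) * g y)) by exact/L1Z.
  transitivity (\int[mu]_y (phi x * (f (x - y) * g y))%:E)%E.
    rewrite L1_EFinE// RintegralZl//; last exact: fg1.
    by rewrite mulrC.
  by apply: eq_integral => y _; rewrite mulrC.
rewrite H; congr fine; apply: eq_integral => y _.
have h1 : L1 (fun x => f x * phi (x + y)).
  apply: (@L1_bounded _ _ _ M) => // ; apply: (measurableT_comp mp).
  exact: measurable_funD.
have hy : L1 (fun x => g y * (f (- y + x) * phi (- y + x + y))).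
  have := L1_addr (- y) (L1Z (g y) h1); apply: eq_integrable => // x _ /=.
  by rewrite [x + - y]addrC.
transitivity (\int[mu]_x (g y * (f (- y + x) * phi (- y + x + y)))%:E)%E.
  apply: eq_integral => x _.
  by rewrite [- y + x]addrC subrK -mulrA mulrCA.
rewrite L1_EFinE//; congr EFin; rewrite -RintegralZl//.
apply: (@Rintegral_addl _ (fun x => g y * (f x * phi (x + y))) (- y)).
exact: (L1_measurable (L1Z (g y) h1)).
Qed.

End convolution.

(** * A class of densities stable under convolution *)

Section regularity.
Context {R : realType}.
Local Notation mu := (@lebesgue_measure R).
Implicit Types (f g h : R -> R) (A B : set R) (x y M e : R).

(** Boundedness is part of the notion because products of Lipschitz functions need it; a single
    constant serves both bounds. *)
Definition bounded_lipschitz A f := exists M : R,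
  (forall x, A x -> `|f x| <= M) /\
  (forall x y, A x -> A y -> `|f x - f y| <= M * `|x - y|).

Lemma bounded_lipschitzP A f M N : 0 <= M -> 0 <= N ->
  (forall x, A x -> `|f x| <= M) ->
  (forall x y, A x -> A y -> `|f x - f y| <= N * `|x - y|) ->
  bounded_lipschitz A f.
Proof.
move=> M0 N0 fM fN; exists (M + N); split=> [x Ax|x y Ax Ay].
  by rewrite (le_trans (fM _ Ax))// lerDl.
by rewrite (le_trans (fN _ _ Ax Ay))// ler_wpM2r// lerDr.
Qed.

Lemma bounded_lipschitzS A B f : B `<=` A ->
  bounded_lipschitz A f -> bounded_lipschitz B f.
Proof.
by move=> BA [M [fM fL]]; exists M; split=> *; [apply: fM|apply: fL]; exact: BA.
Qed.

Lemma bounded_lipschitz_eq A f g : (forall x, A x -> f x = g x) ->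
  bounded_lipschitz A f -> bounded_lipschitz A g.
Proof.
move=> fg [M [fM fL]]; exists M; split=> [x Ax|x y Ax Ay].
  by rewrite -fg//; exact: fM.
by rewrite -!fg//; exact: fL.
Qed.

Lemma bounded_lipschitzD A f g : bounded_lipschitz A f ->
  bounded_lipschitz A g -> bounded_lipschitz A (fun x => f x + g x).
Proof.
move=> [M [fM fL]] [N [gN gL]]; exists (M + N); split=> [x Ax|x y Ax Ay].
  by rewrite (le_trans (ler_normD _ _))// lerD ?fM ?gN.
rewrite opprD addrACA (le_trans (ler_normD _ _))// mulrDl.
by rewrite lerD ?fL ?gL.
Qed.

Lemma bounded_lipschitzM A f g : bounded_lipschitz A f ->
  bounded_lipschitz A g -> bounded_lipschitz A (fun x => f x * g x).
Proof.
move=> [M [fM fL]] [N [gN gL]].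
(* On an empty [A] nothing forces the two constants to be nonnegative. *)
have [[z Az]|A0] := pselect (exists z, A z); last first.
  by exists 0; split=> [x Ax|x y Ax Ay]; exfalso; apply: A0; exists x.
have M0 : 0 <= M by rewrite (le_trans _ (fM _ Az)).
have N0 : 0 <= N by rewrite (le_trans _ (gN _ Az)).
apply: (@bounded_lipschitzP _ _ (M * N) (M * N + M * N)).
- exact: mulr_ge0.
- by rewrite addr_ge0// mulr_ge0.
- by move=> x Ax; rewrite normrM ler_pM ?fM ?gN.
- move=> x y Ax Ay.
  have -> : f x * g x - f y * g y = f x * (g x - g y) + (f x - f y) * g y by ring.
  rewrite (le_trans (ler_normD _ _))// !normrM mulrDl; apply: lerD.
    by rewrite -mulrA ler_pM// ?fM// gL.
  rewrite mulrAC; apply: ler_pM => //; [exact: fL|exact: gN].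
Qed.

Lemma maxr_lipschitz e x y : `|Num.max x e - Num.max y e| <= `|x - y|.
Proof.
by case: (leP x e) => xe; case: (leP y e) => ye; rewrite ler_norml;
  case: (leP 0 (x - y)) => xy; rewrite ?(ger0_norm xy) ?(ltr0_norm xy); lra.
Qed.

Lemma minr_lipschitz e x y : `|Num.min x e - Num.min y e| <= `|x - y|.
Proof.
by case: (leP x e) => xe; case: (leP y e) => ye; rewrite ler_norml;
  case: (leP 0 (x - y)) => xy; rewrite ?(ger0_norm xy) ?(ltr0_norm xy); lra.
Qed.

Definition cutoff e x := Num.min (Num.max (x / e - 1) 0) 1.

Lemma cutoff0 e x : 0 < e -> x <= e -> cutoff e x = 0.
Proof.
move=> e0 xe; rewrite /cutoff max_r ?min_l//.
by rewrite subr_le0 ler_pdivrMr// mul1r.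
Qed.

Lemma cutoff1 e x : 0 < e -> 2 * e <= x -> cutoff e x = 1.
Proof.
move=> e0 xe; rewrite /cutoff min_r// le_max; apply/orP; left.
by rewrite lerBrDr ler_pdivlMr//; lra.
Qed.

Lemma cutoff_bounded_lipschitz e : 0 < e -> bounded_lipschitz setT (cutoff e).
Proof.
move=> e0; apply: (@bounded_lipschitzP _ _ 1 e^-1) => //.
- by rewrite invr_ge0 ltW.
- move=> x _; rewrite /cutoff ger0_norm ?ge_min ?lexx ?orbT//.
  by rewrite le_min ler01 andbT le_max lexx orbT.
- move=> x y _ _; rewrite (le_trans (minr_lipschitz _ _ _))//.
  rewrite (le_trans (maxr_lipschitz _ _ _))//.
  have -> : x / e - 1 - (y / e - 1) = (x - y) / e by ring.
  by rewrite normrM mulrC ger0_norm// invr_ge0 ltW.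
Qed.

Lemma bounded_lipschitz_maxr e f : bounded_lipschitz `[e, +oo[ f ->
  bounded_lipschitz setT (fun x => f (Num.max x e)).
Proof.
move=> [M [fM fL]].
have me x : `[e, +oo[%classic (Num.max x e) by rewrite /= in_itv/= andbT le_max lexx orbT.
have M0 : 0 <= M by rewrite (le_trans _ (fM _ (me 0))).
exists M; split=> [x _|x y _ _]; first exact: fM.
by rewrite (le_trans (fL _ _ (me x) (me y)))// ler_wpM2l// maxr_lipschitz.
Qed.

(** The bounds on [f (x - y)] are only asked where [g y] is nonzero: [f] may be singular at 0,
    provided the support of [g] keeps [x - y] away from it. *)
Lemma convolution_bounded_lipschitz A f g M : 0 <= M ->
  measurable_fun [set: R] f -> L1 g ->
  (forall x y, A x -> g y != 0 -> `|f (x - y)| <= M) ->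
  (forall x x' y, A x -> A x' -> g y != 0 ->
    `|f (x - y) - f (x' - y)| <= M * `|x - x'|) ->
  (forall x, A x -> L1 (fun y => f (x - y) * g y)) /\
  bounded_lipschitz A (convolution f g).
Proof.
move=> M0 mf g1 fM fL.
have le x y : A x -> `|f (x - y) * g y| <= M * `|g y|.
  move=> Ax; rewrite normrM; have [->|gy] := eqVneq (g y) 0.
    by rewrite normr0 !mulr0.
  by rewrite ler_wpM2r// fM.
have fg1 x : A x -> L1 (fun y => f (x - y) * g y).
  move=> Ax; apply: (@L1_le _ _ (fun y => M * `|g y|)).
  - apply: measurable_funM; last exact: L1_measurable.
    by apply: (measurableT_comp mf); exact: measurable_funB.
  - by move=> y; exact: le.
  - exact/L1Z/L1_norm.
split=> //; have I0 : 0 <= \int[mu]_y `|g y| by exact: Rintegral_ge0.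
apply: (@bounded_lipschitzP _ _ (M * \int[mu]_y `|g y|) (M * \int[mu]_y `|g y|)).
- exact: mulr_ge0.
- exact: mulr_ge0.
- move=> x Ax; apply: le_norm_RintegralM => //; first exact: fg1.
  by move=> y; exact: le.
- move=> x x' Ax Ax'; rewrite /convolution -RintegralB//; [|exact: fg1|exact: fg1].
  rewrite mulrAC; apply: le_norm_RintegralM => //.
    by apply: L1B; exact: fg1.
  move=> y; rewrite -mulrBl normrM; have [->|gy] := eqVneq (g y) 0.
    by rewrite normr0 !mulr0.
  by rewrite ler_wpM2r// fL.
Qed.

(** The second alternative is there for the beta densities, which may be unbounded or jump at 0. It
    is compatible with convolution because both factors vanish on the negative half-line, so that
    singularities at 0 can only combine to one at 0. *)
Definition regular f := bounded_lipschitz setT f \/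
  (forall x, x <= 0 -> f x = 0) /\
  (forall e, 0 < e -> bounded_lipschitz `[e, +oo[ f).

Definition regular_density f := [/\ forall x, 0 <= f x, L1 f & regular f].

Lemma regular_density_measurable f : regular_density f -> measurable_fun [set: R] f.
Proof. by case=> _ /L1_measurable. Qed.

Lemma convolution_lipschitzT f g : measurable_fun [set: R] f ->
  bounded_lipschitz setT f -> L1 g ->
  (forall x, L1 (fun y => f (x - y) * g y)) /\
  bounded_lipschitz setT (convolution f g).
Proof.
move=> mf [M [fM fL]] g1.
have M0 : 0 <= M by rewrite (le_trans _ (fM 0 _)).
have [||H1 H2] := @convolution_bounded_lipschitz setT _ _ M M0 mf g1.
- by move=> x y _ _; exact: fM.
- move=> x x' y _ _ _; rewrite (le_trans (fL _ _ _ _))//.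
  by rewrite opprB addrA subrK.
- by split=> // x; exact: H1.
Qed.

Lemma L1_convolutionC x f g :
  L1 (fun y => f (x - y) * g y) -> L1 (fun y => g (x - y) * f y).
Proof.
move=> /(L1_subl x); apply: eq_integrable => // y _ /=.
by rewrite subKr mulrC.
Qed.

(* On [4 e, +oo[, split g at scale e with a Lipschitz cutoff: the part away
   from 0 is globally Lipschitz, the part near 0 only sees f on [2 e, +oo[. *)
Lemma convolution_halfline f g : L1 f -> L1 g ->
  (forall e, 0 < e -> bounded_lipschitz `[e, +oo[ f) ->
  (forall e, 0 < e -> bounded_lipschitz `[e, +oo[ g) ->
  forall e, 0 < e ->
  (forall x, 4 * e <= x -> L1 (fun y => f (x - y) * g y)) /\
  bounded_lipschitz `[4 * e, +oo[ (convolution f g).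
Proof.
move=> f1 g1 fr gr e e0; have mf := L1_measurable f1.
have mg := L1_measurable g1.
(* [Num.max y e] makes the first factor globally Lipschitz and changes no value of the product,
   since the cutoff vanishes for [y <= e]. *)
pose g2 y := g (Num.max y e) * cutoff e y.
pose g1' y := g y - g2 y.
have g2l : bounded_lipschitz setT g2.
  apply: bounded_lipschitzM; last exact: cutoff_bounded_lipschitz.
  exact/bounded_lipschitz_maxr/gr.
have mc : measurable_fun [set: R] (cutoff e).
  apply: measurable_minr => //; apply: measurable_maxr => //.
  by apply: measurable_funB => //; exact: measurable_funM.
have g2E y : g2 y = g y * cutoff e y.
  rewrite /g2; have [ye|ye] := leP y e; last by [].
  by rewrite cutoff0// !mulr0.
have mg2 : measurable_fun [set: R] g2.
  by rewrite (funext g2E); exact: measurable_funM.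
have c01 y : 0 <= cutoff e y <= 1.
  rewrite /cutoff le_min ge_min lexx ler01 orbT andbT andbT.
  by rewrite le_max lexx orbT.
have g1'1 : L1 g1'.
  apply: (@L1_le _ _ (fun y => `|g y|)) => //; last exact: L1_norm.
    exact: measurable_funB.
  move=> y; rewrite /g1' g2E -{1}[g y]mulr1 -mulrBr normrM ler_piMr//.
  by have := c01 y; rewrite ler_norml; lra.
have g1'0 y : 2 * e <= y -> g1' y = 0.
  by move=> ye; rewrite /g1' g2E cutoff1// mulr1 subrr.
have [H21 H22] := convolution_lipschitzT mg2 g2l f1.
have [M [fM fL]] : bounded_lipschitz `[2 * e, +oo[ f by apply: fr; lra.
have M0 : 0 <= M.
  by rewrite (le_trans _ (fM (2 * e) _))//= in_itv/= lexx.
have dom x y : `[4 * e, +oo[%classic x -> g1' y != 0 -> `[2 * e, +oo[%classic (x - y).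
  rewrite /= !in_itv/= !andbT => xe; apply: contraNT; rewrite -ltNge => xy.
  by apply/eqP/g1'0; lra.
have [||H11 H12] := @convolution_bounded_lipschitz `[4 * e, +oo[ f g1' M M0 mf g1'1.
- by move=> x y Ax gy; apply: fM; exact: dom Ax gy.
- move=> x x' y Ax Ax' gy.
  rewrite (le_trans (fL _ _ (dom _ _ Ax gy) (dom _ _ Ax' gy)))//.
  by rewrite opprB addrA subrK.
have split_g x y : f (x - y) * g y = f (x - y) * g1' y + f (x - y) * g2 y.
  by rewrite -mulrDr /g1' subrK.
have fg2 x : L1 (fun y => f (x - y) * g2 y) by exact: L1_convolutionC.
have A4 x : 4 * e <= x -> `[4 * e, +oo[%classic x by rewrite /= in_itv/= andbT.
split=> [x /A4 Ax|].
  have := L1D (H11 _ Ax) (fg2 x); apply: eq_integrable => // y _.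
  by rewrite /= split_g.
have := bounded_lipschitzD H12 (bounded_lipschitzS (@subsetT _ _) H22).
apply: bounded_lipschitz_eq => x Ax.
rewrite -(convolutionC mf mg2) /convolution -(RintegralD _ (H11 _ Ax) (fg2 x))//.
by apply: eq_Rintegral => y _; rewrite split_g.
Qed.

(** One globally Lipschitz factor makes the whole convolution globally Lipschitz. If both factors
    live on the positive half-line, the integrand vanishes identically for [x <= 0], and
    [convolution_halfline] at scale [e / 4] handles [[e, +oo[]. Convergence at every [x] is proved
    along with it, as [integral_convolution] asks for it. *)
Lemma regular_density_convolution f g : regular_density f -> regular_density g ->
  (forall x, L1 (fun y => f (x - y) * g y)) /\ regular_density (convolution f g).
Proof.
move=> nf ng; have [f0 f1 fr] := nf; have [g0 g1 gr] := ng.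
have mf := L1_measurable f1; have mg := L1_measurable g1.
suff [fg1 fgr] : (forall x, L1 (fun y => f (x - y) * g y)) /\
    regular (convolution f g).
  split=> //; split=> // [x|].
    by apply: Rintegral_ge0 => y _; rewrite mulr_ge0.
  have mc1 : measurable_fun [set: R] (fun=> 1 : R) by exact: measurable_cst.
  by have [] := @integral_convolution _ f g _ 1 f1 g1 mc1 _ fg1 => // x; rewrite normr1.
have [ft|[fl fr']] := fr.
  by have [? ?] := convolution_lipschitzT mf ft g1; split => //; left.
have [gt|[gl gr']] := gr.
  have [H1 H2] := convolution_lipschitzT mg gt f1.
  split; first by move=> x; exact/L1_convolutionC.
  by left; rewrite convolutionC.
have H := convolution_halfline f1 g1 fr' gr'.
have Z x : x <= 0 -> forall y, f (x - y) * g y = 0.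
  move=> x0 y; have [y0|y0] := leP y 0; first by rewrite gl ?mulr0.
  by rewrite fl ?mul0r//; lra.
split=> [x|].
  have [x0|x0] := leP x 0.
    rewrite (_ : (fun _ => _) = cst 0); first exact: integrable0.
    by apply/funext => y; exact: Z.
  by have [|h _] := H (x / 4); [lra|apply: h; lra].
right; split=> [x x0|e e0].
  rewrite /convolution (eq_Rintegral _ (g := cst 0)) ?Rintegral_cst//= ?mul0r//.
  by move=> y _; exact: Z.
have [|_] := H (e / 4); first lra.
by rewrite mulrC divfK.
Qed.

End regularity.

(** * The Fourier transform of an integrable function *)

Section fourier.
Context {R : realType}.
Local Notation mu := (@lebesgue_measure R).
Implicit Types (f g h : R -> R) (a t x y : R).

Lemma RintegralZ (k : R) f : L1 f -> \int[mu]_x (k * f x) = k * \int[mu]_x f x.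
Proof. by move=> f1; rewrite RintegralZl. Qed.

Lemma RintegralZ_r (k : R) f : L1 f -> \int[mu]_x (f x * k) = (\int[mu]_x f x) * k.
Proof. by move=> f1; rewrite RintegralZr. Qed.

Lemma RintegralDT f g : L1 f -> L1 g ->
  \int[mu]_x (f x + g x) = \int[mu]_x f x + \int[mu]_x g x.
Proof. by move=> f1 g1; rewrite RintegralD. Qed.

Lemma RintegralBT f g : L1 f -> L1 g ->
  \int[mu]_x (f x - g x) = \int[mu]_x f x - \int[mu]_x g x.
Proof. by move=> f1 g1; rewrite RintegralB. Qed.

Lemma continuous_cosM t : continuous (fun x => cos (t * x)).
Proof.
move=> x; apply: continuous_comp; last exact: continuous_cos.
by apply: cvgM; [exact: cvg_cst|exact: cvg_id].
Qed.

Lemma continuous_sinM t : continuous (fun x => sin (t * x)).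
Proof.
move=> x; apply: continuous_comp; last exact: continuous_sin.
by apply: cvgM; [exact: cvg_cst|exact: cvg_id].
Qed.

Lemma measurable_cosM t : measurable_fun [set: R] (fun x => cos (t * x)).
Proof. by apply: continuous_measurable_fun; exact: continuous_cosM. Qed.

Lemma measurable_sinM t : measurable_fun [set: R] (fun x => sin (t * x)).
Proof. by apply: continuous_measurable_fun; exact: continuous_sinM. Qed.

Lemma L1_cosM f t : L1 f -> L1 (fun x => f x * cos (t * x)).
Proof.
move=> f1; apply: (@L1_bounded _ _ _ 1) => //; first exact: measurable_cosM.
by move=> x; exact: cos_max.
Qed.

Lemma L1_sinM f t : L1 f -> L1 (fun x => f x * sin (t * x)).
Proof.
move=> f1; apply: (@L1_bounded _ _ _ 1) => //; first exact: measurable_sinM.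
by move=> x; exact: sin_max.
Qed.

(** The kernel is exp (- i t x): with u = exp (- x), the power u^(i t) of Euler's integral is
    exactly this exponential. *)
Definition fourier f t : R[i] :=
  Complex (\int[mu]_x (f x * cos (t * x))) (- \int[mu]_x (f x * sin (t * x))).

Lemma fourier_convolution f g t : regular_density f -> regular_density g ->
  fourier (convolution f g) t = fourier f t * fourier g t.
Proof.
move=> nf ng; have [f0 f1 fr] := nf; have [g0 g1 gr] := ng.
have [fg1 _] := regular_density_convolution nf ng.
pose C := \int[mu]_x (f x * cos (t * x)).
pose S := \int[mu]_x (f x * sin (t * x)).
have fc := L1_cosM t f1; have fs := L1_sinM t f1.
have gc := L1_cosM t g1; have gs := L1_sinM t g1.
have cE y : \int[mu]_x (f x * cos (t * (x + y))) = C * cos (t * y) - S * sin (t * y).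
  rewrite -!RintegralZ_r// -RintegralBT.
  - by apply: eq_Rintegral => x _; rewrite mulrDr cosD; ring.
  - by have := L1Z (cos (t * y)) fc; apply: eq_integrable => // x _; rewrite /= mulrC.
  - by have := L1Z (sin (t * y)) fs; apply: eq_integrable => // x _; rewrite /= mulrC.
have sE y : \int[mu]_x (f x * sin (t * (x + y))) = S * cos (t * y) + C * sin (t * y).
  rewrite -!RintegralZ_r// -RintegralDT.
  - by apply: eq_Rintegral => x _; rewrite mulrDr sinD; ring.
  - by have := L1Z (cos (t * y)) fs; apply: eq_integrable => // x _; rewrite /= mulrC.
  - by have := L1Z (sin (t * y)) fc; apply: eq_integrable => // x _; rewrite /= mulrC.
have [_ cI] := integral_convolution f1 g1 (measurable_cosM t) (fun x => cos_max _) fg1.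
have [_ sI] := integral_convolution f1 g1 (measurable_sinM t) (fun x => sin_max _) fg1.
rewrite /fourier cI sI -/C -/S.
set Cg := \int[mu]_x (g x * cos _); set Sg := \int[mu]_x (g x * sin _).
have -> : \int[mu]_y (g y * \int[mu]_x (f x * cos (t * (x + y)))) = C * Cg - S * Sg.
  rewrite /Cg /Sg -!RintegralZ// -RintegralBT; [|exact: L1Z|exact: L1Z].
  by apply: eq_Rintegral => y _; rewrite cE; ring.
have -> : \int[mu]_y (g y * \int[mu]_x (f x * sin (t * (x + y)))) = S * Cg + C * Sg.
  rewrite /Cg /Sg -!RintegralZ// -RintegralDT; [|exact: L1Z|exact: L1Z].
  by apply: eq_Rintegral => y _; rewrite sE; ring.
by apply/eqP; rewrite eq_complex /=; apply/andP; split; apply/eqP; ring.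
Qed.

Lemma Rintegral_convolution f g : regular_density f -> regular_density g ->
  \int[mu]_x convolution f g x = (\int[mu]_x f x) * \int[mu]_x g x.
Proof.
move=> nf ng; have [f0 f1 fr] := nf; have [g0 g1 gr] := ng.
have [fg1 _] := regular_density_convolution nf ng.
have mc1 : measurable_fun [set: R] (fun=> 1 : R) by exact: measurable_cst.
have [|_] := @integral_convolution _ f g _ 1 f1 g1 mc1 _ fg1.
  by move=> x; rewrite normr1.
under eq_Rintegral do rewrite mulr1.
move=> ->; rewrite -RintegralZ//; apply: eq_Rintegral => y _.
by rewrite mulrC; congr (_ * _); apply: eq_Rintegral => x _; rewrite mulr1.
Qed.

End fourier.

(** * The exponential density and its transform *)

Section halfexp.
Context {R : realType}.
Local Notation mu := (@lebesgue_measure R).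
Implicit Types (f g h : R -> R) (a t x y : R).

Lemma is_derive_mulrl t x : is_derive x (1 : R) (fun y => t * y) t.
Proof. by have := is_deriveZ t (is_derive_id x (1 : R)); rewrite [t *: 1]mulr1. Qed.

Lemma is_derive_Nmulrl t x : is_derive x (1 : R) (fun y => - (t * y)) (- t).
Proof. exact: is_deriveN (is_derive_mulrl t x). Qed.

(** The beta density with second parameter 1 ([beta_density1]). Its transform 1 / (a + i t) also
    yields the functional equation of Gamma and the transform of exp (- |y|). *)
Definition halfexp a y : R := if 0 < y then expR (- (a * y)) else 0.

Let a_exp0 a (B : R -> R) (M : R) : 0 < a -> (forall x, `|B x| <= M) ->
  (expR (- (a * x)) * B x) @[x --> +oo] --> (0 : R).
Proof.
move=> a0 BM.
have ex : (expR (- (a * x))) @[x --> +oo] --> (0 : R).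
  apply: (@cvg_comp _ _ _ (fun x => a * x) (fun x => expR (- x)) _ (pinfty_nbhs R)).
    exact: gt0_cvgMry.
  exact: cvgr_expR.
apply/norm_cvg0P.
apply: (@squeeze_cvgr _ _ _ _ (fun=> 0) (fun x => M * expR (- (a * x)))).
- near=> x; rewrite normr_ge0 normrM (ger0_norm (expR_ge0 _)) mulrC/=.
  by rewrite ler_wpM2r// expR_ge0.
- exact: cvg_cst.
- by rewrite -(mulr0 M); apply: cvgM => //; exact: cvg_cst.
Unshelve. all: by end_near. Qed.

Let halfexp_restrict a : 0 < a ->
  halfexp a = (fun y => expR (- (a * y))) \_ `]0, +oo[.
Proof.
move=> a0; apply/funext => y; rewrite /halfexp patchE.
by congr (if _ then _ else _); apply/idP/idP; rewrite inE/= in_itv/= andbT.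
Qed.

(* [1 + cos] and [1 + sin] are nonnegative, so the fundamental theorem of
   calculus on the half line applies to them. *)
Let ge0_integral_halfexp a (q : R -> R) (B : R -> R) (M : R) : 0 < a ->
  continuous q -> (forall x, 0 <= q x) -> (forall x, `|B x| <= M) ->
  (forall x, is_derive x (1 : R) (fun y => expR (- (a * y)) * B y) (expR (- (a * x)) * q x)) ->
  (\int[mu]_y (halfexp a y * q y)%:E = (- B 0)%:E)%E.
Proof.
move=> a0 cq q0 BM dB.
have ce : continuous (fun y : R => expR (- (a * y)) * q y).
  move=> x; apply: cvgM; last exact: cq.
  apply: continuous_comp; last exact: continuous_expR.
  by apply: cvgN; apply: cvgM; [exact: cvg_cst|exact: cvg_id].
have me := continuous_measurable_fun ce.
transitivity (\int[mu]_(y in `]0%R, +oo[) (expR (- (a * y)) * q y)%:E)%E.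
  rewrite [RHS]integral_mkcond; apply: eq_integral => y _.
  rewrite halfexp_restrict// !patchE; case: ifP => // _.
  by rewrite mul0r.
rewrite integral_itv_obnd_cbnd; last first.
  by apply/measurable_EFinP; exact: measurable_funTS.
rewrite (ge0_integral_derivey (l := 0) dB)//.
- by rewrite sub0r mulr0 oppr0 expR0 mul1r.
- by move=> x _; rewrite mulr_ge0// expR_ge0.
- exact: a_exp0 BM.
Qed.

Lemma measurable_halfexp a : measurable_fun [set: R] (halfexp a).
Proof.
apply: measurable_fun_ifT => //; first exact: measurable_fun_ltr.
by apply: measurableT_comp => //; apply: measurableT_comp => //; exact: measurable_funM.
Qed.

Lemma halfexp_ge0 a y : 0 <= halfexp a y.
Proof. by rewrite /halfexp; case: ifP => // _; exact: expR_ge0. Qed.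

Let dexp a x (B : R -> R) b : is_derive x (1 : R) B b ->
  is_derive x (1 : R) (fun y => expR (- (a * y)) * B y)
    (expR (- (a * x)) * (b - a * B x)).
Proof.
move=> dB; have de : is_derive x (1 : R) (fun y : R => expR (- (a * y))) (expR (- (a * x)) * - a).
  exact: (is_derive1_comp (is_derive_expR _) (is_derive_Nmulrl a x)).
by apply: (is_derive_eq (is_deriveM de dB)); rewrite /GRing.scale /=; ring.
Qed.

Lemma Rintegral_halfexp a : 0 < a ->
  L1 (halfexp a) /\ \int[mu]_y halfexp a y = a^-1.
Proof.
move=> a0.
have E : (\int[mu]_y (halfexp a y)%:E = (a^-1)%:E)%E.
  transitivity (\int[mu]_y (halfexp a y * 1)%:E)%E.
    by apply: eq_integral => y _; rewrite mulr1.
  rewrite -[a^-1]opprK.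
  apply: (@ge0_integral_halfexp a (fun=> 1) (fun=> - a^-1) a^-1 a0).
  - by move=> x; exact: cvg_cst.
  - by [].
  - by move=> x; rewrite normrN ger0_norm// invr_ge0 ltW.
  - move=> x; apply: (is_derive_eq (dexp a (is_derive_cst (- a^-1) x (1 : R)))).
    by rewrite /=; field; rewrite gt_eqF.
split; last by rewrite /Rintegral E.
apply/L1P; split; first exact: measurable_halfexp.
under eq_integral do rewrite ger0_norm ?halfexp_ge0//.
by rewrite E ltry.
Qed.

Lemma fourier_halfexp a t : 0 < a ->
  fourier (halfexp a) t = (Complex a t)^-1.
Proof.
move=> a0; have [h1 hE] := Rintegral_halfexp a0.
have q0 : 0 < a ^+ 2 + t ^+ 2 by rewrite ltr_pwDl ?exprn_gt0// sqr_ge0.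
have q1 : a ^+ 2 + t ^+ 2 != 0 by rewrite gt_eqF.
have dcos x : is_derive x (1 : R) (fun y => cos (t * y)) (- (t * sin (t * x))).
  by apply: (is_derive_eq (is_derive1_comp (is_derive_cos _) (is_derive_mulrl t x))); ring.
have dsin x : is_derive x (1 : R) (fun y => sin (t * y)) (t * cos (t * x)).
  by apply: (is_derive_eq (is_derive1_comp (is_derive_sin _) (is_derive_mulrl t x))); ring.
(* [expR (- (a * y)) * Bc y] is a primitive of [expR (- (a * y)) * (1 + cos (t * y))], and likewise
   for [Bs] with the sine; the summand [- a^-1] accounts for the constant 1. *)
pose Bc x := - a^-1 + (a ^+ 2 + t ^+ 2)^-1 * (t * sin (t * x) - a * cos (t * x)).
pose Bs x := - a^-1 - (a ^+ 2 + t ^+ 2)^-1 * (a * sin (t * x) + t * cos (t * x)).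
have qi0 : 0 <= (a ^+ 2 + t ^+ 2)^-1 by rewrite invr_ge0 ltW.
pose M := a^-1 + (a ^+ 2 + t ^+ 2)^-1 * (`|t| + a).
have nB u v w : `|u| <= `|t| -> `|v| <= a -> `|w| <= (a ^+ 2 + t ^+ 2)^-1 ->
    `|- a^-1 + w * (u + v)| <= M.
  move=> ut va wq; rewrite (le_trans (ler_normD _ _))// normrN ger0_norm ?invr_ge0 ?(ltW a0)//.
  rewrite lerD2l normrM ler_pM// (le_trans (ler_normD _ _))//.
  exact: lerD.
have nM k x : `|x| <= 1 -> `|k * x| <= `|k|.
  by move=> x1; rewrite normrM ler_piMr.
have an : `|a| = a by rewrite ger0_norm// ltW.
have BcM x : `|Bc x| <= M.
  apply: nB; [by rewrite nM ?sin_max| |by rewrite ger0_norm].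
  by rewrite normrN -[leRHS]an nM ?cos_max.
have BsM x : `|Bs x| <= M.
  rewrite /Bs -mulNr [X in _ * X]addrC.
  apply: nB; [by rewrite nM ?cos_max| |by rewrite normrN ger0_norm].
  by rewrite -[leRHS]an nM ?sin_max.
have dBc x : is_derive x (1 : R) Bc
    (0 + (a ^+ 2 + t ^+ 2)^-1 * (t * (t * cos (t * x)) - a * - (t * sin (t * x)))).
  exact: is_deriveD.
have dBs x : is_derive x (1 : R) Bs
    (0 - (a ^+ 2 + t ^+ 2)^-1 * (a * (t * cos (t * x)) + t * - (t * sin (t * x)))).
  exact: is_deriveB.
have hc := L1_cosM t h1; have hs := L1_sinM t h1.
have split_q (q : R -> R) : L1 (fun y => halfexp a y * q y) ->
    \int[mu]_y (halfexp a y * (1 + q y)) = a^-1 + \int[mu]_y (halfexp a y * q y).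
  move=> hq; rewrite -hE -RintegralDT//.
  by apply: eq_Rintegral => y _; rewrite mulrDr mulr1.
have cI : \int[mu]_y (halfexp a y * cos (t * y)) = a / (a ^+ 2 + t ^+ 2).
  have /(congr1 fine) E : (\int[mu]_y (halfexp a y * (1 + cos (t * y)))%:E = (- Bc 0)%:E)%E.
    apply: (@ge0_integral_halfexp _ (fun y => 1 + cos (t * y)) Bc M a0).
    - by move=> x; apply: cvgD; [exact: cvg_cst|exact: continuous_cosM].
    - by move=> x; have := cos_geN1 (t * x); lra.
    - by [].
    - by move=> x; apply: (is_derive_eq (dexp a (dBc x))); rewrite /Bc; field; rewrite q1 gt_eqF.
  have := split_q _ hc; rewrite [LHS]E /= /Bc mulr0 sin0 cos0.
  by move=> H; apply: (addrI (a^-1)); rewrite -H; ring.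
have sI : \int[mu]_y (halfexp a y * sin (t * y)) = t / (a ^+ 2 + t ^+ 2).
  have /(congr1 fine) E : (\int[mu]_y (halfexp a y * (1 + sin (t * y)))%:E = (- Bs 0)%:E)%E.
    apply: (@ge0_integral_halfexp _ (fun y => 1 + sin (t * y)) Bs M a0).
    - by move=> x; apply: cvgD; [exact: cvg_cst|exact: continuous_sinM].
    - by move=> x; have := sin_geN1 (t * x); lra.
    - by [].
    - by move=> x; apply: (is_derive_eq (dexp a (dBs x))); rewrite /Bs; field; rewrite q1 gt_eqF.
  have := split_q _ hs; rewrite [LHS]E /= /Bs mulr0 sin0 cos0.
  by move=> H; apply: (addrI (a^-1)); rewrite -H; ring.
rewrite /fourier cI sI.
by apply/eqP; rewrite eq_complex /= !eqxx.
Qed.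

End halfexp.

(** * The Riemann-Lebesgue lemma *)

Section riemann_lebesgue.
Context {R : realType}.
Local Notation mu := (@lebesgue_measure R).
Implicit Types (f g h : R -> R) (a t x y p q T : R).

(* Shifting by [pi / T] changes the sign of [sin (T x)]; hence the integral is at
   most half the L1 distance between [f] and its translate, which is twice the
   integral of the positive part of their difference, dominated by [f]. *)
Let ge0_riemann_lebesgue_le f T : 0 < T -> (forall x, 0 <= f x) -> L1 f ->
  `|\int[mu]_x (f x * sin (T * x))| <= \int[mu]_x Num.max (f x - f (x + pi / T)) 0.
Proof.
move=> T0 f0 f1; set d := pi / T; set w := fun x => Num.max (f x - f (x + d)) 0.
have mf := L1_measurable f1; have fd1 := L1_addr d f1.
have w1 : L1 w.
  apply: (@L1_le _ _ f) => //.
    apply: measurable_maxr => //; apply: measurable_funB => //.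
    exact: L1_measurable fd1.
  move=> x; rewrite ger0_norm /w ?le_max ?lexx ?orbT// ge_max f0 andbT.
  by have := f0 (x + d); lra.
have sh : \int[mu]_x (f (x + d) * sin (T * x)) = - \int[mu]_x (f x * sin (T * x)).
  rewrite -mulN1r -RintegralZ; last exact: L1_sinM.
  rewrite -[RHS](Rintegral_addl d); last first.
    by apply: L1_measurable; apply: L1Z; exact: L1_sinM.
  apply: eq_Rintegral => x _; have -> : T * (d + x) = T * x + pi.
    by rewrite /d; field; rewrite gt_eqF.
  by rewrite sinDpi [d + x]addrC; ring.
have twice : 2 * \int[mu]_x (f x * sin (T * x)) =
    \int[mu]_x ((f x - f (x + d)) * sin (T * x)).
  transitivity (\int[mu]_x (f x * sin (T * x) - f (x + d) * sin (T * x))).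
    by rewrite RintegralBT ?sh; [ring|exact: L1_sinM|exact: L1_sinM].
  by apply: eq_Rintegral => x _; rewrite mulrBl.
have B1 := L1B f1 fd1.
have le1 : `|\int[mu]_x ((f x - f (x + d)) * sin (T * x))| <=
    1 * \int[mu]_x `|f x - f (x + d)|.
  apply: (le_norm_RintegralM B1); first exact: L1_sinM.
  by move=> x; rewrite mul1r normrM ler_piMr// sin_max.
have E : \int[mu]_x `|f x - f (x + d)| = 2 * \int[mu]_x w x.
  transitivity (\int[mu]_x (2 * w x - (f x - f (x + d)))).
    apply: eq_Rintegral => x _; rewrite /w.
    by case: (leP (f x - f (x + d)) 0) => h; rewrite ?(ler0_norm h) ?(gtr0_norm h); lra.
  rewrite RintegralBT//; last exact: L1Z.
  rewrite RintegralZ// RintegralBT//.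
  have -> : \int[mu]_x f (x + d) = \int[mu]_x f (d + x).
    by apply: eq_Rintegral => x _; rewrite addrC.
  by rewrite Rintegral_addl// subrr subr0.
move: le1; rewrite -twice E normrM ger0_norm// mul1r ler_pM2l//.
Qed.

(** The limit is tested along sequences tending to infinity, where dominated convergence applies: by
    continuity the integrand of the bound tends to 0 off the null set [{p, q}]. *)
Let ge0_riemann_lebesgue f p q : (forall x, 0 <= f x) -> L1 f ->
  (forall x, x != p -> x != q -> {for x, continuous f}) ->
  \int[mu]_x (f x * sin (T * x)) @[T --> +oo] --> 0.
Proof.
move=> f0 f1 fc; apply/cvg_pinftyP => u uy.
pose w n x := Num.max (f x - f (x + pi / u n)) 0.
have mf := L1_measurable f1.
have mw n : measurable_fun [set: R] (w n).
  apply: measurable_maxr => //; apply: measurable_funB => //.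
  exact: L1_measurable (L1_addr _ f1).
have u0 : \forall n \near \oo, 0 < u n.
  by move/cvgryPgt : uy; apply.
have d0 : (pi / u n) @[n --> \oo] --> (0 : R).
  rewrite -(mulr0 pi); apply: cvgM; first exact: cvg_cst.
  exact/gtr0_cvgV0.
have w0 n x : 0 <= w n x by rewrite /w le_max lexx orbT.
have wf n x : w n x <= f x.
  by rewrite /w ge_max f0 andbT; have := f0 (x + pi / u n); lra.
have wx x : x != p -> x != q -> w n x @[n --> \oo] --> 0.
  move=> xp xq; have := fc x xp xq => cx.
  have fx : f (x + pi / u n) @[n --> \oo] --> f x.
    have xd : x + pi / u n @[n --> \oo] --> x.
      have : x + pi / u n @[n --> \oo] --> x + 0 by apply: cvgD => //; exact: cvg_cst.
      by rewrite addr0.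
    exact: (cvg_comp _ _ xd cx).
  have nf : `|f x - f (x + pi / u n)| @[n --> \oo] --> (0 : R).
    rewrite -(normr0 R) -(subrr (f x)); apply: cvg_norm.
    by apply: cvgB => //; exact: cvg_cst.
  apply: (squeeze_cvgr _ _ nf); last exact: (cvg_cst 0).
  by near=> n; rewrite w0 /w/= ge_max ler_norm normr_ge0.
have wI : (\int[mu]_x (w n x)%:E)%E @[n --> \oo] --> 0%E.
  have [|||||_ _] := @dominated_convergence _ (measurableTypeR R) R mu setT measurableT
    (fun n x => (w n x)%:E) (cst 0%E) (EFin \o f).
  - by move=> n; have /measurable_EFinP := mw n; exact.
  - exact: measurable_cst.
  - exists [set p; q]; split.
    + exact: measurableU.
    + by apply: countable_lebesgue_measure0; exact: finite_set_countable.
    + move=> x /=; apply: contra_notP => /not_orP[/eqP xp /eqP xq] _.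
      by apply/cvg_EFin; [exact: nearW|exact: wx].
  - exact: f1.
  - apply: aeW => x n _.
    by rewrite lee_fin ger0_norm ?w0// wf.
  - by rewrite integral0.
have wR : \int[mu]_x w n x @[n --> \oo] --> 0.
  exact: (fine_cvg wI).
apply/norm_cvg0P.
apply: (squeeze_cvgr _ (cvg_cst 0) wR); near=> n.
rewrite normr_ge0/=; apply: ge0_riemann_lebesgue_le => //.
by near: n.
Unshelve. all: by end_near. Qed.

(** In Fourier inversion this is applied to a difference quotient that may be discontinuous at
    [y = 0] and at the singular point of the density: hence two exceptional points. The nonnegative
    functions [|f| + f] and [|f| - f] are continuous wherever [f] is, and half their difference is
    [f]. *)
Lemma riemann_lebesgue f p q : L1 f ->
  (forall x, x != p -> x != q -> {for x, continuous f}) ->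
  \int[mu]_x (f x * sin (T * x)) @[T --> +oo] --> 0.
Proof.
move=> f1 fc; have nf1 := L1_norm f1.
pose fp x : R := `|f x| + f x; pose fn x : R := `|f x| - f x.
have fp1 : L1 fp by exact: L1D.
have fn1 : L1 fn by exact: L1B.
have cP : \int[mu]_x (fp x * sin (T * x)) @[T --> +oo] --> 0.
  apply: (@ge0_riemann_lebesgue _ p q) => // x.
    by rewrite /fp; have := ler_norm (- f x); rewrite normrN; lra.
  move=> xp xq; have fx := fc x xp xq.
  by apply: cvgD => //; exact: cvg_norm.
have cN : \int[mu]_x (fn x * sin (T * x)) @[T --> +oo] --> 0.
  apply: (@ge0_riemann_lebesgue _ p q) => // x.
    by rewrite /fn; have := ler_norm (f x); lra.
  move=> xp xq; have fx := fc x xp xq.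
  by apply: cvgB => //; exact: cvg_norm.
have : 2^-1 * (\int[mu]_x (fp x * sin (T * x)) - \int[mu]_x (fn x * sin (T * x)))
    @[T --> +oo] --> (2^-1 * (0 - 0) : R).
  by apply: cvgM; [exact: cvg_cst|exact: cvgB].
rewrite subrr mulr0; apply: cvg_trans; apply: near_eq_cvg; near=> T.
have sP := L1_sinM T fp1; have sN := L1_sinM T fn1.
rewrite -RintegralBT// -RintegralZ; last exact: L1B.
by apply: eq_Rintegral => x _; rewrite /fp /fn; field.
Unshelve. all: by end_near. Qed.

End riemann_lebesgue.

(** * Pointwise Fourier inversion *)

Section inversion.
Context {R : realType}.
Local Notation mu := (@lebesgue_measure R).
Implicit Types (f g h : R -> R) (a b t x y p q T M : R) (k : R -> R -> R).

(** On a bounded window in [t] the integrand is dominated by an integrable function on the plane, so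
    Fubini applies although the transform itself may not be integrable over the line. *)
Lemma Rintegral_window f k a b : L1 f -> a <= b ->
  measurable_fun [set: R * R] (fun z : R * R => k z.1 z.2) ->
  (forall t y, `|k t y| <= 1) ->
  mu.-integrable `[a, b] (fun t => (\int[mu]_y (f y * k t y))%:E) /\
  \int[mu]_(t in `[a, b]) (\int[mu]_y (f y * k t y)) =
  \int[mu]_y (f y * \int[mu]_(t in `[a, b]) k t y).
Proof.
move=> f1 ab mk k1; have mf := L1_measurable f1.
pose I t : R := \1_`[a, b] t.
have mI : measurable_fun [set: R] I by apply: measurable_indic; exact: measurable_itv.
have I01 t : 0 <= I t <= 1 by rewrite /I indicE; case: (_ \in _); rewrite /= ?lexx ?ler01.
have I1 : L1 I.
  apply/L1P; split => //.
  under eq_integral => t _ do rewrite ger0_norm ?(andP (I01 t)).1//.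
  have -> : (\int[mu]_t (I t)%:E = mu `[a, b]%classic)%E.
    by rewrite integral_indic ?setIT//; exact: measurable_itv.
  by rewrite lebesgue_measure_itv/=; case: ifP => // _; rewrite -EFinB ltry.
have mG : measurable_fun [set: measurableTypeR R * measurableTypeR R]
    (fun z : measurableTypeR R * measurableTypeR R => (I z.1 * f z.2)%:E).
  have m1 : measurable_fun [set: R * R] (fun z : R * R => I z.1) by exact: (measurableT_comp mI).
  have m2 : measurable_fun [set: R * R] (fun z : R * R => f z.2) by exact: (measurableT_comp mf).
  have /measurable_EFinP := measurable_funM m1 m2; exact.
have G1 : ((mu \x mu)%E).-integrable setT
    (fun z : measurableTypeR R * measurableTypeR R => (I z.1 * f z.2)%:E).
  apply/(integrable21ltyP _ _ mG) => /=.
  have -> : (\int[mu]_y \int[mu]_x `|(I x * f y)%:E| =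
      \int[mu]_y ((\int[mu]_x `|I x|) * `|f y|)%:E)%E.
    apply: eq_integral => y _; rewrite EFinM -(L1_EFinE (L1_norm I1)).
    rewrite -ge0_integralZr//; last first.
      exact/measurable_EFinP/measurableT_comp.
    by apply: eq_integral => x _; rewrite -EFinM -normrM.
  exact/integrable_lty/L1Z/L1_norm.
have F1 : ((mu \x mu)%E).-integrable setT
    (fun z : measurableTypeR R * measurableTypeR R => (I z.1 * f z.2 * k z.1 z.2)%:E).
  have := integrableMl measurableT G1 mk; apply; exists 1.
  split=> [|x Mx z _ /=]; first exact: num_real.
  by rewrite (le_trans (k1 _ _))// ltW.
have fk1 t : L1 (fun y => f y * k t y).
  apply: (@L1_bounded _ _ _ 1) => //.
  exact: (measurableT_comp mk (pair1_measurable t)).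
have inner t : (\int[mu]_y (I t * f y * k t y)%:E = (I t * \int[mu]_y (f y * k t y))%:E)%E.
  rewrite -RintegralZ// -L1_EFinE; last exact: L1Z.
  by apply: eq_integral => y _; rewrite mulrA.
have k1' y : L1 (fun t => I t * k t y).
  apply: (@L1_bounded _ _ _ 1) => //.
  exact: (measurableT_comp mk (pair2_measurable y)).
have inner2 y : (\int[mu]_t (I t * f y * k t y)%:E = (f y * \int[mu]_t (I t * k t y))%:E)%E.
  rewrite -RintegralZ// -L1_EFinE; last exact: L1Z.
  by apply: eq_integral => t _; congr EFin; ring.
have restr (g : R -> R) : \int[mu]_(t in `[a, b]) g t = \int[mu]_t (I t * g t).
  rewrite Rintegral_mkcond; apply: eq_Rintegral => t _.
  by rewrite patchE /I indicE; case: (_ \in _); rewrite ?mul1r ?mul0r.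
have L : L1 (fun t => I t * \int[mu]_y (f y * k t y)).
  have := integrable_fubini_F F1; apply: eq_integrable => // t _.
  by rewrite /fubini_F /= inner.
split.
  have mab : measurable (`[a, b]%classic : set (measurableTypeR R)) by exact: measurable_itv.
  have := integrableS measurableT mab (@subsetT _ _) L.
  apply: eq_integrable => // t tab /=.
  by rewrite /I indicE tab mul1r.
rewrite restr.
have /(congr1 fine) := Fubini F1.
have -> : (\int[mu]_x \int[mu]_y (I x * f y * k x y)%:E =
  \int[mu]_x (I x * \int[mu]_y (f y * k x y))%:E)%E.
  by apply: eq_integral => t _; rewrite inner.
rewrite -[LHS]/(\int[mu]_x (I x * \int[mu]_y (f y * k x y))) => ->.
congr fine; apply: eq_integral => y _.
by rewrite inner2 restr.
Qed.

(** The Dini-type condition of pointwise inversion: it keeps the difference quotient at [x] bounded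
    near 0. *)
Definition local_lipschitz f x := exists e M : R,
  0 < e /\ forall y, `|y| <= e -> `|f (x - y) - f x| <= M * `|y|.

Lemma local_lipschitz_continuous f x : local_lipschitz f x -> {for x, continuous f}.
Proof.
move=> [e [M [e0 H]]]; apply/cvgrPdist_le => /= d d0.
have M1 : 0 < `|M| + 1 by rewrite ltr_pwDr.
near=> z.
have ze : `|x - z| <= e by near: z; exact: cvgr_dist_le.
have zd : `|x - z| <= d / (`|M| + 1).
  by near: z; apply: cvgr_dist_le => //; exact: divr_gt0.
have := H (x - z) ze; rewrite subKr distrC => /le_trans; apply.
rewrite (le_trans (ler_norm _))// normrM normr_id.
rewrite (le_trans (y := (`|M| + 1) * `|x - z|))//.
  by rewrite ler_wpM2r// lerDl.
by rewrite mulrC -ler_pdivlMr.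
Unshelve. all: by end_near. Qed.

Lemma regular_local_lipschitz f x : regular f ->
  x != 0 \/ bounded_lipschitz setT f -> local_lipschitz f x.
Proof.
have T : bounded_lipschitz setT f -> local_lipschitz f x.
  move=> [M [_ fL]]; exists 1, M; split=> // y _.
  rewrite (le_trans (fL _ _ _ _))//.
  by rewrite addrAC subrr sub0r normrN.
move=> [fT|[f0 fr]] [x0|fT']; [exact: T|exact: T| |exact: T].
have [xp|xn|x00] := ltgtP x 0; last by rewrite x00 eqxx in x0.
  exists (- x), 0; split=> [|y]; first lra.
  rewrite ler_norml => /andP[y1 y2].
  by rewrite !f0 ?subrr ?normr0 ?mul0r//; lra.
have [|M [_ fL]] := fr (x / 2); first lra.
exists (x / 2), M; split=> [|y]; first lra.
rewrite ler_norml => /andP[y1 y2].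
rewrite (le_trans (fL _ _ _ _)) ?[x - y - x]addrAC ?subrr ?sub0r ?normrN//=;
  rewrite in_itv/= andbT; lra.
Qed.

(** [halfexp 1] vanishes at 0, so the value 1 there is restored by an indicator, which no integral
    sees. *)
Lemma expRN_norm_decomp y :
  expR (- `|y|) = halfexp 1 y + halfexp 1 (- y) + \1_[set 0] y :> R.
Proof.
rewrite /halfexp indicE !mul1r opprK oppr_gt0.
have [y0|y0|y0] := ltgtP y 0.
- rewrite memNset ?addr0 ?add0r//=; last by move=> y00; rewrite y00 ltxx in y0.
  by rewrite ltr0_norm// opprK.
- rewrite memNset ?addr0//=; last by move=> y00; rewrite y00 ltxx in y0.
  by rewrite gtr0_norm.
- by rewrite y0 mem_set//= normr0 oppr0 expR0 !add0r.
Qed.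

(** The reason for comparing with exp (- |y|): it is integrable, has value 1 at 0, and its transform
    has the primitive [2 * atan], whose limit at infinity is [pi]. *)
Lemma fourier_expRN_norm t :
  L1 (fun y : R => expR (- `|y|)) /\
  \int[mu]_y (expR (- `|y|) * cos (t * y)) = 2 / (1 + t ^+ 2).
Proof.
have [h1 _] := @Rintegral_halfexp R 1 ltr01.
have h1' : L1 (fun y : R => halfexp 1 (- y)).
  by have := L1_subl 0 h1; apply: eq_integrable => // y _; rewrite /= sub0r.
have mi : measurable_fun [set: R] (\1_[set 0] : R -> R) by apply: measurable_indic; exact: measurable_set1.
have i0 : (\int[mu]_y `|\1_[set 0%R] y|%:E = 0)%E.
  under eq_integral => y _ do rewrite ger0_norm//.
  rewrite -(lebesgue_measure_set1 (0 : R)).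
  by rewrite integral_indic ?setIT//; exact: measurable_set1.
have i1 : L1 (\1_[set 0] : R -> R).
  by apply/L1P; split => //; rewrite i0.
have E : (fun y : R => expR (- `|y|)) =
    (fun y => halfexp 1 y + halfexp 1 (- y) + \1_[set 0] y).
  by apply/funext => y; exact: expRN_norm_decomp.
split; first by rewrite E; apply: L1D => //; exact: L1D.
have hc := L1_cosM t h1; have hc' := L1_cosM t h1'; have ic := L1_cosM t i1.
transitivity (\int[mu]_y (halfexp 1 y * cos (t * y) +
    halfexp 1 (- y) * cos (t * y) + \1_[set 0] y * cos (t * y))).
  by apply: eq_Rintegral => y _; rewrite expRN_norm_decomp; ring.
rewrite RintegralDT//; last exact: L1D.
rewrite RintegralDT//.
have -> : \int[mu]_y (\1_[set 0] y * cos (t * y)) = 0.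
  apply/normr0_eq0/eqP; rewrite eq_le normr_ge0 andbT.
  rewrite (le_trans (le_norm_RintegralM (M := 1) i1 ic _))//.
    by move=> y; rewrite mul1r normrM ler_piMr// cos_max.
  by rewrite mul1r /Rintegral i0.
have -> : \int[mu]_y (halfexp 1 (- y) * cos (t * y)) = \int[mu]_y (halfexp 1 y * cos (t * y)).
  rewrite -[LHS]Rintegral_opp; last exact: L1_measurable.
  by apply: eq_Rintegral => y _; rewrite opprK mulrN cosN.
have /(congr1 (@complex.Re R)) /= := fourier_halfexp t (@ltr01 R).
rewrite expr1n => ->; field.
by rewrite gt_eqF// ltr_pwDl// sqr_ge0.
Qed.

Lemma Rintegral_cos_scale T y : 0 < T ->
  y * \int[mu]_(t in `[0, T]) cos (t * y) = sin (T * y).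
Proof.
move=> T0; have [->|y0] := eqVneq y 0; first by rewrite mul0r mulr0 sin0.
have d t : is_derive t (1 : R) (fun t => y^-1 * sin (y * t)) (cos (y * t)).
  apply: (is_derive_eq (is_deriveZ y^-1
    (is_derive1_comp (is_derive_sin (y * t)) (is_derive_mulrl y t)))).
  by rewrite /GRing.scale /=; field.
have -> : \int[mu]_(t in `[0, T]) cos (t * y) = \int[mu]_(t in `[0, T]) cos (y * t).
  by apply: eq_Rintegral => t _; rewrite mulrC.
rewrite /Rintegral (integral_derive T0 d) /=; last exact: continuous_cosM.
by rewrite mulr0 sin0 mulr0 subr0 mulrA divff// mul1r mulrC.
Qed.

Lemma Rintegral_cauchy T : 0 < T ->
  \int[mu]_(t in `[0, T]) (2 / (1 + t ^+ 2)) = 2 * atan T.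
Proof.
move=> T0.
have d t : is_derive t (1 : R) (fun t => 2 * atan t) (2 / (1 + t ^+ 2)).
  exact: (is_deriveZ 2 (is_derive1_atan t)).
rewrite /Rintegral (integral_derive T0 d) /= ?atan0 ?mulr0 ?subr0//.
move=> t; apply: cvgM; first exact: cvg_cst.
apply: cvgV; first by rewrite gt_eqF// ltr_pwDl// sqr_ge0.
by apply: cvgD; [exact: cvg_cst|exact: exprn_continuous].
Qed.

Lemma measurable_invr : measurable_fun [set: R] (@GRing.inv R).
Proof.
have m0 : measurable [set (0 : R)] by exact: measurable_set1.
rewrite -(setUv [set (0 : R)]).
apply/measurable_funU; [exact: m0|exact: measurableC m0|split].
  exact: measurable_fun_set1.
apply: open_continuous_measurable_fun; first exact/closed_openC/closed_eq.
by move=> x /[!inE] /eqP x0; exact: inv_continuous.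
Qed.

(* Comparing [f] near [x] with [f x * exp (- |y|)] leaves an error divisible by
   [y], to which the Riemann-Lebesgue lemma applies, and a main term whose
   transform integrates to an arctangent. *)
Lemma fourier_inversion f x p : L1 f -> local_lipschitz f x ->
  (forall z, z != p -> {for z, continuous f}) ->
  \int[mu]_(t in `[0, T]) (\int[mu]_y (f y * cos (t * (x - y)))) @[T --> +oo]
    --> pi * f x.
Proof.
move=> f1 [e [M [e0 fL]]] fc.
have [phi1 _] := fourier_expRN_norm 0.
pose phi y : R := expR (- `|y|).
pose E y : R := f (x - y) - f x * phi y.
have fx1 : L1 (fun y => f (x - y)) := L1_subl x f1.
have E1 : L1 E by apply: L1B => //; exact: L1Z.
have mE := L1_measurable E1.
have phi_le y : `|1 - phi y| <= `|y|.
  rewrite /phi ger0_norm; last by rewrite subr_ge0 -expR0 ler_expR oppr_le0.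
  by have := expR_ge1Dx (- `|y|); lra.
pose psi y : R := E y / y.
have mpsi : measurable_fun [set: R] psi.
  by apply: measurable_funM => //; exact: measurable_invr.
have psi1 : L1 psi.
  (* For [|y| <= e] one has [exp (- |y|) >= exp (- e)], so the factor [expR e] turns a constant
     bound into a multiple of [phi]; beyond [e], the division by [y] costs at most the factor
     [e^-1]. *)
  pose C := (`|M| + `|f x|) * expR e.
  apply: (@L1_le _ _ (fun y => C * phi y + e^-1 * `|E y|)) => //; last first.
    by apply: L1D; apply: L1Z => //; exact: L1_norm.
  move=> y; have C0 : 0 <= C by rewrite mulr_ge0 ?expR_ge0// addr_ge0.
  rewrite /psi normrM normfV; have [ye|ye] := leP `|y| e; last first.
    rewrite (le_trans (y := e^-1 * `|E y|))//; last first.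
      by rewrite lerDr mulr_ge0// expR_ge0.
    by rewrite mulrC ler_wpM2r// lef_pV2 ?posrE ?ltW// (lt_trans e0).
  have [->|y0] := eqVneq y 0.
    by rewrite normr0 invr0 mulr0 addr_ge0// mulr_ge0// ?expR_ge0// invr_ge0 ltW.
  have EM : `|E y| <= (`|M| + `|f x|) * `|y|.
    have -> : E y = (f (x - y) - f x) + f x * (1 - phi y) by rewrite /E; ring.
    rewrite mulrDl (le_trans (ler_normD _ _))// lerD//.
      by rewrite (le_trans (fL _ ye))// ler_wpM2r// ler_norm.
    by rewrite normrM ler_wpM2l.
  rewrite (le_trans (y := C * phi y))//; last first.
    by rewrite lerDl mulr_ge0// invr_ge0 ltW.
  rewrite ler_pdivrMr ?normr_gt0// (le_trans EM)// ler_wpM2r//.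
  rewrite /C /phi -mulrA -expRD ler_peMr ?addr_ge0//.
  by rewrite -expR0 ler_expR subr_ge0.
have cphi y : {for y, continuous phi}.
  have c1 : - `|z| @[z --> y] --> - `|y| by apply: cvgN; apply: cvg_norm; exact: cvg_id.
  apply: (cvg_comp _ _ c1); exact: continuous_expR.
have cpsi y : y != 0 -> y != x - p -> {for y, continuous psi}.
  move=> y0 yp.
  apply: cvgM; last by apply: cvgV => //; exact: cvg_id.
  apply: cvgB.
    have c1 : x - z @[z --> y] --> x - y by apply: cvgB; [exact: cvg_cst|exact: cvg_id].
    apply: (cvg_comp _ _ c1); apply: fc.
    by apply: contraNneq yp => <-; rewrite subKr.
  apply: cvgM; first exact: cvg_cst.
  exact: cphi.
have rl := riemann_lebesgue psi1 cpsi.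
have lim : f x * (2 * atan T) + \int[mu]_y (psi y * sin (T * y)) @[T --> +oo] --> pi * f x.
  have : f x * (2 * atan T) + \int[mu]_y (psi y * sin (T * y)) @[T --> +oo]
      --> (f x * (2 * (pi / 2)) + 0 : R).
    apply: cvgD => //; apply: cvgM; first exact: cvg_cst.
    by apply: cvgM; [exact: cvg_cst|exact: cvgy_atan].
  by have -> : f x * (2 * (pi / 2)) + 0 = pi * f x by field.
apply: cvg_trans lim; apply: near_eq_cvg; near=> T.
have T0 : 0 < T by near: T; apply: nbhs_pinfty_gt; exact: num_real.
have mk : measurable_fun [set: R * R] (fun z : R * R => cos (z.1 * z.2)).
  apply: (@measurableT_comp _ _ _ _ _ _ cos).
    by apply: continuous_measurable_fun; exact: continuous_cos.
  exact: measurable_funM.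
have k1 t y : `|cos (t * y)| <= 1 by exact: cos_max.
have [wphi _] := Rintegral_window (k := fun t y => cos (t * y)) phi1 (ltW T0) mk k1.
have [wE IE] := Rintegral_window (k := fun t y => cos (t * y)) E1 (ltW T0) mk k1.
have inner t : \int[mu]_y (f y * cos (t * (x - y))) =
    f x * \int[mu]_y (phi y * cos (t * y)) + \int[mu]_y (E y * cos (t * y)).
  transitivity (\int[mu]_y (f (x - y) * cos (t * y))).
    rewrite -[RHS](Rintegral_subl x); last exact: (L1_measurable (L1_cosM t fx1)).
    by apply: eq_Rintegral => y _; rewrite subKr.
  have pc := L1_cosM t phi1; have ec := L1_cosM t E1.
  rewrite -RintegralZ// -RintegralDT//; last exact: L1Z.
  by apply: eq_Rintegral => y _; rewrite /E; ring.
have mT : measurable (`[0, T]%classic : set (measurableTypeR R)) by exact: measurable_itv.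
transitivity (\int[mu]_(t in `[0, T]) (f x * \int[mu]_y (phi y * cos (t * y))
    + \int[mu]_y (E y * cos (t * y)))); last first.
  by apply: eq_Rintegral => t _; rewrite inner.
rewrite RintegralD//; last exact: (integrableZl mT (f x) wphi).
rewrite RintegralZl// IE; congr (_ * _ + _).
  rewrite -(Rintegral_cauchy T0); apply: eq_Rintegral => t _.
  by have [_ ->] := fourier_expRN_norm t.
apply: eq_Rintegral => y _; rewrite -(Rintegral_cos_scale _ T0) mulrA.
(* At [y = 0] the product of [psi y] and [y] vanishes whatever [psi] is there, and so does [E]. *)
have [->|y0] := eqVneq y 0; last by rewrite /psi divfK.
by rewrite mulr0 /E subr0 /phi normr0 oppr0 expR0 mulr1 subrr.
Unshelve. all: by end_near. Qed.

End inversion.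

(** * Gamma and beta densities in the variable xi *)

Section gamma_beta_densities.
Context {R : realType}.
Local Notation mu := (@lebesgue_measure R).
Implicit Types (f g h : R -> R) (a b d t x y M : R).

Lemma derive_bound_lipschitz f (df : R -> R) e M :
  (forall x, e <= x -> is_derive x (1 : R) f (df x)) ->
  (forall x, e <= x -> `|df x| <= M) ->
  forall x y, e <= x -> e <= y -> `|f x - f y| <= M * `|x - y|.
Proof.
move=> fd fM.
suff H x y : e <= x -> x < y -> `|f x - f y| <= M * `|x - y|.
  move=> x y ex ey; have [xy|xy|->] := ltgtP x y; last by rewrite !subrr normr0 mulr0.
  - exact: H.
  - by rewrite distrC [`|x - y|]distrC; exact: H.
move=> ex xy.
have cf : {within `[x, y], continuous f}.
  apply: derivable_within_continuous => z; rewrite in_itv/= => /andP[xz _].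
  by have [] := fd z (le_trans ex xz).
have [|z /[!in_itv]/= /andP[xz zy] E] := @MVT _ f df _ _ xy _ cf.
  move=> z; rewrite in_itv/= => /andP[xz _].
  by apply: fd; rewrite (le_trans ex)// ltW.
rewrite distrC E normrM [`|x - y|]distrC ler_wpM2r//.
by apply: fM; rewrite (le_trans ex)// ltW.
Qed.

Definition gamma_density a x := expR (- (a * x)) * expR (- expR (- x)).

(** The integrand u^(a - 1) (1 - u)^(d - 1) of Euler's beta integral in the variable u = exp (- x),
    the Jacobian turning u^(a - 1) into u^a. It is not normalized. *)
Definition beta_density a d x := if 0 < x then
  expR (- (a * x)) * expR ((d - 1) * ln (1 - expR (- x))) else 0.

Lemma gamma_density_gt0 a x : 0 < gamma_density a x.
Proof. by rewrite mulr_gt0 ?expR_gt0. Qed.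

Lemma beta_density_ge0 a d x : 0 <= beta_density a d x.
Proof. by rewrite /beta_density; case: ifP => // _; rewrite mulr_ge0 ?expR_ge0. Qed.

Lemma gamma_densityD a b x :
  gamma_density (a + b) x = expR (- (b * x)) * gamma_density a x.
Proof. by rewrite /gamma_density mulrDl opprD expRD; ring. Qed.

Lemma beta_densityD a b d x :
  beta_density (a + b) d x = expR (- (b * x)) * beta_density a d x.
Proof.
rewrite /beta_density; case: ifP => _; last by rewrite mulr0.
by rewrite mulrDl opprD expRD; ring.
Qed.

Lemma measurable_expNM a : measurable_fun [set: R] (fun x => expR (- (a * x))).
Proof.
by apply: measurableT_comp => //; exact: measurableT_comp.
Qed.

Lemma measurable_gamma_density a : measurable_fun [set: R] (gamma_density a).
Proof.
apply: measurable_funM; first exact: measurable_expNM.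
apply: measurableT_comp => //; apply: measurableT_comp => //.
exact: measurable_expN.
Qed.

Lemma measurable_beta_density a d : measurable_fun [set: R] (beta_density a d).
Proof.
apply: measurable_fun_ifT => //; first exact: measurable_fun_ltr.
apply: measurable_funM; first exact: measurable_expNM.
apply: measurableT_comp => //; apply: measurable_funM => //.
apply: measurableT_comp => //; apply: measurable_funB => //.
exact: measurable_expN.
Qed.

(* The exponent [- a x - exp (- x)] is maximal at [x = - ln a]. *)
Lemma gamma_density_le a x : 0 < a -> gamma_density a x <= expR (a * ln a - a).
Proof.
move=> a0; rewrite /gamma_density -expRD ler_expR.
have := expR_ge1Dx (- x - ln a); rewrite [leRHS]expRD [expR (- ln a)]expRN lnK ?posrE//.
by rewrite ler_pdivlMr//; lra.
Qed.

(** For [x > 0] the double exponential is at most 1. For [x <= 0] one unit of the parameter is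
    traded for [expR x]: [gamma_density (a + 1)] is bounded by [C], and the remaining factor
    [expR x] is integrable on that side. *)
Lemma L1_gamma_density a : 0 < a -> L1 (gamma_density a).
Proof.
move=> a0; pose C := expR ((a + 1) * ln (a + 1) - (a + 1)).
have [h1 _] := Rintegral_halfexp a0.
have [p1 _] := @fourier_expRN_norm R 0.
apply: (@L1_le _ _ (fun x => halfexp a x + C * expR (- `|x|))).
- exact: measurable_gamma_density.
- move=> x; rewrite gtr0_norm ?gamma_density_gt0// /halfexp.
  have [x0|x0] := ltP 0 x.
    rewrite (le_trans (y := expR (- (a * x))))//.
      by rewrite ler_piMr ?expR_ge0// -expR0 ler_expR oppr_le0 expR_ge0.
    by rewrite lerDl mulr_ge0 ?expR_ge0.
  rewrite add0r ler0_norm// opprK.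
  have -> : gamma_density a x = gamma_density (a + 1) x * expR x.
    by rewrite gamma_densityD mul1r mulrAC -expRD addNr expR0 mul1r.
  rewrite ler_wpM2r ?expR_ge0//; apply: gamma_density_le; lra.
- by apply: L1D => //; exact: L1Z.
Qed.

Lemma is_derive_gamma_density a x : is_derive x (1 : R) (gamma_density a)
  (gamma_density (a + 1) x - a * gamma_density a x).
Proof.
have d1 : is_derive x (1 : R) (fun y => expR (- (a * y))) (expR (- (a * x)) * - a).
  exact: (is_derive1_comp (is_derive_expR _) (is_derive_Nmulrl a x)).
have d2 : is_derive x (1 : R) (fun y => expR (- expR (- y)))
    (expR (- expR (- x)) * expR (- x)).
  exact: (is_derive1_comp (is_derive_expR _) (is_derive_expN x)).
apply: (is_derive_eq (is_deriveM d1 d2)).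
by rewrite gamma_densityD /GRing.scale /= /gamma_density mul1r; ring.
Qed.

(** The derivative is a combination of [gamma_density (a + 1)] and [gamma_density a], both bounded
    by their maxima. [derive_bound_lipschitz] works on a half-line, here the one starting at
    [Num.min x y]. *)
Lemma gamma_density_lipschitz a : 0 < a -> bounded_lipschitz setT (gamma_density a).
Proof.
move=> a0.
have gM b x : 0 < b -> `|gamma_density b x| <= expR (b * ln b - b).
  by move=> b0; rewrite gtr0_norm ?gamma_density_gt0// gamma_density_le.
apply: (@bounded_lipschitzP _ _ _ (expR (a * ln a - a))
  (expR ((a + 1) * ln (a + 1) - (a + 1)) + a * expR (a * ln a - a))).
- exact: expR_ge0.
- by rewrite addr_ge0 ?mulr_ge0 ?expR_ge0// ltW.
- by move=> x _; exact: gM.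
- move=> x y _ _; apply: (@derive_bound_lipschitz (gamma_density a)
    (fun z => gamma_density (a + 1) z - a * gamma_density a z) (Num.min x y)).
  + by move=> z _; exact: is_derive_gamma_density.
  + move=> z _; rewrite (le_trans (ler_normB _ _))// lerD//.
      by apply: gM; lra.
    by rewrite normrM (gtr0_norm a0) ler_pM2l// gM.
  + by rewrite ge_min lexx.
  + by rewrite ge_min lexx orbT.
Qed.

Lemma regular_density_gamma_density a : 0 < a -> regular_density (gamma_density a).
Proof.
move=> a0; split; [by move=> x; exact/ltW/gamma_density_gt0|exact: L1_gamma_density|].
by left; exact: gamma_density_lipschitz.
Qed.

Lemma beta_density_bounded_lipschitz a d e : 0 < a -> 0 < e ->
  bounded_lipschitz `[e, +oo[ (beta_density a d).
Proof.
move=> a0 e0; pose s x : R := 1 - expR (- x).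
pose b x : R := expR (- (a * x)) * expR ((d - 1) * ln (s x)).
have se : 0 < s e by rewrite /s subr_gt0 -expR0 ltr_expR; lra.
have s0 x : e <= x -> s e <= s x.
  by move=> ex; rewrite lerD2l lerN2 ler_expR lerN2.
have s1 x : s x <= 1 by rewrite /s gerBl expR_ge0.
(* On [[e, +oo[] the quantity [s x] stays between [s e] and 1, so [|ln (s x)|] is at most
   [|ln (s e)|]; the absolute values cover both signs of [d - 1]. *)
pose K := expR (`|d - 1| * `|ln (s e)|).
have bK x : e <= x -> `|b x| <= K.
  move=> ex; rewrite gtr0_norm ?mulr_gt0 ?expR_gt0// -[leRHS]mul1r.
  rewrite ler_pM ?expR_ge0//.
    by rewrite -expR0 ler_expR oppr_le0 mulr_ge0 ?(ltW a0)//; lra.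
  rewrite ler_expR (le_trans (ler_norm _))// normrM ler_wpM2l//.
  have sx : 0 < s x := lt_le_trans se (s0 _ ex).
  rewrite !ler0_norm ?ln_le0//; last by rewrite lerN2 ler_ln ?posrE// s0.
have ds x : is_derive x (1 : R) s (expR (- x)).
  have := is_deriveD (is_derive_cst (1 : R) x (1 : R)) (is_derive_expN x).
  by rewrite add0r.
have db x : e <= x -> is_derive x (1 : R) b
    (b x * (- a + (d - 1) * (expR (- x) / s x))).
  move=> ex; have sx : 0 < s x := lt_le_trans se (s0 _ ex).
  have d1 : is_derive x (1 : R) (fun y => expR (- (a * y))) (expR (- (a * x)) * - a).
    exact: (is_derive1_comp (is_derive_expR _) (is_derive_Nmulrl a x)).
  have d2 : is_derive x (1 : R) (fun y => ln (s y)) ((s x)^-1 * expR (- x)).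
    exact: (is_derive1_comp (is_derive1_ln sx) (ds x)).
  have d3 : is_derive x (1 : R) (fun y => expR ((d - 1) * ln (s y)))
      (expR ((d - 1) * ln (s x)) * ((d - 1) * ((s x)^-1 * expR (- x)))).
    exact: (is_derive1_comp (is_derive_expR _) (is_deriveZ (d - 1) d2)).
  apply: (is_derive_eq (is_deriveM d1 d3)).
  by rewrite /GRing.scale /= /b; ring.
have K0 : 0 <= K by exact: expR_ge0.
have D0 : 0 <= a + `|d - 1| / s e.
  by rewrite addr_ge0 ?(ltW a0)// divr_ge0// ltW.
apply: (@bounded_lipschitz_eq _ _ b).
  by move=> x /=; rewrite in_itv/= andbT => ex; rewrite /beta_density (lt_le_trans e0 ex).
apply: (@bounded_lipschitzP _ _ _ K (K * (a + `|d - 1| / s e))) => //.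
- exact: mulr_ge0.
- by move=> x /=; rewrite in_itv/= andbT; exact: bK.
- move=> x y /=; rewrite !in_itv/= !andbT; apply: (derive_bound_lipschitz db).
  move=> z ez; have sz : 0 < s z := lt_le_trans se (s0 _ ez).
  rewrite normrM ler_pM ?bK//.
  rewrite (le_trans (ler_normD _ _))// normrN gtr0_norm// lerD2l normrM ler_wpM2l//.
  rewrite gtr0_norm ?divr_gt0 ?expR_gt0// -[leRHS]mul1r ler_pM ?expR_ge0 ?invr_ge0 ?(ltW sz)//.
    by rewrite -expR0 ler_expR; lra.
  by rewrite lef_pV2 ?posrE// s0.
Qed.

End gamma_beta_densities.

(** * The real Gamma function and the Gamma-beta convolution *)

Section gamma_function.
Context {R : realType}.
Local Notation mu := (@lebesgue_measure R).
Implicit Types (f g h : R -> R) (a b d t x y M : R).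

Definition real_gamma a : R := \int[mu]_x gamma_density a x.

Lemma real_gammaE a : 0 < a -> (\int[mu]_x (gamma_density a x)%:E = (real_gamma a)%:E)%E.
Proof. by move=> a0; rewrite L1_EFinE//; exact: L1_gamma_density. Qed.

Lemma real_gamma_gt0 a : 0 < a -> 0 < real_gamma a.
Proof.
move=> a0; have [h1 hE] := Rintegral_halfexp a0.
(* For [x > 0], [exp (- exp (- x)) >= exp (- 1)], so [expR (- 1)] times [halfexp a] lies below the
   Gamma density. *)
apply: (lt_le_trans (y := expR (- 1) * a^-1)).
  by rewrite mulr_gt0 ?expR_gt0 ?invr_gt0.
rewrite -hE -RintegralZ//; apply: le_Rintegral => //; [exact: L1Z|exact: L1_gamma_density|].
move=> x _; rewrite /halfexp; case: ifP => x0; last by rewrite mulr0 ltW ?gamma_density_gt0.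
rewrite mulrC ler_wpM2l ?expR_ge0// ler_expR lerN2 -expR0 ler_expR.
by rewrite oppr_le0 ltW.
Qed.

(* The substitution [z = exp y - 1] turns the left-hand side into a Gamma integral. *)
Lemma gamma_beta_convolutionE a d x : 0 < d ->
  (\int[mu]_y (gamma_density (a + d) (x - y) * beta_density a d y)%:E =
   (real_gamma d * gamma_density a x)%:E)%E.
Proof.
move=> d0; pose F y := (gamma_density (a + d) (x - y) * beta_density a d y)%:E.
pose c := expR (- ((a + d) * x)).
(* The integrand in the variable [z = exp y - 1], extended by 0 to [z <= 0] so that the shift by 1
   can be made on the whole line. *)
pose K (z : R) : \bar R := if 0 < z then (c * (expR ((d - 1) * ln z) * expR (- (expR (- x) * (1 + z)))))%:E else 0%E.
have F0 y : (0 <= F y)%E.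
  by rewrite lee_fin mulr_ge0 ?beta_density_ge0// ltW// gamma_density_gt0.
have mF : measurable_fun [set: R] F.
  apply/measurable_EFinP/measurable_funM; last exact: measurable_beta_density.
  apply: (measurableT_comp (measurable_gamma_density _)); exact: measurable_funB.
have K0 z : (0 <= K z)%E.
  by rewrite /K; case: ifP => // _; rewrite lee_fin !mulr_ge0 ?expR_ge0.
have mK : measurable_fun [set: R] K.
  apply: measurable_fun_ifT => //; first exact: measurable_fun_ltr.
  apply/measurable_EFinP; apply: measurable_funM => //; apply: measurable_funM.
    by apply: measurableT_comp => //; exact: measurable_funM.
  apply: measurableT_comp => //; apply: measurableT_comp => //.
  by apply: measurable_funM => //; exact: measurable_funD.
rewrite -[LHS](ge0_integral_opp mF F0).
have step1 y : F (- y) = (K (expR (- y) - 1)%R * (expR (- y))%:E)%E.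
  have cnd : (0 < expR (- y) - 1) = (y < 0).
    by rewrite subr_gt0 -{1}expR0 ltr_expR oppr_gt0.
  rewrite /F /K /beta_density cnd oppr_gt0 !opprK.
  case: ifP => y0; last by rewrite mulr0 mul0e.
  have e1 : 1 < expR (- y) by rewrite -{1}expR0 ltr_expR oppr_gt0.
  have -> : 1 - expR y = (expR (- y) - 1) * expR y.
    by rewrite mulrBl mul1r -expRD addNr expR0.
  rewrite lnM ?posrE ?expR_gt0 ?subr_gt0// expRK -EFinM; congr EFin.
  rewrite /gamma_density /c -!expRD; congr expR.
  have -> : expR (- (x + y)) = expR (- x) * expR (- y) by rewrite opprD expRD.
  by ring.
transitivity (\int[mu]_y (K (expR (- y) - 1)%R * (expR (- y))%:E))%E.
  by apply: eq_integral => y _; rewrite step1.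
have mK1 : measurable_fun [set: R] (fun z => K (z - 1)%R).
  by apply: (measurableT_comp mK); exact: measurable_funB.
rewrite -(ge0_integral_expN (f := fun z => K (z - 1)%R)); last 2 first.
- exact: measurable_funTS mK1.
- by move=> z _; exact: K0.
transitivity (\int[mu]_z K (z - 1)%R)%E.
  rewrite [LHS]integral_mkcond; apply: eq_integral => z _.
  rewrite patchE; case: ifPn => //; rewrite notin_setE/= in_itv/= andbT => /negP z0.
  by rewrite /K ifF//; apply/negbTE; rewrite subr_gt0 -leNgt; lra.
transitivity (\int[mu]_z K z)%E.
  rewrite -[RHS](ge0_integral_addl (-1)%R mK K0).
  by apply: eq_integral => z _; rewrite addrC.
transitivity (\int[mu]_(z in `]0%R, +oo[) K z)%E.
  rewrite [RHS]integral_mkcond; apply: eq_integral => z _.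
  rewrite patchE; case: ifPn => //; rewrite notin_setE/= in_itv/= andbT => /negP z0.
  by rewrite /K ifF//; apply/negbTE.
rewrite ge0_integral_expN; last 2 first.
- exact: measurable_funTS mK.
- by move=> z _; exact: K0.
have mg := measurable_gamma_density d.
(* Under [z = exp (- y)] the last exponential of [K] becomes [exp (- exp (- x)) exp (- exp (- (x +
   y)))], so a translated Gamma density appears, and translation invariance gives Gamma(d). *)
transitivity (\int[mu]_y ((expR (d * x) * c * expR (- expR (- x)))%:E * (gamma_density d (x + y))%:E))%E.
  apply: eq_integral => y _; rewrite /K expR_gt0 expRK -!EFinM; congr EFin.
  rewrite /gamma_density -!expRD; congr expR.
  have -> : expR (- (x + y)) = expR (- x) * expR (- y) by rewrite opprD expRD.
  by ring.
rewrite ge0_integralZl//; last 3 first.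
- apply/measurable_EFinP; apply: (measurableT_comp mg); exact: measurable_funD.
- by move=> y _; rewrite lee_fin ltW ?gamma_density_gt0.
- by rewrite lee_fin !mulr_ge0 ?expR_ge0.
rewrite (ge0_integral_addl (f := fun y => (gamma_density d y)%:E)); last 2 first.
- exact/measurable_EFinP.
- by move=> y; rewrite lee_fin ltW ?gamma_density_gt0.
rewrite real_gammaE// -EFinM; congr EFin; rewrite mulrC; congr (_ * _).
rewrite /gamma_density /c -!expRD; congr expR.
by ring.
Qed.

End gamma_function.

(** * Transforms of beta densities and nonvanishing of Gamma *)

Section gamma_nonvanishing.
Context {R : realType}.
Local Notation mu := (@lebesgue_measure R).
Implicit Types (f g h : R -> R) (a b d t x y M : R).

Let ge0_integralZ (k : R) f : 0 <= k -> measurable_fun [set: R] f ->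
  (forall x, 0 <= f x) ->
  (\int[mu]_x (k * f x)%:E = k%:E * \int[mu]_x (f x)%:E)%E.
Proof.
move=> k0 mf f0; transitivity (\int[mu]_x (k%:E * (f x)%:E))%E; first by [].
rewrite ge0_integralZl//; first exact/measurable_EFinP.
by move=> x _; rewrite lee_fin.
Qed.

(* By Tonelli, integrating [gamma_beta_convolutionE] over [x] bounds the integral
   of [beta_density a d] by [Gamma(a) Gamma(d) / Gamma(a + d)]. *)
Lemma L1_beta_density a d : 0 < a -> 0 < d -> L1 (beta_density a d).
Proof.
move=> a0 d0; apply/L1P; split; first exact: measurable_beta_density.
have ad0 : 0 < a + d by exact: addr_gt0.
have mg : measurable_fun [set: R] (gamma_density (a + d)) by exact: measurable_gamma_density.
have mb : measurable_fun [set: R] (beta_density a d) by exact: measurable_beta_density.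
have mF : measurable_fun [set: measurableTypeR R * measurableTypeR R]
    (fun z : measurableTypeR R * measurableTypeR R =>
      (gamma_density (a + d) (z.1 - z.2) * beta_density a d z.2)%:E).
  have m1 : measurable_fun [set: R * R] (fun z : R * R => gamma_density (a + d) (z.1 - z.2)).
    by apply: (measurableT_comp mg); exact: measurable_funB.
  have m2 : measurable_fun [set: R * R] (fun z : R * R => beta_density a d z.2).
    exact: (measurableT_comp mb).
  have /measurable_EFinP := measurable_funM m1 m2; exact.
have F0 (z : measurableTypeR R * measurableTypeR R) :
    (0 <= (gamma_density (a + d) (z.1 - z.2) * beta_density a d z.2)%:E)%E.
  by rewrite lee_fin mulr_ge0 ?beta_density_ge0// ltW// gamma_density_gt0.
have FT : (\int[mu]_x \int[mu]_y (gamma_density (a + d) (x - y) * beta_density a d y)%:E =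
    \int[mu]_y \int[mu]_x (gamma_density (a + d) (x - y) * beta_density a d y)%:E)%E.
  exact: (@fubini_tonelli _ _ (measurableTypeR R) (measurableTypeR R) R mu mu _ mF F0).
have E1 : (\int[mu]_x \int[mu]_y (gamma_density (a + d) (x - y) * beta_density a d y)%:E =
    (real_gamma d * real_gamma a)%:E)%E.
  rewrite -RintegralZ; last exact: L1_gamma_density.
  rewrite -L1_EFinE; last exact/L1Z/L1_gamma_density.
  by apply: eq_integral => x _; exact: gamma_beta_convolutionE.
have G0 := real_gamma_gt0 ad0; have GE := real_gammaE ad0.
move: (real_gamma (a + d)) G0 GE => G G0 GE.
have mgE : measurable_fun [set: R] (fun x => (gamma_density (a + d) x)%:E).
  exact/measurable_EFinP.
have gE0 x : (0 <= (gamma_density (a + d) x)%:E)%E.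
  by rewrite lee_fin; apply: ltW; exact: gamma_density_gt0.
have b0 := beta_density_ge0 a d.
have E2 : (\int[mu]_y \int[mu]_x (gamma_density (a + d) (x - y) * beta_density a d y)%:E =
    G%:E * \int[mu]_y (beta_density a d y)%:E)%E.
  rewrite -(ge0_integralZ (ltW G0) mb b0).
  apply: eq_integral => y _; rewrite mulrC EFinM -GE.
  rewrite -(ge0_integral_addl (- y) mgE gE0).
  have mgy : measurable_fun [set: R] (fun x => gamma_density (a + d) (- y + x)).
    by apply: (measurableT_comp mg); exact: measurable_funD.
  rewrite -(ge0_integralZ (b0 y) mgy (fun x => ltW (gamma_density_gt0 _ _))).
  by apply: eq_integral => x _; rewrite [- y + x]addrC; congr EFin; exact: mulrC.
have -> : (\int[mu]_y `|beta_density a d y|%:E = \int[mu]_y (beta_density a d y)%:E)%E.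
  by apply: eq_integral => y _; rewrite (ger0_norm (b0 y)).
have := etrans (esym E1) (etrans FT E2) => {E1 E2 FT}.
move: (real_gamma d * _) (\int[mu]_y (beta_density a d y)%:E)%E => X Y XY.
rewrite ltey; apply/eqP => oo; move: XY; rewrite oo gt0_muley; last by rewrite lte_fin.
by move=> H; have := ltry X; rewrite H ltxx.
Qed.

Lemma regular_density_beta_density a d : 0 < a -> 0 < d -> regular_density (beta_density a d).
Proof.
move=> a0 d0; split; [exact: beta_density_ge0|exact: L1_beta_density|right].
split; last by move=> e e0; exact: beta_density_bounded_lipschitz.
by move=> x x0; rewrite /beta_density ifF//; apply/negbTE; rewrite -leNgt.
Qed.

Lemma gamma_beta_convolution a d : 0 < d ->
  convolution (gamma_density (a + d)) (beta_density a d) =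
  (fun x => real_gamma d * gamma_density a x).
Proof.
by move=> d0; apply/funext => x; rewrite /convolution /Rintegral gamma_beta_convolutionE.
Qed.

Lemma fourierZ (k : R) f t : L1 f ->
  fourier (fun x => k * f x) t = k%:C%C * fourier f t.
Proof.
move=> f1; rewrite /fourier.
have fc := L1_cosM t f1; have fs := L1_sinM t f1.
have -> : \int[mu]_x (k * f x * cos (t * x)) = k * \int[mu]_x (f x * cos (t * x)).
  by rewrite -RintegralZ//; apply: eq_Rintegral => x _; rewrite mulrA.
have -> : \int[mu]_x (k * f x * sin (t * x)) = k * \int[mu]_x (f x * sin (t * x)).
  by rewrite -RintegralZ//; apply: eq_Rintegral => x _; rewrite mulrA.
by apply/eqP; rewrite eq_complex /=; apply/andP; split; apply/eqP; ring.
Qed.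

Lemma fourier_gamma_beta a d t : 0 < a -> 0 < d ->
  fourier (gamma_density (a + d)) t * fourier (beta_density a d) t =
  (real_gamma d)%:C%C * fourier (gamma_density a) t.
Proof.
move=> a0 d0; rewrite -fourierZ; last exact: L1_gamma_density.
rewrite -gamma_beta_convolution// fourier_convolution//.
- by apply: regular_density_gamma_density; exact: addr_gt0.
- exact: regular_density_beta_density.
Qed.

Lemma Rintegral_gamma_beta a d : 0 < a -> 0 < d ->
  real_gamma (a + d) * \int[mu]_x beta_density a d x = real_gamma d * real_gamma a.
Proof.
move=> a0 d0; have g1 := L1_gamma_density a0.
rewrite -(RintegralZ (real_gamma d) g1).
transitivity (\int[mu]_x convolution (gamma_density (a + d)) (beta_density a d) x).
  rewrite Rintegral_convolution//; last exact: regular_density_beta_density.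
  by apply: regular_density_gamma_density; exact: addr_gt0.
by apply: eq_Rintegral => x _; rewrite gamma_beta_convolution.
Qed.

Lemma beta_density1 a : beta_density a 1 = halfexp a.
Proof.
apply/funext => x; rewrite /beta_density /halfexp; case: ifP => // _.
by rewrite subrr mul0r expR0 mulr1.
Qed.

Lemma real_gamma1 : real_gamma 1 = 1 :> R.
Proof.
have [h1 hE] := @Rintegral_halfexp R 1 ltr01.
rewrite invr1 in hE; rewrite -[RHS]hE.
have me : measurable_fun [set: R] (fun x : R => expR (- x)) by exact: measurable_expN.
transitivity (\int[mu]_(x in `]0%R, +oo[) expR (- x)).
  rewrite Rintegral_expN; last exact: measurable_funTS.
  by apply: eq_Rintegral => x _; rewrite /gamma_density mul1r mulrC.
rewrite Rintegral_mkcond; apply: eq_Rintegral => x _.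
rewrite patchE /halfexp mul1r; congr (if _ then _ else _).
by apply/idP/idP; rewrite inE/= in_itv/= andbT.
Qed.

(** The case [d = 1] of the Gamma-beta identity: [beta_density a 1] is [halfexp a], of mass 1 / a,
    and Gamma(1) = 1. [fourier_gammaS] is the same argument on transforms. *)
Lemma real_gammaS a : 0 < a -> real_gamma (a + 1) = a * real_gamma a.
Proof.
move=> a0; have := Rintegral_gamma_beta a0 ltr01.
rewrite beta_density1 real_gamma1 mul1r; have [_ ->] := Rintegral_halfexp a0.
by move=> <-; rewrite mulrC divfK// gt_eqF.
Qed.

Lemma fourier_gammaS a t : 0 < a ->
  fourier (gamma_density (a + 1)) t = Complex a t * fourier (gamma_density a) t.
Proof.
move=> a0; have := fourier_gamma_beta t a0 ltr01.
rewrite beta_density1 real_gamma1 mul1r fourier_halfexp// => <-.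
rewrite mulrC divfK//; apply/negP => /eqP /(congr1 (@complex.Re R)) /= a00.
by rewrite a00 ltxx in a0.
Qed.

Lemma cos_ge x : 1 - x ^+ 2 / 2 <= cos x.
Proof.
have sl y : `|sin y| <= `|y|.
  have := @derive_bound_lipschitz R sin cos (Num.min 0 y) 1.
  move=> /(_ (fun z _ => is_derive_sin z) (fun z _ => cos_max z) y 0).
  by rewrite !ge_min !lexx orbT sin0 !subr0 mul1r; apply.
have -> : cos x = 1 - 2 * sin (x / 2) ^+ 2.
  rewrite [X in cos X](splitr x) cosD -!expr2.
  by have := cos2Dsin2 (x / 2); lra.
have := sl (x / 2); rewrite -ler_sqr ?nnegrE// !real_normK ?num_real//.
have -> : (x / 2) ^+ 2 = x ^+ 2 / 4 by field.
lra.
Qed.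

(** For [x >= 0], squaring [1 + x / 2 <= exp (x / 2)] gives [1 + x + x^2 / 4 <= exp x]; adding
    [1 - x <= exp (- x)] leaves [x^2 / 4], whence the factor 4. *)
Lemma sqr_le_expRD x : x ^+ 2 <= 4 * (expR x + expR (- x) - 2).
Proof.
wlog x0 : x / 0 <= x.
  move=> H; have [/H//|x0] := leP 0 x.
  have := H (- x); rewrite oppr_ge0 ltW// sqrrN opprK [expR (- x) + _]addrC.
  exact.
have h1 := expR_ge1Dx (x / 2); have h2 := expR_ge1Dx (- x).
have h3 : (1 + x / 2) ^+ 2 <= expR x.
  rewrite [X in _ <= expR X](splitr x) expRD -expr2 ler_sqr ?nnegrE ?expR_ge0//.
  by rewrite addr_ge0// divr_ge0.
have : (1 + x / 2) ^+ 2 = 1 + x + x ^+ 2 / 4 by field.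
by move=> h4; rewrite h4 in h3; lra.
Qed.

(* For large [a], the mass of [gamma_density a] sits near [- ln a], so the
   oscillation of [cos (t (x + ln a))] is too slow to cancel its integral; the
   bound [y^2 <= 4 (exp y + exp (- y) - 2)] reduces the second moment about
   [- ln a] to the values [Gamma(a - 1)], [Gamma(a)], [Gamma(a + 1)]. *)
Let fourier_gamma_neq0_large a t : 1 + 2 * t ^+ 2 < a ->
  fourier (gamma_density a) t != 0.
Proof.
move=> ta; have t20 : 0 <= t ^+ 2 by exact: sqr_ge0.
have a0 : 0 < a by lra. have a1 : 0 < a - 1 by lra.
have g1 := L1_gamma_density a0.
have gc := L1_cosM t g1; have gs := L1_sinM t g1.
apply/negP => /eqP E0.
have C0 : \int[mu]_x (gamma_density a x * cos (t * x)) = 0.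
  by move/(congr1 (@complex.Re R)): E0.
have S0 : \int[mu]_x (gamma_density a x * sin (t * x)) = 0.
  by move/(congr1 (@complex.Im R)): E0 => /= /eqP; rewrite oppr_eq0 => /eqP.
pose c := cos (t * ln a); pose s := sin (t * ln a).
have I0 : \int[mu]_x (c * (gamma_density a x * cos (t * x)) -
    s * (gamma_density a x * sin (t * x))) = 0.
  rewrite RintegralBT; [|exact: L1Z|exact: L1Z].
  by rewrite !RintegralZ// C0 S0 !mulr0 subr0.
have gam : L1 (gamma_density (a - 1)) by exact: L1_gamma_density.
have gap : L1 (gamma_density (a + 1)) by apply: L1_gamma_density; lra.
have Gm : real_gamma a = (a - 1) * real_gamma (a - 1).
  by rewrite -real_gammaS// subrK.
(* [L] is the Gamma density times the lower bound [1 - 2 t^2 (exp z + exp (- z) - 2)] for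
   [cos (t z)], with [z = x + ln a]. Its integral is [(1 - 2 t^2 / (a - 1)) Gamma(a)], which the
   hypothesis [a > 1 + 2 t^2] makes positive. *)
pose L x := (1 + 4 * t ^+ 2) * gamma_density a x -
  (2 * t ^+ 2 * a * gamma_density (a - 1) x + 2 * t ^+ 2 / a * gamma_density (a + 1) x).
have L1L : L1 L.
  by apply: L1B; [exact: L1Z|apply: L1D; exact: L1Z].
have LE : \int[mu]_x L x = (1 - 2 * t ^+ 2 / (a - 1)) * real_gamma a.
  rewrite /L RintegralBT; [|exact: L1Z|by apply: L1D; exact: L1Z].
  rewrite RintegralDT; [|exact: L1Z|exact: L1Z].
  rewrite !RintegralZ// -!/(real_gamma _) real_gammaS// Gm.
  by field; rewrite !gt_eqF.
have : \int[mu]_x L x <= 0.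
  rewrite -I0; apply: le_Rintegral => //.
    by apply: L1B; exact: L1Z.
  move=> x _; have <- : gamma_density a x * cos (t * (x + ln a)) =
      c * (gamma_density a x * cos (t * x)) - s * (gamma_density a x * sin (t * x)).
    by rewrite mulrDr cosD /c /s; ring.
  have -> : L x = gamma_density a x *
      (1 - 2 * t ^+ 2 * (expR (x + ln a) + expR (- (x + ln a)) - 2)).
    have ea : gamma_density (a - 1) x = gamma_density a x * expR x.
      by rewrite gamma_densityD mulN1r opprK mulrC.
    have ep : gamma_density (a + 1) x = gamma_density a x * expR (- x).
      by rewrite gamma_densityD mul1r mulrC.
    have e1 : expR (x + ln a) = expR x * a by rewrite expRD lnK ?posrE.
    have e2 : expR (- (x + ln a)) = expR (- x) / a.
      by rewrite opprD expRD [expR (- ln a)]expRN lnK ?posrE.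
    by rewrite /L ea ep e1 e2; field; rewrite gt_eqF.
  rewrite (ler_wpM2l (ltW (gamma_density_gt0 _ _)))//.
  apply: le_trans (cos_ge _); rewrite exprMn.
  have H := sqr_le_expRD (x + ln a).
  have : t ^+ 2 * (x + ln a) ^+ 2 <= t ^+ 2 * (4 * (expR (x + ln a) + expR (- (x + ln a)) - 2)).
    exact: ler_wpM2l.
  by lra.
rewrite LE leNgt => /negP; apply; rewrite mulr_gt0 ?real_gamma_gt0// subr_gt0.
by rewrite ltr_pdivrMr//; lra.
Qed.

(** By the functional equation a zero at [a] would recur at every [a + n], against the case of large
    parameters. This permits the division by Gamma(b + i t) in [Gamma_ratio]. *)
Lemma fourier_gamma_neq0 a t : 0 < a -> fourier (gamma_density a) t != 0.
Proof.
move=> a0; apply/negP => /eqP E0.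
have En n : fourier (gamma_density (a + n%:R)) t = 0.
  elim: n => [|n IH]; first by rewrite addr0.
  by rewrite -natr1 addrA fourier_gammaS ?IH ?mulr0// ltr_wpDr.
pose n := (Num.truncn (1 + 2 * t ^+ 2)).+1.
suff : fourier (gamma_density (a + n%:R)) t != 0 by rewrite En eqxx.
by apply: fourier_gamma_neq0_large; rewrite (lt_le_trans (truncnS_gt _))// lerDr ltW.
Qed.

End gamma_nonvanishing.

(** * The Mellin-Barnes integral as Fourier inversion *)

Section mellin_barnes.
Context {R : realType}.
Local Notation mu := (@lebesgue_measure R).
Implicit Types (f g h : R -> R) (a b c t x y T : R).
Local Open Scope complex_scope.

Lemma measurable_ln_itv : measurable_fun (`]0%R, +oo[%classic : set R) (@ln R).
Proof. exact: measurable_funTS. Qed.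

Lemma Gamma_fourier a t : 0 < a -> Gamma (a +i* t) = fourier (gamma_density a) t.
Proof.
move=> a0; rewrite /Gamma /= a0 /pochhammer big_ord0 addr0 divr1.
rewrite /euler_integral /cintegral /fourier.
have E x : cpow x (a +i* t - 1) * (expR (- x))%:C =
    (expR ((a - 1) * ln x) * expR (- x) * cos (t * ln x)) +i*
    (expR ((a - 1) * ln x) * expR (- x) * sin (t * ln x)).
  apply/eqP; rewrite eq_complex /cpow /cexp /=.
  by apply/andP; split; apply/eqP; rewrite ?subr0 ?addr0 !(mulr0, mul0r, subr0, addr0, add0r); ring.
have mln := measurable_ln_itv.
have me : measurable_fun (`]0%R, +oo[%classic : set R) (fun x => expR ((a - 1) * ln x) * expR (- x)).
  apply: measurable_funM; last by apply: measurable_funTS; exact: measurable_expN.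
  apply: (measurableT_comp (@measurable_expR R)).
  exact: (measurable_funM (measurable_cst (a - 1)) mln).
have mt : measurable_fun (`]0%R, +oo[%classic : set R) (fun x => t * ln x).
  exact: (measurable_funM (measurable_cst t) mln).
have mc : measurable_fun [set: R] (@cos R).
  by apply: continuous_measurable_fun; exact: continuous_cos.
have ms : measurable_fun [set: R] (@sin R).
  by apply: continuous_measurable_fun; exact: continuous_sin.
have gE x : expR ((a - 1) * - x) * expR (- expR (- x)) * expR (- x) = gamma_density a x.
  by rewrite /gamma_density -!expRD; congr expR; ring.
congr Complex.
- under eq_Rintegral do rewrite E /=.
  rewrite Rintegral_expN; last first.
    by apply: measurable_funM => //; exact: measurableT_comp.
  apply: eq_Rintegral => x _; rewrite expRK mulrAC gE mulrN cosN.
  by [].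
- under eq_Rintegral do rewrite E /=.
  rewrite Rintegral_expN; last first.
    by apply: measurable_funM => //; exact: measurableT_comp.
  rewrite -[RHS]mulN1r -RintegralZ; last exact/L1_sinM/L1_gamma_density.
  apply: eq_Rintegral => x _; rewrite expRK mulrAC gE mulrN sinN.
  by rewrite mulN1r mulrN.
Qed.

Lemma Gamma_ratio a b t : 0 < a -> a < b ->
  Gamma (a +i* t) / Gamma (b +i* t) =
  fourier (fun x => (real_gamma (b - a))^-1 * beta_density a (b - a) x) t.
Proof.
move=> a0 ab; have d0 : 0 < b - a by rewrite subr_gt0.
have b0 : 0 < b by exact: lt_trans ab.
rewrite !Gamma_fourier// fourierZ; last exact: L1_beta_density.
have := fourier_gamma_beta t a0 d0; rewrite [a + (b - a)]addrC subrK => H.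
have G0 : (real_gamma (b - a))%:C != 0.
  by rewrite eq_complex /= eqxx andbT gt_eqF// real_gamma_gt0.
have F0 := fourier_gamma_neq0 t b0.
apply: (mulfI G0); rewrite mulrA -H.
rewrite mulrAC divff// mul1r mulrA.
have -> : ((real_gamma (b - a))^-1)%:C = ((real_gamma (b - a))%:C)^-1.
  exact: (fmorphV (real_complex R)).
by rewrite divff// mul1r.
Qed.

Lemma Rintegral_itv_opp g T : measurable_fun (`[- T, 0]%classic : set R) g ->
  \int[mu]_(t in `[- T, 0]) g t = \int[mu]_(t in `[0, T]) g (- t).
Proof.
move=> mg; rewrite [LHS]Rintegral_mkcond [RHS]Rintegral_mkcond.
rewrite -[LHS]Rintegral_opp; last first.
  by apply/(measurable_restrictT _ _).1 => //; exact: measurable_itv.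
apply: eq_Rintegral => t _; rewrite !patchE; congr (if _ then _ else _).
by apply/idP/idP; rewrite !inE/= !in_itv/= => /andP[t1 t2]; apply/andP; split; lra.
Qed.

(** On the contour, [cpow (expR (- x)) (- u)] is [exp (c x) (cos (t x) + i sin (t x))], so the
    integrand is [exp (c x) (G t + i H t)] with [G] even and [H] odd. Each half-line contributes
    [exp (c x) pi D(x)] for [G], and the two contributions of [H] cancel; the prefactor
    [1 / (2 i pi)] and the [i] of the parametrization then leave [exp (c x) D(x)]. *)
Lemma meijerG_inversion (r s : nat) c (b : 'I_s -> R[i]) (a : 'I_r -> R[i])
    (D : R -> R) x : L1 D -> local_lipschitz D x ->
  (forall z, z != 0 -> {for z, continuous D}) ->
  (forall t, (\prod_(i < r) Gamma (a i + (c +i* t))) /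
    (\prod_(j < s) Gamma (b j + (c +i* t))) = fourier D t) ->
  meijerG c b a (expR (- x)) = (expR (c * x) * D x)%:C.
Proof.
move=> D1 Dx Dc FD; rewrite /meijerG /vertical_integral.
pose G t := \int[mu]_y (D y * cos (t * (x - y))).
pose H t := \int[mu]_y (D y * sin (t * (x - y))).
have pw t : cpow (expR (- x)) (- (c +i* t)) =
    (expR (c * x) * cos (t * x)) +i* (expR (c * x) * sin (t * x)).
  rewrite /cpow /cexp expRK; apply/eqP; rewrite eq_complex /=.
  have -> : - c * - x - - t * 0 = c * x by ring.
  have -> : - c * 0 + - t * - x = t * x by ring.
  by apply/andP; split; apply/eqP; ring.
have Dcos t := L1_cosM t D1; have Dsin t := L1_sinM t D1.
have GE t : G t = (\int[mu]_y (D y * cos (t * y))) * cos (t * x) +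
    (\int[mu]_y (D y * sin (t * y))) * sin (t * x).
  rewrite -!RintegralZ_r// -RintegralDT; last 2 first.
  - by have := L1Z (cos (t * x)) (Dcos t); apply: eq_integrable => // y _; rewrite /= mulrC.
  - by have := L1Z (sin (t * x)) (Dsin t); apply: eq_integrable => // y _; rewrite /= mulrC.
  by apply: eq_Rintegral => y _; rewrite mulrBr cosB; ring.
have HE t : H t = (\int[mu]_y (D y * cos (t * y))) * sin (t * x) -
    (\int[mu]_y (D y * sin (t * y))) * cos (t * x).
  rewrite -!RintegralZ_r// -RintegralBT; last 2 first.
  - by have := L1Z (sin (t * x)) (Dcos t); apply: eq_integrable => // y _; rewrite /= mulrC.
  - by have := L1Z (cos (t * x)) (Dsin t); apply: eq_integrable => // y _; rewrite /= mulrC.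
  by apply: eq_Rintegral => y _; rewrite mulrBr sinB; ring.
pose F (u : R[i]) : R[i] := (\prod_(i < r) Gamma (a i + u)) /
  (\prod_(j < s) Gamma (b j + u)) * cpow (expR (- x)) (- u).
have ReF t : complex.Re (F (c +i* t)) = expR (c * x) * G t.
  by rewrite /F FD pw /= GE; ring.
have ImF t : complex.Im (F (c +i* t)) = expR (c * x) * H t.
  by rewrite /F FD pw /= HE; ring.
have mm (k : R -> R) : measurable_fun [set: R] k ->
    measurable_fun [set: R * R] (fun z : R * R => k (z.1 * (x - z.2))).
  move=> mk; apply: (measurableT_comp mk); apply: measurable_funM => //.
  exact: measurable_funB.
have mcos : measurable_fun [set: R] (@cos R).
  by apply: continuous_measurable_fun; exact: continuous_cos.
have msin : measurable_fun [set: R] (@sin R).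
  by apply: continuous_measurable_fun; exact: continuous_sin.
have win (k : R -> R) (T1 T2 : R) : measurable_fun [set: R] k -> (forall y, `|k y| <= 1) ->
    T1 <= T2 -> mu.-integrable `[T1, T2]
      (fun t => (expR (c * x) * \int[mu]_y (D y * k (t * (x - y))))%:E).
  move=> mk k1 T12.
  have [w _] := Rintegral_window (k := fun t y => k (t * (x - y))) D1 T12 (mm _ mk) (fun _ _ => k1 _).
  apply: (integrableZl _ (expR (c * x)) w); exact: measurable_itv.
have mwin (k : R -> R) (T : R) : measurable_fun [set: R] k -> (forall y, `|k y| <= 1) ->
    measurable_fun (`[- T, 0]%classic : set R)
      (fun t => expR (c * x) * \int[mu]_y (D y * k (t * (x - y)))).
  move=> mk k1; have [T0|T0] := leP 0 T.
    have /integrableP[/measurable_EFinP] := win k (- T) 0 mk k1 (ltac:(lra)).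
    by [].
  have -> : (`[- T, 0]%classic : set R) = set0.
    by rewrite -subset0 => z /=; rewrite in_itv/=; lra.
  exact: measurable_fun_set0.
have GN t : G (- t) = G t.
  by apply: eq_Rintegral => y _; rewrite mulNr cosN.
have HN t : H (- t) = - H t.
  rewrite /H -[RHS]mulN1r -RintegralZ; last first.
    apply: (@L1_bounded _ _ _ 1) => // [|y]; last exact: sin_max.
    apply: (measurableT_comp msin); apply: measurable_funM => //.
    exact: measurable_funB.
  by apply: eq_Rintegral => y _; rewrite mulNr sinN; ring.
have inv : \int[mu]_(t in `[0, T]) (expR (c * x) * G t) @[T --> +oo] -->
    (expR (c * x) * (pi * D x) : R).
  have key := @fourier_inversion _ _ _ 0 D1 Dx Dc.
  have : expR (c * x) * (\int[mu]_(t in `[0, T]) G t) @[T --> +oo] -->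
    (expR (c * x) * (pi * D x) : R) by apply: cvgM => //; exact: cvg_cst.
  apply: cvg_trans; apply: near_eq_cvg; near=> T.
  rewrite RintegralZl//.
  have T0 : 0 <= T by near: T; apply: nbhs_pinfty_ge; exact: num_real.
  have [w _] := Rintegral_window (k := fun t y => cos (t * (x - y))) D1 T0 (mm _ mcos) (fun _ _ => cos_max _).
  exact: w.
have -> : improper_integral (fun t => complex.Re (F (c +i* t))) =
    expR (c * x) * (pi * D x) + expR (c * x) * (pi * D x).
  rewrite /improper_integral (funext ReF); congr (_ + _); last exact: cvg_lim inv.
  apply: cvg_lim => //; apply: cvg_trans inv; apply: near_eq_cvg; near=> T.
  rewrite Rintegral_itv_opp; first by apply: eq_Rintegral => t _; rewrite GN.
  by apply: mwin => // y; exact: cos_max.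
have -> : improper_integral (fun t => complex.Im (F (c +i* t))) = 0.
  rewrite /improper_integral (funext ImF).
  set B := fun T : R => \int[mu]_(t in `[0, T]) (expR (c * x) * H t).
  have -> : (fun T : R => \int[mu]_(t in `[- T, 0]) (expR (c * x) * H t)) = (fun T => - B T).
    apply/funext => T; rewrite Rintegral_itv_opp; last first.
      by apply: mwin => // y; exact: sin_max.
    have -> : \int[mu]_(t in `[0, T]) (expR (c * x) * H (- t)) =
        \int[mu]_(t in `[0, T]) (-1 * (expR (c * x) * H t)).
      by apply: eq_Rintegral => t _; rewrite HN mulrN mulN1r.
    have [T0|T0] := leP 0 T.
      by rewrite RintegralZl ?mulN1r//; apply: (win sin 0 T) => // y; exact: sin_max.
    have E0 : (`[0, T]%classic : set R) = set0.
      by rewrite -subset0 => z /=; rewrite in_itv/=; lra.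
    by rewrite /B E0 !Rintegral_set0 oppr0.
  (* If the half-line integral of the odd part diverges, both limits take the default value 0, so
     the sum is 0 in either case. *)
  have [cB|ncB] := pselect (cvg (B T @[T --> +oo])).
    by rewrite limN// addNr.
  rewrite [X in _ + X]dvgP// dvgP ?addr0//.
  move=> /is_cvgN cNB; apply: ncB; move: cNB.
  by rewrite (_ : - _ = B)//; apply/funext => T; exact: opprK.
have pi0 : (pi : R) != 0 by rewrite gt_eqF// pi_gt0.
have cpi0 : 2 * (0 +i* (pi : R)) != 0.
  rewrite mulf_neq0 ?pnatr_eq0//.
  by rewrite eq_complex /= eqxx.
apply: (mulfI cpi0); rewrite mulVKf//.
apply/eqP; rewrite eq_complex /=.
by apply/andP; split; apply/eqP; ring.
Unshelve. all: by end_near. Qed.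

End mellin_barnes.

(** * Iterated convolutions *)

Section convolutions.
Context {R : realType} {I : eqType}.
Local Notation mu := (@lebesgue_measure R).
Implicit Types (h : I -> R -> R) (l : seq I).

(** The unit of convolution is a Dirac mass, not a function: hence the separate case of one factor
    and a dummy value for the empty list. *)
Fixpoint convolutions h l : R -> R := match l with
  | [::] => fun=> 0
  | [:: i] => h i
  | i :: l' => convolution (h i) (convolutions h l')
  end.

Lemma convolutions_cons h i l : l <> [::] ->
  convolutions h (i :: l) = convolution (h i) (convolutions h l).
Proof. by case: l. Qed.

Lemma regular_density_convolutions h l : (forall i, regular_density (h i)) -> l <> [::] ->
  regular_density (convolutions h l).
Proof.
move=> hn; elim: l => // i [|j l] IH _; first exact: hn.
rewrite convolutions_cons//; have [//|_] := regular_density_convolution (hn i) (IH _).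
by apply.
Qed.

Lemma fourier_convolutions h l t : (forall i, regular_density (h i)) -> l <> [::] ->
  fourier (convolutions h l) t = \prod_(i <- l) fourier (h i) t.
Proof.
move=> hn; elim: l => // i [|j l] IH _; first by rewrite big_seq1.
rewrite big_cons -IH// convolutions_cons//.
by apply: fourier_convolution => //; exact: regular_density_convolutions.
Qed.

Lemma Rintegral_convolutions h l : (forall i, regular_density (h i)) -> l <> [::] ->
  \int[mu]_x convolutions h l x = \prod_(i <- l) \int[mu]_x h i x.
Proof.
move=> hn; elim: l => // i [|j l] IH _; first by rewrite big_seq1.
rewrite big_cons -IH// convolutions_cons//.
by apply: Rintegral_convolution => //; exact: regular_density_convolutions.
Qed.

(** The weight is multiplicative, [exp (- c x) = exp (- c (x - y)) exp (- c y)], so it distributes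
    over the factors of a convolution. *)
Lemma convolutions_expM h l (c : R) : (forall i, regular_density (h i)) ->
  convolutions (fun i x => expR (- (c * x)) * h i x) l =
  (fun x => expR (- (c * x)) * convolutions h l x).
Proof.
move=> hn; elim: l => [|i [|j l] IH].
- by apply/funext => x /=; rewrite mulr0.
- by [].
rewrite (@convolutions_cons _ i (j :: l))// IH (@convolutions_cons h i (j :: l))//.
apply/funext => x.
have [|fg _] := regular_density_convolution (hn i) (@regular_density_convolutions h (j :: l) hn _) => //.
rewrite /convolution -RintegralZ; last exact: fg.
apply: eq_Rintegral => y _.
have -> : expR (- (c * x)) = expR (- (c * (x - y))) * expR (- (c * y)).
  by rewrite -expRD; congr expR; ring.
by ring.
Qed.

Lemma convolutions0 h l x : (forall i y, y <= 0 -> h i y = 0) -> x <= 0 ->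
  convolutions h l x = 0.
Proof.
move=> h0; elim: l x => // i [|j l] IH x x0; first exact: h0.
have Z y : h i (x - y) * convolutions h (j :: l) y = 0.
  have [y0|y0] := leP y 0; first by rewrite IH ?mulr0.
  by rewrite h0 ?mul0r//; lra.
rewrite convolutions_cons// /convolution.
by rewrite (eq_Rintegral _ (g := cst 0)) ?Rintegral_cst//= ?mul0r.
Qed.

Lemma convolutions_lipschitz h l i0 : (forall i, regular_density (h i)) -> i0 \in l ->
  bounded_lipschitz setT (h i0) -> bounded_lipschitz setT (convolutions h l).
Proof.
move=> hn il hL; elim: l il => // i [|j l] IH; first by rewrite inE => /eqP <-.
have nl : regular_density (convolutions h (j :: l)) by exact: regular_density_convolutions.
rewrite convolutions_cons//; have [_ l1 _] := nl; have [_ i1 _] := hn i.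
rewrite inE => /predU1P[<-|/IH lL].
  by have [] := convolution_lipschitzT (regular_density_measurable (hn i0)) hL l1.
rewrite convolutionC; [|exact: regular_density_measurable|exact: regular_density_measurable].
by have [] := convolution_lipschitzT (regular_density_measurable nl) lL i1.
Qed.

End convolutions.

(** * Pairing the indices j with the positions lambda_j *)

Section big_partner.
Context {r s : nat} (lam : 'I_s -> nat).
Hypothesis lam_range : forall j, (1 <= lam j <= r)%N.
Hypothesis lam_inj : injective lam.

(** [j |-> lam j - 1] embeds the indices of [b] into those of [a], so every [i] has at most one
    partner [j]. Both Gamma products can then be indexed by [i], which pairs each factor of the
    denominator with one of the numerator. *)
Lemma big_partner (T : Type) (idx : T) (op : Monoid.com_law idx) (F : 'I_s -> T) :
  \big[op/idx]_(i < r) (if [pick j | lam j == i.+1] is Some j then F j else idx) =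
  \big[op/idx]_(j < s) F j.
Proof.
have lamP j : ((lam j).-1 < r)%N.
  by have /andP[] := lam_range j; case: (lam j).
rewrite (partition_big (fun j => Ordinal (lamP j)) xpredT)//=.
apply: eq_bigr => i _.
have lamE j : (Ordinal (lamP j) == i) = (lam j == i.+1).
  have /andP[+ _] := lam_range j; rewrite -val_eqE/=.
  by case: (lam j) => // n _; rewrite eqSS.
rewrite (eq_bigl _ _ lamE); case: pickP => [j ji|none].
  rewrite (big_pred1 j)// => j'; apply/idP/eqP => [/eqP j'i|->//].
  by apply: lam_inj; rewrite j'i (eqP ji).
by rewrite big_pred0.
Qed.

Lemma leq_sum_partner (g : nat -> nat) :
  (\sum_(j < s) g (lam j) <= \sum_(i < r) g i.+1)%N.
Proof.
rewrite -(big_partner _ (fun j => g (lam j))) leq_sum// => i _.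
by case: pickP => // j /eqP ->.
Qed.

End big_partner.

(** * The density attached to the parameters *)

Section mellin_density.
Context {R : realType} {r s : nat} (lam : 'I_s -> nat).
Local Notation mu := (@lebesgue_measure R).
Implicit Types (A : 'I_r -> R) (B : 'I_s -> R) (x t c e : R).
Hypothesis lam_range : forall j, (1 <= lam j <= r)%N.
Hypothesis lam_inj : injective lam.

Definition mellin_factor A B (i : 'I_r) : R -> R :=
  if [pick j | lam j == i.+1] is Some j
  then fun x => (real_gamma (B j - A i))^-1 * beta_density (A i) (B j - A i) x
  else gamma_density (A i).

Definition mellin_density A B := convolutions (mellin_factor A B) (enum 'I_r).

(** Only paired parameters are compared: [ashift] and [bshift] raise [a_i] and [b_j] together when
    they are paired, so the condition passes to all [r] measures. *)
Definition admissible A B := (forall i, 0 < A i) /\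
  forall (i : 'I_r) j, lam j = i.+1 -> A i < B j.

Lemma regular_densityZ (k : R) f : 0 <= k -> regular_density f -> regular_density (fun x => k * f x).
Proof.
move=> k0 [f0 f1 fr]; split; [by move=> x; exact: mulr_ge0|exact: L1Z|].
have bk (S : set R) : bounded_lipschitz S (fun=> k).
  exists `|k|; split=> [//|x y _ _].
  by rewrite subrr normr0 mulr_ge0.
case: fr => [fT|[fl fr]]; [left|right; split].
- exact: bounded_lipschitzM.
- by move=> x x0; rewrite fl// mulr0.
- by move=> e e0; apply: bounded_lipschitzM => //; exact: fr.
Qed.

Lemma regular_density_mellin_factor A B i : admissible A B -> regular_density (mellin_factor A B i).
Proof.
move=> [A0 AB]; rewrite /mellin_factor; case: pickP => [j /eqP ji|_].
  have d0 : 0 < B j - A i by rewrite subr_gt0 AB.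
  apply: regular_densityZ; first by rewrite invr_ge0 ltW ?real_gamma_gt0.
  exact: regular_density_beta_density.
exact: regular_density_gamma_density.
Qed.

Hypothesis r_gt0 : (0 < r)%N.

Lemma enum_ord_neq_nil : enum 'I_r <> [::].
Proof. by move/(congr1 size); rewrite size_enum_ord; case: r r_gt0. Qed.

Lemma regular_density_mellin_density A B : admissible A B -> regular_density (mellin_density A B).
Proof.
move=> AB; apply: regular_density_convolutions; last exact: enum_ord_neq_nil.
by move=> i; exact: regular_density_mellin_factor.
Qed.

Lemma fourier_mellin_density A B t : admissible A B ->
  fourier (mellin_density A B) t =
  (\prod_(i < r) Gamma (Complex (A i) t)) / (\prod_(j < s) Gamma (Complex (B j) t)).
Proof.
move=> AB; rewrite fourier_convolutions; last 2 first.
- by move=> i; exact: regular_density_mellin_factor.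
- exact: enum_ord_neq_nil.
rewrite -prodfV -(big_partner lam_range lam_inj _ (fun j => (Gamma (Complex (B j) t))^-1)).
rewrite -big_split big_enum; apply: eq_bigr => i _ /=; rewrite /mellin_factor.
have [A0 AB'] := AB; case: pickP => [j /eqP ji|_].
  by rewrite Gamma_ratio// AB'.
by rewrite mulr1 Gamma_fourier.
Qed.

Lemma Rintegral_mellin_density A B : admissible A B ->
  \int[mu]_x mellin_density A B x =
  (\prod_(i < r) real_gamma (A i)) / (\prod_(j < s) real_gamma (B j)).
Proof.
move=> AB; rewrite Rintegral_convolutions; last 2 first.
- by move=> i; exact: regular_density_mellin_factor.
- exact: enum_ord_neq_nil.
rewrite -prodfV -(big_partner lam_range lam_inj _ (fun j => (real_gamma (B j))^-1)).
rewrite -big_split big_enum; apply: eq_bigr => i _ /=; rewrite /mellin_factor.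
have [A0 AB'] := AB; case: pickP => [j /eqP ji|_]; last by rewrite mulr1.
have d0 : 0 < B j - A i by rewrite subr_gt0 AB'.
have B0 : 0 < B j by apply: lt_trans (A0 i) _; exact: AB'.
rewrite RintegralZ; last exact: L1_beta_density.
have := Rintegral_gamma_beta (A0 i) d0; rewrite [A i + _]addrC subrK => H.
have G1 : real_gamma (B j - A i) != 0 by rewrite gt_eqF// real_gamma_gt0.
have G2 : real_gamma (B j) != 0 by rewrite gt_eqF// real_gamma_gt0.
apply: (mulfI G1); apply: (mulfI G2).
rewrite mulVKf// H; move: G2; move: (real_gamma (B j)) => g G2.
move: (real_gamma _) (real_gamma _) => u v.
by field.
Qed.

(** The differences [B j - A i] are unchanged, so each factor merely acquires the weight
    [exp (- c x)]. Real [c] covers the contours, natural [c] the moments. *)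
Lemma mellin_densityD A B c : admissible A B ->
  mellin_density (fun i => A i + c) (fun j => B j + c) =
  (fun x => expR (- (c * x)) * mellin_density A B x).
Proof.
move=> AB; rewrite /mellin_density -convolutions_expM; last first.
  by move=> i; exact: regular_density_mellin_factor.
congr convolutions; apply/funext => i; apply/funext => x.
rewrite /mellin_factor; case: pickP => [j _|_]; last exact: gamma_densityD.
by rewrite beta_densityD opprD addrACA subrr addr0 mulrCA.
Qed.

(** When [s = r] the pairing is a bijection, so every factor is a beta density and vanishes on the
    negative half-line; in the variable [exp (- x)] this confines the measures to (0, 1). *)
Lemma mellin_density0 A B x : s = r -> x <= 0 -> mellin_density A B x = 0.
Proof.
move=> sr; apply: convolutions0 => i y y0; rewrite /mellin_factor.
case: pickP => [j _|none].
  by rewrite /beta_density ifF ?mulr0//; apply/negbTE; rewrite -leNgt.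
exfalso.
have lamP j : ((lam j).-1 < r)%N.
  by have /andP[] := lam_range j; case: (lam j).
have finj : injective (fun j => Ordinal (lamP j)).
  move=> j1 j2 /(congr1 val) /=; have /andP[+ _] := lam_range j1.
  have /andP[+ _] := lam_range j2 => l1 l2 /(congr1 S).
  by rewrite !prednK// => /lam_inj.
have /codomP[j ij] : i \in codom (fun j => Ordinal (lamP j)).
  by apply: (inj_card_onto finj); rewrite !card_ord sr.
have := none j; rewrite ij /= prednK ?eqxx//.
by have /andP[] := lam_range j.
Qed.

(** When [s < r] some position has no partner; its factor is a Gamma density, and one globally
    Lipschitz factor is enough. This covers the point 0, that is, the argument 1 of the
    G-function. *)
Lemma mellin_density_lipschitz A B : (s < r)%N -> admissible A B ->
  bounded_lipschitz setT (mellin_density A B).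
Proof.
move=> sr AB.
have [i none] : exists i : 'I_r, forall j, lam j != i.+1.
  apply: contrapT => /forallNP H.
  have ex (i : 'I_r) : exists j, lam j == i.+1.
    by have /existsNP[j /negP] := H i; rewrite negbK; exists j.
  have finj : injective (fun i => xchoose (ex i)).
    move=> i1 i2 /(congr1 lam); rewrite (eqP (xchooseP (ex i1))).
    by rewrite (eqP (xchooseP (ex i2))) => -[] /val_inj.
  by have := leq_card _ finj; rewrite !card_ord leqNgt sr.
apply: (@convolutions_lipschitz _ _ _ _ i).
- by move=> i'; exact: regular_density_mellin_factor.
- by rewrite mem_enum.
- rewrite /mellin_factor; case: pickP => [j|_]; first by rewrite (negbTE (none j)).
  by have [A0 _] := AB; exact: gamma_density_lipschitz.
Qed.

End mellin_density.

(** * Values of the G-function and moments of the measures *)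

Section meijerG_moments.
Context {R : realType} {r s : nat} (lam : 'I_s -> nat).
Local Notation mu := (@lebesgue_measure R).
Implicit Types (A : 'I_r -> R) (B : 'I_s -> R) (x t c e : R).
Local Open Scope complex_scope.
Hypothesis lam_range : forall j, (1 <= lam j <= r)%N.
Hypothesis lam_inj : injective lam.
Hypothesis r_gt0 : (0 < r)%N.
Hypothesis s_le_r : (s <= r)%N.

Lemma support_set_gt0 x : support_set s r x -> 0 < x.
Proof. by rewrite /support_set; case: ifP => _ /=; rewrite in_itv/= => /andP[]. Qed.

Lemma support_set_ln x : support_set s r x -> (s < r)%N \/ (s = r /\ 0 < - ln x).
Proof.
rewrite /support_set; case: ifPn => sr /=; first by left.
rewrite in_itv/= => /andP[x0 x1]; right.
by split; [apply/eqP; rewrite eqn_leq s_le_r leqNgt|rewrite oppr_gt0 ln_lt0// x0 x1].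
Qed.

(** The contour [Re u = c] acts as a shift of all parameters by [e + c]; with [y = - ln x], the
    resulting weight [exp (- (e + c) y)] and the factor [exp (c y)] of the contour integral combine
    to [exp (- e y)], free of [c]. The values [e = 0] and [e = - 1] are the two forms of the
    density. *)
Lemma meijerG_mellin A B c e x : admissible lam A B -> support_set s r x ->
  (forall i, 0 < A i + e + c) ->
  meijerG c (fun j => (B j + e)%:C) (fun i => (A i + e)%:C) x =
  (expR (- (e * - ln x)) * mellin_density lam A B (- ln x))%:C.
Proof.
move=> AB xS Ac; have x0 := support_set_gt0 xS.
set y := - ln x.
have xE : x = expR (- y) by rewrite /y opprK lnK.
pose A' i := A i + (e + c); pose B' j := B j + (e + c).
have AB' : admissible lam A' B'.
  split=> [i|i j ji]; first by rewrite /A' addrA.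
  by rewrite /A' /B' ltrD2r AB.2.
have nD := regular_density_mellin_density r_gt0 AB'.
have [_ D1 Dr] := nD.
rewrite xE (@meijerG_inversion _ _ _ _ _ _ (mellin_density lam A' B'))//.
- rewrite mellin_densityD// mulrA -expRD; congr ((expR _ * _)%:C).
  by ring.
- apply: regular_local_lipschitz => //.
  have [sr|[sr y0]] := support_set_ln xS.
    by right; exact: mellin_density_lipschitz.
  by left; rewrite gt_eqF.
- by move=> z z0; apply: local_lipschitz_continuous; apply: regular_local_lipschitz => //; left.
- move=> t; rewrite fourier_mellin_density//; congr (_ / _); apply: eq_bigr => i _; congr Gamma;
    apply/eqP; rewrite eq_complex /= /A' /B' ?add0r ?eqxx ?andbT; apply/eqP; ring.
Qed.

Lemma meijerG_mellin0 A B c x : admissible lam A B -> support_set s r x ->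
  (forall i, 0 < A i + c) ->
  meijerG c (fun j => (B j)%:C) (fun i => (A i)%:C) x =
  (mellin_density lam A B (- ln x))%:C.
Proof.
move=> AB xS Ac.
have -> : (fun j => (B j)%:C) = (fun j => (B j + 0)%:C).
  by apply/funext => j; rewrite addr0.
have -> : (fun i => (A i)%:C) = (fun i => (A i + 0)%:C).
  by apply/funext => i; rewrite addr0.
rewrite (meijerG_mellin AB xS); last by move=> i; rewrite addr0.
by congr (_%:C); rewrite mul0r oppr0 expR0 mul1r.
Qed.

(** With [x = exp (- xi)], [x^n dx / x] becomes [exp (- n xi) d xi], so the moment is the total mass
    of the density with all parameters raised by [n], a product over its factors. *)
Lemma moment_mellin A B (nu : {measure set (measurableTypeR R) -> \bar R}) (w : R -> R)
    (n : nat) : admissible lam A B -> has_density nu (support_set s r) w ->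
  (forall x, support_set s r x -> w x = mellin_density lam A B (- ln x) / x) ->
  nu.-integrable setT (fun x => (x ^+ n)%:E) /\
  \int[nu]_x (x ^+ n) =
  (\prod_(i < r) real_gamma (A i + n%:R)) / (\prod_(j < s) real_gamma (B j + n%:R)).
Proof.
move=> AB [mw nuE] wE.
have nM := regular_density_mellin_density r_gt0 AB; have [M0 M1 _] := nM.
have ABn : admissible lam (fun i => A i + n%:R) (fun j => B j + n%:R).
  split=> [i|i j ji]; first by rewrite ltr_wpDr ?AB.1.
  by rewrite ltrD2r AB.2.
have nMn := regular_density_mellin_density r_gt0 ABn; have [_ Mn1 _] := nMn.
have mS : measurable (support_set s r : set (measurableTypeR R)).
  by rewrite /support_set; case: ifP => _; exact: measurable_itv.
have w0 x : support_set s r x -> 0 <= w x.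
  by move=> xS; rewrite wE// divr_ge0 ?M0// ltW// support_set_gt0.
pose g x := x ^+ n * (mellin_density lam A B (- ln x) / x).
have mpow : measurable_fun [set: measurableTypeR R] (fun x : measurableTypeR R => x ^+ n).
  exact: exprn_measurable.
have mg : measurable_fun [set: R] g.
  apply: measurable_funM; first exact: mpow.
  apply: measurable_funM; last exact: measurable_invr.
  apply: (measurableT_comp (regular_density_measurable nM)).
  by apply: measurableT_comp => //; exact: measurable_ln.
(* For [s = r] the integral over (0, 1) may be extended to the half-line because the density
   vanishes where [ln x >= 0]. *)
have restrE : (fun x : R => x ^+ n * w x) \_ (support_set s r) = g \_ (`]0%R, +oo[%classic).
  apply/funext => x; rewrite !patchE.
  case: ifPn => [/set_mem xS|xS].
    by rewrite mem_set ?/g ?wE//= in_itv/= andbT support_set_gt0.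
  case: ifPn => // /set_mem; rewrite /= in_itv/= andbT => x0.
  move/negP: xS; rewrite inE /support_set; case: ifPn => sr /=; rewrite in_itv/= x0//= => /negP x1.
  rewrite /g (mellin_density0 lam_range lam_inj) ?mul0r ?mulr0//.
    by apply/eqP; rewrite eqn_leq s_le_r leqNgt.
  by rewrite oppr_le0 ln_ge0// leNgt.
have gE x : g (expR (- x)) * expR (- x) =
    mellin_density lam (fun i => A i + n%:R) (fun j => B j + n%:R) x.
  rewrite mellin_densityD// /g expRK opprK -expRM_natl.
  by rewrite mulrA divfK ?gt_eqF ?expR_gt0// mulrN.
have mgS : measurable_fun (`]0%R, +oo[%classic : set R) g by exact: measurable_funTS.
split.
  apply/(integrable_density mS mw w0 nuE mpow).
  apply/(integrable_mkcond _ mS); rewrite restrict_EFin /= [X in EFin \o X]restrE -restrict_EFin.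
  apply/(integrable_mkcond _ _).1; first exact: measurable_itv.
  apply/(integrable_expN mgS).2.
  by move: Mn1; apply: eq_integrable => // x _; rewrite gE.
rewrite (Rintegral_density mS mw w0 nuE mpow) Rintegral_mkcond restrE -Rintegral_mkcond.
rewrite Rintegral_expN//.
rewrite -(Rintegral_mellin_density lam_range lam_inj r_gt0 ABn).
by apply: eq_Rintegral => x _; rewrite gE.
Qed.

End meijerG_moments.

(** * Pochhammer symbols and alternating binomial sums *)

Section pochhammer_theory.
Context {R : realType}.
Implicit Types (x z b : R) (p q : {poly R}) (m n k : nat).

Lemma pochhammer0 z : pochhammer z 0 = 1.
Proof. by rewrite /pochhammer big_ord0. Qed.

Lemma pochhammerS z n : pochhammer z n.+1 = pochhammer z n * (z + n%:R).
Proof. by rewrite /pochhammer big_ord_recr. Qed.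

Lemma pochhammerD z m n :
  pochhammer z (m + n) = pochhammer z m * pochhammer (z + m%:R) n.
Proof.
elim: n => [|n IH]; first by rewrite addn0 pochhammer0 mulr1.
by rewrite addnS !pochhammerS IH natrD addrA mulrA.
Qed.

Lemma pochhammerSl z n : pochhammer z n.+1 = z * pochhammer (z + 1) n.
Proof. by rewrite -add1n pochhammerD pochhammerS pochhammer0 mul1r addr0. Qed.

Lemma pochhammer_gt0 z n : 0 < z -> 0 < pochhammer z n.
Proof. by move=> z0; apply: prodr_gt0 => i _; exact: ltr_wpDr. Qed.

Lemma pochhammer_neg n m : pochhammer (- n%:R) m = (-1) ^+ m * (n ^_ m)%:R :> R.
Proof.
elim: m => [|m IH]; first by rewrite pochhammer0 ffactn0 expr0 mul1r.
rewrite pochhammerS IH ffactnSr natrM exprSr.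
have [mn|nm] := leqP m n; first by rewrite natrB//; ring.
by rewrite ffact_small// !(mulr0, mul0r).
Qed.

Lemma pochhammer_neg_fact n m :
  pochhammer (- n%:R) m / m`!%:R = (-1) ^+ m * 'C(n, m)%:R :> R.
Proof.
by rewrite pochhammer_neg -bin_ffact natrM mulrA mulfK// pnatr_eq0 -lt0n fact_gt0.
Qed.

(** Up to the sign [(-1)^n], the [n]-th forward difference of [f] at 0. *)
Definition alternating_sum n (f : nat -> R) : R :=
  \sum_(m < n.+1) (-1) ^+ m * 'C(n, m)%:R * f m.

Lemma eq_alternating_sum n f g : (forall m, f m = g m) ->
  alternating_sum n f = alternating_sum n g.
Proof. by move=> fg; apply: eq_bigr => m _; rewrite fg. Qed.

Lemma alternating_sumD n f g :
  alternating_sum n (fun m => f m + g m) = alternating_sum n f + alternating_sum n g.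
Proof. by rewrite /alternating_sum -big_split; apply: eq_bigr => m _; rewrite mulrDr. Qed.

Lemma alternating_sumZ n c f :
  alternating_sum n (fun m => c * f m) = c * alternating_sum n f.
Proof. by rewrite /alternating_sum mulr_sumr; apply: eq_bigr => m _; rewrite mulrCA. Qed.

Lemma alternating_sumS n f :
  alternating_sum n.+1 f = alternating_sum n f - alternating_sum n (fun m => f m.+1).
Proof.
rewrite /alternating_sum big_ord_recl [in RHS]big_ord_recl /= expr0 !bin0 -addrA.
congr (_ + _); rewrite big_ord_recr [in X in _ - X]big_ord_recr /=.
rewrite opprD addrA; congr (_ + _); last first.
  by rewrite /bump /= !add1n !binn exprS; ring.
rewrite -sumrB; apply: eq_bigr => i _; rewrite /bump /= !add1n binS natrD exprS.
by ring.
Qed.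

Lemma alternating_sum_mul n f :
  alternating_sum n.+1 (fun m => m%:R * f m) =
  - n.+1%:R * alternating_sum n (fun m => f m.+1).
Proof.
rewrite /alternating_sum big_ord_recl /= mul0r mulr0 add0r mulr_sumr.
apply: eq_bigr => i _; rewrite /bump /= !add1n.
have : (n.+1%:R * 'C(n, i)%:R = i.+1%:R * 'C(n.+1, i.+1)%:R :> R).
  by rewrite -!natrM mul_bin_diag.
move=> H; transitivity (- (-1) ^+ i * (i.+1%:R * 'C(n.+1, i.+1)%:R) * f i.+1).
  by rewrite exprS; ring.
by rewrite -H; ring.
Qed.

(** Write [p = q X + c]: the constant is annihilated, and the factor [m] turns the sum of order
    [n + 1] into one of order [n] for [q (X + 1)], which has the same coefficient of degree [n] as
    [q]. *)
Lemma alternating_sum_poly n p : (size p <= n.+1)%N ->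
  alternating_sum n (fun m => p.[m%:R]) = (-1) ^+ n * n`!%:R * p`_n.
Proof.
elim: n p => [|n IH] p sp.
  rewrite /alternating_sum big_ord_recl big_ord0 /=.
  have -> : p.[0%:R] = p`_0 by rewrite {1}(size1_polyC sp) hornerC.
  by rewrite addr0 expr0 bin0 fact0 !mul1r.
have [q [c pE]] : exists q c, p = q * 'X + c%:P.
  elim/poly_ind: p {sp} => [|q c _]; last by exists q, c.
  by exists 0, 0; rewrite mul0r add0r.
have sq : (size q <= n.+1)%N.
  have [->|q0] := eqVneq q 0; first by rewrite size_poly0.
  by move: sp; rewrite pE size_MXaddC (negbTE q0).
have -> : p`_n.+1 = q`_n by rewrite pE coefD coefMX coefC addr0.
have XS : size ('X + 1%:P : {poly R}) = 2 by rewrite size_XaddC.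
have qS : (q \Po ('X + 1%:P))`_n = q`_n.
  have [sqn|nsq] := leqP (size q) n.
    by rewrite !nth_default ?size_comp_poly2.
  have sqE : size q = n.+1 by apply/eqP; rewrite eqn_leq sq.
  have := lead_coef_comp q (q := 'X + 1%:P); rewrite XS => /(_ isT).
  by rewrite lead_coefXaddC expr1n mulr1 /lead_coef size_comp_poly2// sqE.
rewrite (@eq_alternating_sum _ _ (fun m => m%:R * q.[m%:R] + c * 1)); last first.
  by move=> m; rewrite pE !hornerE; ring.
have cst0 : alternating_sum n.+1 (fun=> 1) = 0 by rewrite alternating_sumS subrr.
rewrite alternating_sumD alternating_sumZ cst0 mulr0 addr0.
rewrite alternating_sum_mul.
rewrite (@eq_alternating_sum _ _ (fun m => (q \Po ('X + 1%:P)).[m%:R])); last first.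
  by move=> m; rewrite horner_comp !hornerE -natr1.
rewrite IH ?size_comp_poly2// qS factS natrM exprS; ring.
Qed.

(** Read from right to left, this is the partial fraction expansion in [b]. *)
Lemma alternating_sum_inv n b : 0 < b ->
  alternating_sum n (fun m => (b + m%:R)^-1) = n`!%:R / pochhammer b n.+1.
Proof.
elim: n b => [|n IH] b b0.
  rewrite /alternating_sum big_ord_recl big_ord0 /= pochhammerS pochhammer0.
  by rewrite expr0 bin0 fact0 mul1r addr0 !mul1r.
have b1 : 0 < b + 1 by exact: ltr_wpDr.
rewrite alternating_sumS IH//.
rewrite (@eq_alternating_sum _ _ (fun m => (b + 1 + m%:R)^-1)); last first.
  by move=> m; rewrite -addrA nat1r.
rewrite IH// (pochhammerSl b n) [pochhammer b n.+2]pochhammerSl.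
rewrite !(pochhammerS (b + 1)) factS natrM.
have P0 : pochhammer (b + 1) n != 0 by rewrite gt_eqF// pochhammer_gt0.
have n0 : 0 <= n%:R :> R by exact: ler0n.
rewrite -natr1; field.
by rewrite P0 !gt_eqF//; lra.
Qed.

Definition monic_size p n := p \is monic /\ size p = n.+1.

Lemma monic_size_prod (I : finType) (F : I -> {poly R}) (d : I -> nat) :
  (forall i, monic_size (F i) (d i)) ->
  monic_size (\prod_i F i) (\sum_i d i).
Proof.
move=> Fd; apply: (big_ind2 (fun p n => monic_size p n)) => //.
- by split; [exact: monic1|rewrite size_poly1].
- move=> p m q n [pm ps] [qm qs]; split; first by rewrite monicMl.
  by rewrite size_Mmonic ?monic_neq0// ps qs addnS.
Qed.

Definition pochhammer_poly z n : {poly R} :=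
  \prod_(i < n) ('X - (- (z + i%:R))%:P).

Lemma monic_size_pochhammer_poly z n : monic_size (pochhammer_poly z n) n.
Proof.
have := @monic_size_prod 'I_n (fun i => 'X - (- (z + i%:R))%:P) (fun=> 1%N).
rewrite sum_nat_const card_ord muln1; apply => i.
by split; [exact: monicXsubC|rewrite size_XsubC].
Qed.

Lemma horner_pochhammer_poly z n x : (pochhammer_poly z n).[x] = pochhammer (z + x) n.
Proof.
rewrite horner_prod; apply: eq_bigr => i _; rewrite hornerXsubC; ring.
Qed.

Lemma alternating_sum_monic n p : monic_size p n ->
  alternating_sum n (fun m => p.[m%:R]) != 0.
Proof.
move=> [pm ps]; rewrite alternating_sum_poly ?ps//.
have -> : p`_n = 1 by move/monicP: pm; rewrite /lead_coef ps.
rewrite mulr1 mulf_neq0 ?signr_eq0// pnatr_eq0 -lt0n fact_gt0//.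
Qed.

Lemma alternating_sum_small n d p : (d < n)%N -> monic_size p d ->
  alternating_sum n (fun m => p.[m%:R]) = 0.
Proof.
move=> dn [_ ps]; rewrite alternating_sum_poly ?ps ?(leq_trans dn)//.
by rewrite nth_default ?mulr0// ps.
Qed.

(** Division with remainder by [X + b]: the quotient has degree below [n] and contributes nothing,
    and the remainder is the constant [p.[- b]]. The sum is thus nonzero exactly when [p] does not
    vanish at the pole. *)
Lemma alternating_sum_frac n p b : 0 < b -> (size p <= n.+1)%N ->
  alternating_sum n (fun m => p.[m%:R] / (b + m%:R)) =
  p.[- b] * (n`!%:R / pochhammer b n.+1).
Proof.
move=> b0 sp.
have /factor_theorem[q qE] : root (p - p.[- b]%:P) (- b).
  by rewrite /root !hornerE subrr.
have pE : p = q * ('X - (- b)%:P) + p.[- b]%:P by rewrite -qE subrK.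
have sq : (size q <= n)%N.
  have [->|q0] := eqVneq q 0; first by rewrite size_poly0.
  have sz : (size (p - p.[- b]%:P)%R <= n.+1)%N.
    apply: leq_trans (size_polyD _ _) _; rewrite size_polyN geq_max sp/=.
    by rewrite (leq_trans (size_polyC_leq1 _)).
  by move: sz; rewrite qE size_Mmonic ?monicXsubC// size_XsubC addn2.
rewrite -alternating_sum_inv// -alternating_sumZ.
rewrite (@eq_alternating_sum _ _ (fun m => q.[m%:R] + p.[- b] * (b + m%:R)^-1)).
  rewrite alternating_sumD alternating_sum_poly ?(leq_trans sq)//.
  by rewrite nth_default// mulr0 add0r.
move=> m; have bm : b + m%:R != 0 by rewrite gt_eqF// ltr_wpDr.
have -> : p.[m%:R] = q.[m%:R] * (b + m%:R) + p.[- b].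
  by rewrite {1}pE !hornerE opprK [m%:R + b]addrC.
by rewrite mulrDl mulfK.
Qed.

End pochhammer_theory.

(** * Cyclic raising of the parameters *)

Section steps.
Variable r : nat.
Hypothesis r_gt0 : (0 < r)%N.

(* How often the parameter in position [t] of [1, ..., r] has been raised by 1
   after [N] steps when the positions are raised cyclically. *)
Definition steps (N t : nat) : nat := ((N + r - t) %/ r)%N.

Lemma stepsE k j t : (j < r)%N -> (1 <= t <= r)%N ->
  steps (r * k + j) t = (k + (t <= j))%N.
Proof.
move=> jr /andP[t1 tr]; rewrite /steps.
have -> : (r * k + j + r - t = k * r + (j + r - t))%N by nia.
rewrite divnMDl//; congr (_ + _)%N; case: leqP => tj /=.
  have -> : (j + r - t = 1 * r + (j - t))%N by lia.
  by rewrite divnMDl// divn_small ?addn0//; lia.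
by rewrite divn_small//; lia.
Qed.

Lemma leq_steps N M t : (N <= M)%N -> (steps N t <= steps M t)%N.
Proof. by move=> NM; rewrite /steps leq_div2r// leq_sub2r// leq_add2r. Qed.

(** Every step raises exactly one position; this is the count behind all the degrees below. *)
Lemma sum_steps N : (\sum_(i < r) steps N i.+1 = N)%N.
Proof.
have jr : (N %% r < r)%N by rewrite ltn_mod.
rewrite {2}(divn_eq N r) mulnC.
transitivity (\sum_(i < r) (N %/ r + (i < N %% r)))%N.
  apply: eq_bigr => i _; rewrite {1}(divn_eq N r) mulnC stepsE//.
  by rewrite ltn_ord.
rewrite big_split/= sum_nat_const card_ord; congr (_ + _)%N.
rewrite -(big_mkord xpredT (fun i => nat_of_bool (i < N %% r)%N)).
rewrite (big_cat_nat (n := (N %% r)%N))//=; last exact: ltnW.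
rewrite (eq_big_nat _ _ (F2 := fun=> 1%N)); last by move=> i /andP[_ ->].
rewrite sum_nat_const_nat subn0 muln1 big1_seq ?addn0// => i /andP[_].
by rewrite mem_index_iota => /andP[h _]; rewrite ltnNge h.
Qed.

Lemma stepsS N t : (1 <= t <= r)%N ->
  steps N.+1 t = (steps N t + (t == (N %% r).+1))%N.
Proof.
move=> tr; have jr : (N %% r < r)%N by rewrite ltn_mod.
rewrite [in steps N _](divn_eq N r) mulnC stepsE//.
have NE : N.+1 = (r * (N %/ r) + (N %% r).+1)%N by rewrite addnS mulnC -divn_eq.
have [jr'|jr'] := ltnP (N %% r).+1 r.
  by rewrite {1}NE stepsE//; lia.
have {}NE : N.+1 = (r * (N %/ r).+1 + 0)%N by rewrite {1}NE mulnS; lia.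
by rewrite {1}NE stepsE//; lia.
Qed.

End steps.

(** * Orthogonality as finite sums, for any positive [G] with the functional equation of Gamma *)

Section orthogonality.
Context {R : realType} {r s : nat} (lam : 'I_s -> nat).
Variables (a : 'I_r -> R) (b : 'I_s -> R) (G : R -> R).
Hypothesis lam_range : forall j, (1 <= lam j <= r)%N.
Hypothesis lam_inj : injective lam.
Hypothesis r_gt0 : (0 < r)%N.
Hypothesis a_gt0 : forall i, 0 < a i.
Hypothesis b_gt0 : forall j, 0 < b j.
Hypothesis ab_le : forall (i : 'I_r) j, (i.+1 <= lam j)%N -> a i < b j.
Hypothesis ab_gt : forall (i : 'I_r) j, (lam j + 1 <= i.+1)%N -> a i - 1 < b j.
Hypothesis G_gt0 : forall x, 0 < x -> 0 < G x.
Hypothesis GS : forall x, 0 < x -> G (x + 1) = x * G x.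
Local Notation steps := (steps r).

Lemma gamma_pochhammer x n : 0 < x -> G (x + n%:R) = pochhammer x n * G x.
Proof.
move=> x0; elim: n => [|n IH]; first by rewrite addr0 pochhammer0 mul1r.
by rewrite -natr1 addrA GS ?ltr_wpDr// IH pochhammerS; ring.
Qed.

(* The moment of order [k + m] of the [j]-th measure, for [N = r k + j]. *)
Definition step_moment (N m : nat) : R :=
  (\prod_i G (a i + (steps N i.+1)%:R + m%:R)) /
  (\prod_j G (b j + (steps N (lam j))%:R + m%:R)).

(** The parameter [b_j^(n-1)], its ceiling read as a number of steps. At [n = 0] the predecessor is
    0, which keeps the parameter positive. *)
Definition op_beta (n : nat) (j : 'I_s) : R := b j + (steps n.-1 (lam j))%:R.

Definition op_coef (n m : nat) : R :=
  (-1) ^+ n * (\prod_i pochhammer (a i) n) / (\prod_j pochhammer (op_beta n j) n) *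
  (pochhammer (- n%:R) m * (\prod_j pochhammer (op_beta n j) m) /
   (\prod_i pochhammer (a i) m) / m`!%:R).

Lemma op_beta_gt0 n j : 0 < op_beta n j.
Proof. by rewrite ltr_wpDr. Qed.

Lemma op_coef_monic n : op_coef n n = 1.
Proof.
have p1 : \prod_i pochhammer (a i) n != 0.
  by rewrite gt_eqF// prodr_gt0// => i _; exact: pochhammer_gt0.
have p2 : \prod_j pochhammer (op_beta n j) n != 0.
  by rewrite gt_eqF// prodr_gt0// => j _; apply: pochhammer_gt0; exact: op_beta_gt0.
have H : pochhammer (- n%:R) n / n`!%:R = (-1) ^+ n :> R.
  by rewrite pochhammer_neg_fact binn; ring.
rewrite /op_coef [_ * _ / _ / _]mulrAC.
have -> : pochhammer (- n%:R) n * (\prod_j pochhammer (op_beta n j) n) / n`!%:R /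
    \prod_i pochhammer (a i) n =
  (pochhammer (- n%:R) n / n`!%:R) * ((\prod_j pochhammer (op_beta n j) n) /
    \prod_i pochhammer (a i) n) by ring.
rewrite H; move: p1 p2; move: (\prod_i _) (\prod_j _) => u v u0 v0.
rewrite -[RHS](sqrr_sign R n) expr2.
by field; rewrite u0 v0.
Qed.

(** The contribution of [b_j] to the term of index [m]; the numerator is [G (op_beta n j + m)]. It
    is a Pochhammer polynomial in [m] if [N < n]; for [N = n > 0] it is 1, or
    [1 / (op_beta n j + m)] for the parameter raised at the [n]-th step. *)
Let ratio n N m j : R := pochhammer (op_beta n j) m * G (op_beta n j) /
  G (b j + (steps N (lam j))%:R + m%:R).

Lemma ratio_poly n N m j : (N <= n)%N ->
  ratio n.+1 N m j = pochhammer (b j + (steps N (lam j))%:R + m%:R)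
    (steps n (lam j) - steps N (lam j)).
Proof.
move=> Nn; have st := leq_steps r (lam j) Nn.
have c0 : 0 < b j + (steps N (lam j))%:R by rewrite ltr_wpDr.
have B0 := op_beta_gt0 n.+1 j.
rewrite /ratio -gamma_pochhammer// /op_beta /=.
set M := steps N (lam j); set e := (steps n (lam j) - M)%N.
have -> : b j + (steps n (lam j))%:R + m%:R = b j + M%:R + m%:R + e%:R.
  by rewrite /e natrB//; ring.
rewrite gamma_pochhammer ?mulfK//; first by rewrite gt_eqF// G_gt0// ltr_wpDr.
by rewrite ltr_wpDr.
Qed.

Lemma ratio_inv n m j : lam j = (n %% r).+1 ->
  ratio n.+1 n.+1 m j = (op_beta n.+1 j + m%:R)^-1.
Proof.
move=> lj; have B0 := op_beta_gt0 n.+1 j.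
rewrite /ratio -gamma_pochhammer//.
have -> : b j + (steps n.+1 (lam j))%:R + m%:R = op_beta n.+1 j + m%:R + 1.
  by rewrite stepsS// lj eqxx natrD /op_beta /= lj; ring.
have Bm : 0 < op_beta n.+1 j + m%:R by rewrite ltr_wpDr.
by rewrite GS// invfM mulrCA mulfV ?mulr1// gt_eqF// G_gt0.
Qed.

Lemma ratio1 n m j : lam j <> (n %% r).+1 -> ratio n.+1 n.+1 m j = 1.
Proof.
move=> lj; have B0 := op_beta_gt0 n.+1 j.
rewrite /ratio -gamma_pochhammer//.
have -> : b j + (steps n.+1 (lam j))%:R = op_beta n.+1 j.
  by rewrite stepsS//; move/eqP/negbTE: lj => ->; rewrite addn0.
by rewrite mulfV// gt_eqF// G_gt0// ltr_wpDr.
Qed.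

Let K n : R := (-1) ^+ n * (\prod_i pochhammer (a i) n) /
  (\prod_j pochhammer (op_beta n j) n) * ((\prod_i G (a i)) / (\prod_j G (op_beta n j))).

Let K_neq0 n : K n != 0.
Proof.
have pos (I : finType) (F : I -> R) : (forall i, 0 < F i) -> \prod_i F i != 0.
  by move=> F0; rewrite gt_eqF// prodr_gt0.
rewrite /K !mulf_neq0 ?invr_eq0 ?signr_eq0//; apply: pos => i.
- exact: pochhammer_gt0.
- by apply: pochhammer_gt0; exact: op_beta_gt0.
- exact: G_gt0.
- by apply: G_gt0; exact: op_beta_gt0.
Qed.

Lemma sum_op_coef n N :
  \sum_(m < n.+1) op_coef n m * step_moment N m = K n * alternating_sum n (fun m =>
    (\prod_i pochhammer (a i + m%:R) (steps N i.+1)) * \prod_j ratio n N m j).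
Proof.
rewrite /alternating_sum mulr_sumr; apply: eq_bigr => m _.
rewrite /op_coef /step_moment /K.
have pos (I : finType) (F : I -> R) : (forall i, 0 < F i) -> \prod_i F i != 0.
  by move=> F0; rewrite gt_eqF// prodr_gt0.
have -> : \prod_i G (a i + (steps N i.+1)%:R + m%:R) =
    (\prod_i G (a i)) * (\prod_i pochhammer (a i) m) *
    \prod_i pochhammer (a i + m%:R) (steps N i.+1).
  rewrite -!big_split; apply: eq_bigr => i _ /=.
  rewrite -addrA -natrD gamma_pochhammer// addnC pochhammerD; ring.
rewrite /ratio !big_split /= prodfV.
have -> : (-1) ^+ m * 'C(n, m)%:R = pochhammer (- n%:R) m / m`!%:R :> R.
  by rewrite pochhammer_neg_fact.
have p1 : \prod_i pochhammer (a i) m != 0 by apply: pos => i; exact: pochhammer_gt0.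
have p2 : \prod_j G (op_beta n j) != 0.
  by apply: pos => j; apply: G_gt0; exact: op_beta_gt0.
have p3 : \prod_j pochhammer (op_beta n j) n != 0.
  by apply: pos => j; apply: pochhammer_gt0; exact: op_beta_gt0.
have p4 : \prod_j G (b j + (steps N (lam j))%:R + m%:R) != 0.
  by apply: pos => j; apply: G_gt0; rewrite !ltr_wpDr.
have p5 : m`!%:R != 0 :> R by rewrite pnatr_eq0 -lt0n fact_gt0.
move: p1 p2 p3 p4 p5; move: (\prod_i pochhammer (a i) m) (\prod_j G (op_beta n j)) => u1 u2.
move: (\prod_j pochhammer (op_beta n j) n) (\prod_j G (b j + _ + _)) (m`!%:R) => u3 u4 u5.
move: (\prod_i pochhammer (a i) n) (\prod_i G (a i)) (pochhammer (- n%:R) m) => u6 u7 u8.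
move: (\prod_i _) (\prod_j _) ((-1) ^+ n) => u9 u10 u11 p1 p2 p3 p4 p5.
by field; rewrite p1 p2 p3 p4 p5.
Qed.

(** With [n + 1] in place of [n], the degree in [m] is the sum over [i] of [steps N] plus the sum
    over [j] of [steps n - steps N]. As the [lam j] are distinct positions, the second sum is at
    most its analogue over all [r] positions, so the total is at most [n]. *)
Lemma op_coef_orthogonal n N : (N < n)%N ->
  \sum_(m < n.+1) op_coef n m * step_moment N m = 0.
Proof.
case: n => // n Nn; rewrite sum_op_coef.
pose F := (\prod_i pochhammer_poly (a i) (steps N i.+1)) *
  \prod_j pochhammer_poly (b j + (steps N (lam j))%:R) (steps n (lam j) - steps N (lam j)).
have FM : monic_size F (\sum_(i < r) steps N i.+1 +
    \sum_j (steps n (lam j) - steps N (lam j)))%N.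
  have [m1 s1] := @monic_size_prod R _ (fun i => pochhammer_poly (a i) (steps N i.+1)) _
    (fun i => monic_size_pochhammer_poly _ _).
  have [m2 s2] := @monic_size_prod R _
    (fun j => pochhammer_poly (b j + (steps N (lam j))%:R) (steps n (lam j) - steps N (lam j)))
    _ (fun i => monic_size_pochhammer_poly _ _).
  by split; rewrite ?monicMl// size_Mmonic ?monic_neq0// s1 s2 addnS.
rewrite (@eq_alternating_sum _ _ _ (fun m => F.[m%:R])).
  rewrite (alternating_sum_small _ FM) ?mulr0// ltnS.
  apply: (leq_trans (n := (\sum_(i < r) steps N i.+1 +
    \sum_(i < r) (steps n i.+1 - steps N i.+1))%N)).
    rewrite leq_add2l.
    exact: (@leq_sum_partner _ _ _ lam_range lam_inj (fun t => steps n t - steps N t)%N).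
  rewrite -big_split /= -[leqRHS](sum_steps r_gt0 n).
  by apply: leq_sum => i _; rewrite subnKC// leq_steps.
move=> m; rewrite /F hornerM !horner_prod; congr (_ * _); apply: eq_bigr => i _.
  by rewrite horner_pochhammer_poly.
by rewrite ratio_poly// horner_pochhammer_poly.
Qed.

(* If no [lam j] is congruent to [n] modulo [r], the alternating sum is that of a
   monic polynomial of degree [n]; otherwise this polynomial is divided by
   [op_beta n j + m], and it does not vanish at the pole. *)
Lemma op_coef_neq0 n : \sum_(m < n.+1) op_coef n m * step_moment n m != 0.
Proof.
have mF N : monic_size (\prod_i pochhammer_poly (a i) (steps N i.+1)) N.
  rewrite -[X in monic_size _ X](sum_steps r_gt0 N).
  by apply: monic_size_prod => i; exact: monic_size_pochhammer_poly.
have hF N m : (\prod_i pochhammer_poly (a i) (steps N i.+1)).[m%:R] =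
    \prod_i pochhammer (a i + m%:R) (steps N i.+1).
  by rewrite horner_prod; apply: eq_bigr => i _; rewrite horner_pochhammer_poly.
rewrite sum_op_coef mulf_neq0//.
case: n => [|n].
  rewrite /alternating_sum big_ord_recl big_ord0 addr0 /= expr0 bin0 !mul1r.
  apply: mulf_neq0; apply/prodf_neq0 => j _.
    by rewrite gt_eqF// pochhammer_gt0// ltr_wpDr.
  rewrite /ratio pochhammer0 mul1r mulf_neq0 ?invr_eq0 ?gt_eqF ?G_gt0 ?op_beta_gt0//.
  by rewrite !ltr_wpDr.
have [j lj|none] := pickP (fun j => lam j == (n %% r).+1); last first.
  rewrite (@eq_alternating_sum _ _ _ (fun m =>
      (\prod_i pochhammer_poly (a i) (steps n.+1 i.+1)).[m%:R])).
    exact: alternating_sum_monic.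
  move=> m; rewrite hF [X in _ * X]big1 ?mulr1// => j _; apply: ratio1.
  by apply/eqP; rewrite none.
have {}lj : lam j = (n %% r).+1 by exact/eqP.
rewrite (@eq_alternating_sum _ _ _ (fun m =>
    (\prod_i pochhammer_poly (a i) (steps n.+1 i.+1)).[m%:R] / (op_beta n.+1 j + m%:R))); last first.
  move=> m; rewrite hF (bigD1 j)//= ratio_inv// [X in _ * (_ * X)]big1 ?mulr1// => j' jj'.
  by apply: ratio1 => lj'; case/eqP: jj'; apply: lam_inj; rewrite lj lj'.
have B0 := op_beta_gt0 n.+1 j.
rewrite alternating_sum_frac//; last by have [_ ->] := mF n.+1.
rewrite mulf_neq0//; last first.
  by rewrite mulf_neq0 ?invr_eq0 ?pnatr_eq0 -?lt0n ?fact_gt0// gt_eqF// pochhammer_gt0.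
rewrite horner_prod; apply/prodf_neq0 => i _.
rewrite horner_pochhammer_poly; apply/prodf_neq0 => -[t /= tk] _.
rewrite lt_eqF//.
have nj : (n %% r < r)%N by rewrite ltn_mod.
have sn : steps n (lam j) = (n %/ r)%N.
  rewrite [in steps n _](divn_eq n r) mulnC stepsE// lj leqNgt ltnSn addn0//.
have ir : (0 < i.+1 <= r)%N by rewrite ltn_ord.
have si : steps n.+1 i.+1 = (n %/ r + (i.+1 <= lam j))%N.
  rewrite stepsS// [in steps n _](divn_eq n r) mulnC stepsE// lj.
  by rewrite -addnA; congr (_ + _)%N; rewrite eqSS; lia.
(* Every factor [a i + t - op_beta] is negative, with [op_beta = b j + n %/ r]. If [i.+1 <= lam j],
   then [t] is at most [n %/ r] and [a i < b j] suffices; otherwise [t] is at most [n %/ r - 1] and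
   [a i - 1 < b j] suffices. *)
move: tk; rewrite si /op_beta /= sn.
case: (leqP i.+1 (lam j)) => il; rewrite ?addn1 ?addn0 => tk.
  have := ab_le il; rewrite ltnS -(ler_nat R) in tk; lra.
have := @ab_gt i j; rewrite addn1 => /(_ il).
rewrite -(ler_nat R) -natr1 in tk; lra.
Qed.

End orthogonality.

(** * Uniqueness by triangularity *)

Section uniqueness.
Context {R : realType}.
Implicit Types (p q : {poly R}).

Lemma horner_inj p q : (forall x, p.[x] = q.[x]) -> p = q.
Proof.
move=> pq; apply/eqP; rewrite -subr_eq0; apply/negP => /negP pq0.
pose rs : seq R := [seq i%:R | i <- iota 0 (size (p - q)%R)].
have rts : all (root (p - q)) rs.
  by apply/allP => x _; rewrite /root hornerD hornerN pq subrr.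
have urs : uniq rs.
  by rewrite map_inj_uniq ?iota_uniq// => i j /eqP; rewrite eqr_nat => /eqP.
by have := max_poly_roots pq0 rts urs; rewrite size_map size_iota ltnn.
Qed.

Variable ell : nat -> {poly R} -> R.
Hypothesis ell_linear : forall N c p q, ell N (c *: p + q) = c * ell N p + ell N q.

(** A multiple of [Q n] removes the coefficient of degree [n]; by induction the rest is 0, so [p] is
    a multiple of [Q n], and the functional of index [n] forces the factor to be 0. *)
Lemma triangular_unique (Q : nat -> {poly R}) :
  (forall n, size (Q n) = n.+1) -> (forall n, ell n (Q n) != 0) ->
  (forall N n, (N < n)%N -> ell N (Q n) = 0) ->
  forall n p, (size p <= n)%N -> (forall N, (N < n)%N -> ell N p = 0) -> p = 0.
Proof.
move=> sQ Q0 QN; elim=> [|n IH] p sp pN.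
  by apply/eqP; rewrite -size_poly_eq0 -leqn0.
pose c := p`_n / (Q n)`_n.
have Qn0 : (Q n)`_n != 0.
  by have := lead_coef_eq0 (Q n); rewrite /lead_coef sQ /= -size_poly_eq0 sQ => ->.
have E0 : - c *: Q n + p = 0.
  apply: IH => [|N Nn]; last first.
    by rewrite ell_linear QN// mulr0 add0r pN// ltnW.
  apply/leq_sizeP => i; rewrite leq_eqVlt => /predU1P[<-|ni].
    by rewrite coefD coefZ /c mulNr divfK// addNr.
  by rewrite coefD coefZ !nth_default ?sQ ?mulr0 ?addr0// (leq_trans sp).
have pE : p = c *: Q n.
  by apply/eqP; rewrite -subr_eq0 addrC -scaleNr E0.
have := ell_linear n (- c) (Q n) p; rewrite E0 pN// addr0.
have -> : ell n 0 = 0.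
  by have := ell_linear n (-1) 0 0; rewrite scaler0 addr0 mulN1r addNr.
move/esym/eqP; rewrite mulf_eq0 (negbTE (Q0 n)) orbF oppr_eq0 => /eqP c0.
by rewrite pE c0 scale0r.
Qed.

End uniqueness.

(** * Terminating hypergeometric series and the ceiling in its parameters *)

Section hypergeometric_polynomial.
Context {R : realType}.

Lemma hypergeometric_terminating (r s n : nat) (B : 'I_s -> R) (a : 'I_r -> R) (x : R) :
  hypergeometric (- n%:R :: [seq B j | j : 'I_s]) [seq a i | i : 'I_r] x =
  \sum_(m < n.+1) pochhammer (- n%:R) m * (\prod_j pochhammer (B j) m) /
    (\prod_i pochhammer (a i) m) / m`!%:R * x ^+ m.
Proof.
rewrite /hypergeometric; set u := fun m : nat => _.
have uE m : u m = pochhammer (- n%:R) m * (\prod_j pochhammer (B j) m) /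
    (\prod_i pochhammer (a i) m) / m`!%:R * x ^+ m.
  by rewrite /u big_cons !big_image /=; ring.
apply: lim_near_cst => //; near=> k.
have nk : (n.+1 <= k)%N by near: k; exact: nbhs_infty_ge.
rewrite seriesEnat /= (big_cat_nat (n := n.+1))//= [X in _ + X]big1_seq ?addr0.
  by rewrite big_mkord; apply: eq_bigr => m _; rewrite uE.
move=> m /andP[_]; rewrite mem_index_iota => /andP[nm _].
by rewrite uE pochhammer_neg ffact_small// mulr0 !mul0r.
Unshelve. all: by end_near. Qed.

(** The ceiling of [(n + 1 - lam) / r] is the floor of [(n + r - lam) / r], and the latter numerator
    involves no truncation since [lam <= r]. *)
Lemma bpredE (r s : nat) (lam : 'I_s -> nat) (b : 'I_s -> R) n j : (0 < r)%N ->
  (1 <= lam j <= r)%N -> bpred r lam b n.+1 j = b j + (steps r n (lam j))%:R.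
Proof.
move=> r0 /andP[l1 lr]; rewrite /bpred; congr (_ + _).
have r0' : 0 < r%:R :> R by rewrite ltr0n.
rewrite (@ceil_def _ _ (steps r n (lam j))%:Z)//.
have h1 : (steps r n (lam j) * r <= n + r - lam j)%N by exact: leq_trunc_div.
have h2 : (n + r - lam j < (steps r n (lam j)).+1 * r)%N by rewrite -ltn_divLR.
move: h1 h2; set f := steps r n (lam j) => h1 h2.
rewrite intrD /= ltr_pdivlMr// ler_pdivrMr//.
rewrite -!pmulrn; apply/andP; split.
  have : (f * r + lam j <= n + r)%N by lia.
  by rewrite -(ler_nat R) !natrD natrM -natr1; lra.
have : (n.+1 <= f * r + lam j)%N by lia.
by rewrite -(ler_nat R) natrD natrM; lra.
Qed.

End hypergeometric_polynomial.

(** * Integrals of polynomials from moments *)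

Section polynomial_integral.
Context d (T : measurableType d) (R : realType) (nu : {measure set T -> \bar R}).
Variables (f : T -> R) (m : nat -> R).
Hypothesis fm : forall i, nu.-integrable setT (fun x => (f x ^+ i)%:E) /\
  \int[nu]_x (f x ^+ i) = m i.

Lemma Rintegral_horner (k : nat) (p : {poly R}) :
  nu.-integrable setT (fun x => (f x ^+ k * p.[f x])%:E) /\
  \int[nu]_x (f x ^+ k * p.[f x]) = \sum_(i < size p) p`_i * m (k + i)%N.
Proof.
have H n : nu.-integrable setT (fun x => (\sum_(i < n) p`_i * f x ^+ (k + i)%N)%:E) /\
    \int[nu]_x (\sum_(i < n) p`_i * f x ^+ (k + i)%N) = \sum_(i < n) p`_i * m (k + i)%N.
  elim: n => [|n [IH1 IH2]].
    rewrite big_ord0; split.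
      under eq_fun do rewrite big_ord0.
      exact: integrable0.
    under eq_Rintegral do rewrite big_ord0.
    by rewrite Rintegral_cst// mul0r.
  have [f1 f2] := fm (k + n)%N.
  have g1 := integrableZl measurableT p`_n f1.
  split.
    under eq_fun do rewrite big_ord_recr /= EFinD EFinM.
    exact: integrableD.
  under eq_Rintegral do rewrite big_ord_recr /=.
  by rewrite big_ord_recr /= RintegralD// IH2 RintegralZl// f2.
have E x : f x ^+ k * p.[f x] = \sum_(i < size p) p`_i * f x ^+ (k + i)%N.
  rewrite horner_coef mulr_sumr; apply: eq_bigr => i _.
  by rewrite exprD mulrCA.
have [H1 H2] := H (size p); split.
  by move: H1; apply: eq_integrable => // x _; rewrite E.
by rewrite -H2; apply: eq_Rintegral => x _; rewrite E.
Qed.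

End polynomial_integral.

Unset Implicit Arguments.
Local Open Scope complex_scope.

Theorem theorem8p1 (R : realType) (r s : nat) (hsr : (s <= r)%N)
    (hr : r <> 0%N)
    (lam : 'I_s -> nat)
    (hlam1 : forall j : 'I_s, (1 <= lam j)%N /\ (lam j <= r)%N)
    (hlam2 : forall j1 j2 : 'I_s, (j1 < j2)%N -> (lam j1 < lam j2)%N)
    (a : 'I_r -> R) (b : 'I_s -> R)
    (ha : forall i : 'I_r, 0 < a i) (hb : forall j : 'I_s, 0 < b j)
    (hab1 : forall (i : 'I_r) (j : 'I_s), (i.+1 <= lam j)%N -> b j > a i)
    (hab2 : forall (i : 'I_r) (j : 'I_s), (i.+1 >= lam j + 1)%N ->
      b j > a i - 1)
    (* abscissae of the contours of the two Mellin-Barnes integrals *)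
    (c c' : 'I_r -> R)
    (hc : forall k i : 'I_r, c k > - ashift a k i)
    (hc' : forall k i : 'I_r, c' k > - (ashift a k i - 1)) :
  (forall (k : 'I_r) (x : R), support_set s r x ->
     meijerG (c k) (fun j => (bshift lam b k j)%:C)
       (fun i => (ashift a k i)%:C) x / x%:C
     = meijerG (c' k) (fun j => (bshift lam b k j - 1)%:C)
         (fun i => (ashift a k i - 1)%:C) x)
  /\
  (* the parameters being real, so is [meijerG]; [Re] only changes the type *)
  (forall mu : 'I_r -> {measure set (measurableTypeR R) -> \bar R},
     (forall k : 'I_r, has_density (mu k) (support_set s r)
        (fun x => complex.Re (meijerG (c k) (fun j => (bshift lam b k j)%:C)
                        (fun i => (ashift a k i)%:C) x / x%:C))) ->
     forall P : nat -> {poly R},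
       r_orthogonal mu P <->
       forall (n : nat) (x : R),
         (P n).[x] =
         (-1) ^+ n * (\prod_(i < r) pochhammer (a i) n)
         / (\prod_(j < s) pochhammer (bpred r lam b n j) n)
         * hypergeometric (- n%:R :: [seq bpred r lam b n j | j : 'I_s])
             [seq a i | i : 'I_r] x).
Proof.
have r_gt0 : (0 < r)%N by rewrite lt0n; apply/eqP.
have lam_range j : (1 <= lam j <= r)%N by apply/andP; exact: hlam1.
have lam_inj : injective lam.
  move=> j1 j2 l12; apply/val_inj/eqP; rewrite eqn_leq.
  by apply/andP; split; rewrite leqNgt; apply/negP => /hlam2; rewrite l12 ltnn.
have ashiftE k i : ashift a k i = a i + (i.+1 <= k)%N%:R.
  by rewrite /ashift; case: leqP; rewrite ?addr0.
have bshiftE k j : bshift lam b k j = b j + (lam j <= k)%N%:R.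
  by rewrite /bshift; case: leqP; rewrite ?addr0.
have adm (k : 'I_r) : admissible lam (ashift a k) (bshift lam b k).
  split=> [i|i j ji]; first by rewrite ashiftE ltr_wpDr.
  by rewrite ashiftE bshiftE ji ltrD2r; apply: hab1; rewrite ji.
have G0 (k : 'I_r) x : support_set s r x ->
    meijerG (c k) (fun j => (bshift lam b k j)%:C) (fun i => (ashift a k i)%:C) x =
    (mellin_density lam (ashift a k) (bshift lam b k) (- ln x))%:C.
  move=> xS; apply: (meijerG_mellin0 lam_range lam_inj r_gt0 hsr (adm k) xS).
  by move=> i; have := hc k i; lra.
split=> [k x xS|mu muE P].
  have x0 := support_set_gt0 xS.
  rewrite G0// (meijerG_mellin lam_range lam_inj r_gt0 hsr (c := c' k) (e := - 1) (adm k) xS).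
    rewrite mulN1r !opprK expRN lnK ?posrE//.
    rewrite mulrC rmorphM /=; congr (_ * _).
    by rewrite (fmorphV (real_complex R)).
  by move=> i; have := hc' k i; lra.
pose mom := step_moment lam a b (@real_gamma R).
(* The [k] common shifts coming from [x^k] and the extra shift of the positions up to [j] are
   counted together by [steps r (r * k + j)]. *)
have momE (j : 'I_r) k m : (\prod_(i < r) real_gamma (ashift a j i + (k + m)%N%:R)) /
    (\prod_(l < s) real_gamma (bshift lam b j l + (k + m)%N%:R)) = mom (r * k + j)%N m.
  rewrite /mom /step_moment; congr (_ / _); apply: eq_bigr => i _; congr real_gamma.
    by rewrite ashiftE stepsE// ?natrD; [ring|rewrite ltn_ord].
  by rewrite bshiftE stepsE// ?natrD; ring.
have powE (j : 'I_r) k : (mu j).-integrable setT (fun x => (x ^+ k)%:E) /\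
    \int[mu j]_x (x ^+ k) = mom j k.
  have := moment_mellin lam_range lam_inj r_gt0 hsr k (adm j) (muE j).
  have -> : (\prod_(i < r) real_gamma (ashift a j i + k%:R)) /
    (\prod_(l < s) real_gamma (bshift lam b j l + k%:R)) = mom j k.
    by rewrite -[k]add0n momE muln0.
  apply=> x xS; have x0 := support_set_gt0 xS.
  rewrite G0// -(fmorphV (real_complex R)) /=; ring.
have intE (j : 'I_r) k (p : {poly R}) :
    (mu j).-integrable setT (fun x => (x ^+ k * p.[x])%:E) /\
    \int[mu j]_x (x ^+ k * p.[x]) = \sum_(i < size p) p`_i * mom (r * k + j)%N i.
  have [H1 H2] := Rintegral_horner (f := (fun x => x) : measurableTypeR R -> R) (powE j) k p; split; first exact: H1.
  rewrite H2; apply: eq_bigr => i _; congr (_ * _).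
  by rewrite -momE -[(k + i)%N]add0n momE muln0.
(* Integration against [x^k d mu_j] for [N = r k + j], written on coefficients: linearity is then
   plain algebra, and the functionals form one sequence indexed by [N]. *)
pose ell N (p : {poly R}) := \sum_(i < size p) p`_i * mom N i.
have ellE N (p : {poly R}) m : (size p <= m)%N -> ell N p = \sum_(i < m) p`_i * mom N i.
  move=> pm; rewrite /ell (big_ord_widen _ (fun i => p`_i * mom N i) pm).
  rewrite [RHS](bigID (fun i : 'I_m => (i < size p)%N))/= [X in _ + X]big1 ?addr0// => i.
  by rewrite -leqNgt => pi; rewrite nth_default ?mul0r.
have ell_linear N e p q : ell N (e *: p + q) = e * ell N p + ell N q.
  pose m := maxn (size p) (size q).
  have sm : (size (e *: p + q)%R <= m)%N.
    apply: leq_trans (size_polyD _ _) _; rewrite geq_max leq_maxr andbT.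
    by rewrite (leq_trans (size_scale_leq _ _))// leq_maxl.
  rewrite (ellE _ _ m)// (ellE _ p m) ?leq_maxl// (ellE _ q m) ?leq_maxr//.
  rewrite mulr_sumr -big_split; apply: eq_bigr => i _ /=.
  by rewrite coefD coefZ; ring.
pose Q n : {poly R} := \poly_(m < n.+1) op_coef lam a b n m.
have Qlead n : op_coef lam a b n n = 1 by exact: op_coef_monic.
have sQ n : size (Q n) = n.+1 by rewrite size_poly_eq// Qlead oner_neq0.
have Qmonic n : Q n \is monic.
  by apply/monicP; rewrite /lead_coef sQ /= coef_poly ltnSn Qlead.
have ellQ N n : ell N (Q n) = \sum_(m < n.+1) op_coef lam a b n m * mom N m.
  by rewrite /ell sQ; apply: eq_bigr => m _; rewrite coef_poly ltn_ord.
have ellQ_neq0 n : ell n (Q n) != 0.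
  rewrite ellQ; apply: op_coef_neq0 => //.
  - exact: real_gamma_gt0.
  - by move=> x; exact: real_gammaS.
have ellQ0 N n : (N < n)%N -> ell N (Q n) = 0.
  move=> Nn; rewrite ellQ; apply: op_coef_orthogonal => //.
  - exact: real_gamma_gt0.
  - by move=> x; exact: real_gammaS.
have QE n x : (Q n).[x] =
    (-1) ^+ n * (\prod_(i < r) pochhammer (a i) n)
    / (\prod_(j < s) pochhammer (bpred r lam b n j) n)
    * hypergeometric (- n%:R :: [seq bpred r lam b n j | j : 'I_s])
        [seq a i | i : 'I_r] x.
  rewrite hypergeometric_terminating mulr_sumr horner_poly; apply: eq_bigr => m _.
  rewrite mulrA; congr (_ * _); rewrite /op_coef.
  have pE k : (k <= n)%N -> \prod_(j < s) pochhammer (bpred r lam b n j) k =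
      \prod_(j < s) pochhammer (op_beta (r := r) lam b n j) k.
    (* At [n = 0] the ceiling is -1 when [lam j = r], so [bpred] and [op_beta] differ there; only
       Pochhammer symbols of order 0 occur in that case. *)
    case: n {m Qlead sQ} => [|n] in k *.
      by rewrite leqn0 => /eqP ->; apply: eq_bigr => j _; rewrite !pochhammer0.
    by move=> _; apply: eq_bigr => j _; rewrite (bpredE _ _ r_gt0 (lam_range j)) /op_beta.
  by rewrite !pE// -ltnS.
have Porth : r_orthogonal mu P <-> forall n, P n = Q n.
  split=> [[Pm _ Pn0 P0] n|PQ].
    have [Pn sP] := Pm n.
    (* Both polynomials are monic of degree [n], so their difference has size at most [n], and all
       functionals of index below [n] annihilate it. *)
    apply/eqP; rewrite -subr_eq0; apply/eqP.
    apply: (triangular_unique ell_linear sQ ellQ_neq0 ellQ0 (n := n)).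
      apply/leq_sizeP => i; rewrite leq_eqVlt => /predU1P[<-|ni].
        have /monicP := Pn; have /monicP := Qmonic n.
        by rewrite /lead_coef sQ sP coefB /= => -> ->; rewrite subrr.
      by rewrite coefB !nth_default ?sQ ?sP// subrr.
    move=> N Nn; have -> : P n - Q n = -1 *: Q n + P n by rewrite scaleN1r addrC.
    rewrite ell_linear ellQ0// mulr0 add0r.
    have jr : (N %% r < r)%N by rewrite ltn_mod.
    have := P0 (Ordinal jr) (N %/ r)%N n; rewrite /= mulnC -divn_eq addn1 => /(_ Nn).
    by have [_ ->] := intE (Ordinal jr) (N %/ r)%N (P n); rewrite /= mulnC -divn_eq.
  rewrite (funext PQ); split.
  - by move=> n; split; [exact: Qmonic|exact: sQ].
  - by move=> j k n; have [] := intE j k (Q n).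
  - move=> j k n ->; have [_ ->] := intE j k (Q (r * k + j)%N).
    exact/eqP/ellQ_neq0.
  - move=> j k n kn; have [_ ->] := intE j k (Q n).
    by apply: ellQ0; rewrite -addn1.
rewrite Porth; split=> [PQ n x|H n]; first by rewrite PQ QE.
by apply: horner_inj => x; rewrite H QE.
Qed.
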